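(* Let $s\ge0$ be a real number and let $(X,T)$ be a dynamical system with a metric $d$. Suppose there are sequences of natural numbers $(N_n)_{n\ge1}$, $(M_n)_{n\ge1}$ and continuous maps $\psi_n:[0,1]^{M_n}\to X$ such that $N_n\to+\infty$, $M_n/N_n\to s$ as $n\to\infty$, and $\|x-y\|_\infty\le d_{N_n}(\psi_n(x),\psi_n(y))$ for all $n$ and all $x,y\in[0,1]^{M_n}$. Then: (1) $\mathrm{mdim}(X,T)\ge s$; (2) for every natural number $b$ and every equivariant continuous map $\pi:(X,T)\to\left(([0,1]^b)^{\mathbb{Z}},\sigma\right)$, $\underline{\mathrm{mdim}}_{\mathrm{M}}(\pi,T,d)\ge s-b$; (3) for every dynamical system $(Y,S)$ and every equivariant continuous map $\pi:(X,T)\to(Y,S)$, $\underline{\mathrm{mdim}}_{\mathrm{M}}(\pi,T,d)\ge s-2\,\mathrm{mdim}(Y,S)$.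
   Context: $\|x\|_\infty=\max_i|x_i|$. A dynamical system is a compact metrizable space with a homeomorphism; $\sigma$ is the shift $(x_n)_n\mapsto(x_{n+1})_n$ on $([0,1]^b)^{\mathbb{Z}}$; equivariant means $\pi\circ T=S\circ\pi$. For $N\ge1$, $d_N(x,y)=\max_{0\le n<N}d(T^nx,T^ny)$; $\#(E,d_N,\varepsilon)$ is the minimal number of open sets of $d_N$-diameter $<\varepsilon$ covering $E$ ($0$ if empty). $\underline{\mathrm{mdim}}_{\mathrm{M}}(\pi,T,d)=\liminf_{\varepsilon\to0}\lim_{N\to\infty}\frac{\sup_{y\in Y}\log\#(\pi^{-1}(y),d_N,\varepsilon)}{N\log(1/\varepsilon)}$. Mean dimension: $\mathrm{Widim}_\varepsilon(X,d)$ is the minimal $n$ such that there is a continuous map from $X$ into an $n$-dimensional finite simplicial complex all of whose fibers have $d$-diameter $<\varepsilon$; $\mathrm{mdim}(X,T)=\lim_{\varepsilon\to0}\lim_{N\to\infty}\mathrm{Widim}_\varepsilon(X,d_N)/N$ (independent of the metric). *)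

(* Defs.v *)
From HB Require Import structures.
From mathcomp Require Import all_boot all_order all_algebra.
From mathcomp Require Import all_classical all_reals all_analysis.
Set Implicit Arguments. Unset Strict Implicit. Unset Printing Implicit Defensive.
Import Order.TTheory GRing.Theory Num.Theory.
Import numFieldNormedType.Exports.
Local Open Scope classical_set_scope.
Local Open Scope ring_scope.

Section Defs.
Variable R : realType.

Definition is_metric (X : Type) (d : X -> X -> R) : Prop :=
  [/\ forall x y, 0 <= d x y,
      forall x y, d x y = 0 <-> x = y,
      forall x y, d x y = d y x &
      forall x y z, d x z <= d x y + d y z].

Definition mopen (X : Type) (d : X -> X -> R) (U : set X) : Prop :=
  forall x, U x -> exists2 r, 0 < r & forall y, d x y < r -> U y.

Definition mcompact (X : Type) (d : X -> X -> R) : Prop :=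
  forall (I : Type) (U : I -> set X), (forall i, mopen d (U i)) ->
    (forall x, exists i, U i x) ->
    exists (n : nat) (f : 'I_n -> I), forall x, exists j, U (f j) x.

Definition mcont (X Y : Type) (dX : X -> X -> R) (dY : Y -> Y -> R) (f : X -> Y)
  : Prop :=
  forall x e, 0 < e -> exists2 r, 0 < r & forall y, dX x y < r -> dY (f x) (f y) < e.

Definition mcontR (X : Type) (d : X -> X -> R) (g : X -> R) : Prop :=
  mcont d (fun a b : R => `|a - b|) g.

Definition dynsys (X : Type) (d : X -> X -> R) (T : X -> X) : Prop :=
  [/\ is_metric d, mcompact d &
      exists Tinv : X -> X,
        [/\ cancel T Tinv, cancel Tinv T, mcont d d T & mcont d d Tinv]].

Definition dN (X : Type) (d : X -> X -> R) (T : X -> X) (N : nat) (x y : X) : R :=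
  \big[Num.max/0]_(n < N) d (iter n T x) (iter n T y).

(* "diameter of U is < eps" (diam U = sup of d over U x U, 0 for U empty) *)
Definition diam_lt (X : Type) (d : X -> X -> R) (U : set X) (eps : R) : Prop :=
  exists2 r, r < eps & forall x y, U x -> U y -> d x y <= r.

(* #(E, d, eps): minimal number of open sets of d-diameter < eps covering E
   (0 if E is empty; +oo if no finite such cover exists) *)
Definition covnum (X : Type) (d : X -> X -> R) (E : set X) (eps : R) : \bar R :=
  ereal_inf [set (n%:R)%:E | n in
    [set n : nat | exists U : 'I_n -> set X,
        (forall j, mopen d (U j) /\ diam_lt d (U j) eps) /\
        (forall x, E x -> exists j, U j x)]].

Definition liminf0 (g : R -> \bar R) : \bar R :=
  ereal_sup [set ereal_inf [set g e | e in [set e | 0 < e < delta]]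
            | delta in [set delta | 0 < delta]].

Definition lmdimM (X Y : Type) (Yset : set Y) (pi : X -> Y) (T : X -> X)
    (d : X -> X -> R) : \bar R :=
  liminf0 (fun eps =>
    lim ((fun N : nat =>
      (ereal_sup [set lne (covnum (dN d T N.+1) (pi @^-1` [set y]) eps)
                  | y in Yset]
       * ((N.+1%:R * ln (1 / eps))^-1)%:E)%E) @ \oo)).

Definition simpcomplex (k : nat) (K : {set {set 'I_k}}) : Prop :=
  (forall s, s \in K -> 0 < #|s|)%N /\
  (forall s t : {set 'I_k}, s \in K -> t \subset s -> (0 < #|t|)%N -> t \in K).

Definition scdim (k : nat) (K : {set {set 'I_k}}) (n : nat) : Prop :=
  (exists2 s, s \in K & #|s| = n.+1) /\ (forall s, s \in K -> #|s| <= n.+1)%N.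

Definition realization (k : nat) (K : {set {set 'I_k}}) : set ('I_k -> R) :=
  [set p | (forall i, 0 <= p i) /\ \sum_(i < k) p i = 1 /\
           finset (fun i => p i != 0) \in K].

(* Widim_eps(X, d): minimal n such that there is a continuous map from X to an
   n-dimensional finite simplicial complex all of whose fibers have
   d-diameter < eps (+oo if there is none) *)
Definition Widim (X : Type) (d : X -> X -> R) (eps : R) : \bar R :=
  ereal_inf [set (n%:R)%:E | n in
    [set n : nat | exists (k : nat) (K : {set {set 'I_k}}) (f : X -> 'I_k -> R),
       [/\ simpcomplex K, scdim K n,
           forall x, realization K (f x),
           forall i, mcontR d (fun x => f x i) &
           forall p, diam_lt d (f @^-1` [set p]) eps]]].

Definition mdim (X : Type) (T : X -> X) (d : X -> X -> R) : \bar R :=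
  lim ((fun eps : R =>
          lim ((fun N : nat => (Widim (dN d T N.+1) eps
                                * ((N.+1%:R)^-1)%:E)%E) @ \oo)) @ 0^'+).

Definition cube (M : nat) : set ('I_M -> R) :=
  [set x | forall i, 0 <= x i <= 1].

Definition supdist (M : nat) (x y : 'I_M -> R) : R :=
  \big[Num.max/0]_(i < M) `|x i - y i|.

End Defs.

(* Main.v *)
(* A parity count on a triangulated cube whose opposite faces are glued by
   signed permutations shows that a map equivariant for the gluings has an
   approximate zero.  For the gluing [x |-> - x] this is a Brouwer theorem for
   arbitrary self-maps of the cube; applied to a map defined by integer parts of
   partial sums of barycentric coordinates, it shows that a map of [[0,1]^M] with
   small fibres into a [k]-dimensional complex satisfies [M <= k], whence (1).

   For a binary tree of vectors, with gluings exchanging the two subtrees of a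
   node, it produces, given [f : R^M -> R^m] and maps [c |-> al u + H c] with [H]
   a reflection, [2 ^ h] points with nearly equal values of [f] obtained by
   composing those maps along the branches with signs [u] and [- u].  The
   average over these points of a Gaussian weight centred at any point decreases
   by [exp (- (1 - rho) / 2)] at each level, while, if the fibre of [f] through
   them were covered by few sets of diameter [eps], summing over the centres and
   their images under the reflections in the integer hyperplanes would bound it
   from below.  This gives a waist inequality: some fibre of a map
   [[0,1]^M -> R^m] needs about [eps ^ - (M - m)] sets of diameter [eps].

   It is applied to [psi_n] followed by a map [G] whose fibres lie in fibres of
   [pi] along orbits of length [N_n]; [G] has about [b N_n] coordinates in (2),
   and in (3) the [2 k + 1] moments of a map of [(Y, d_N)] to a [k]-dimensional
   complex.  Chaining uniform covers of the fibres of [pi] over blocks of fixed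
   length [L] compares the number of sets needed with the [N_n / L]-th power of
   the fibre covering number for [d_L]. *)
Require Import Defs.
From HB Require Import structures.
From mathcomp Require Import all_boot all_order all_algebra perm.
From mathcomp Require Import all_classical all_reals all_analysis.
From mathcomp Require Import zify ring lra.
Set Implicit Arguments. Unset Strict Implicit. Unset Printing Implicit Defensive.
Import Order.TTheory GRing.Theory Num.Theory.
Import numFieldNormedType.Exports.
Local Open Scope ring_scope.

(** * Relations between vectors in general position *)

(** The exponent M - m comes from how the M coordinates are spent. Equalising m functions takes a
    sphere of directions with m parameters, so m + 1 coordinates are reserved for the unit vectors
    u. Each of the other M - m - 1 coordinates is visited T times, and each visit gains exp (- (1 -
    rho) / 2). The squared scale shrinks by rho in every round, so T is about 2 ln (1 / eps) / ln (1
    / rho), and the gain per coordinate approaches ln (1 / eps) when rho tends to 1. All other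
    losses amount to a factor (8 e) ^ M, whose logarithm per unit of time is bounded and disappears
    after division by ln (1 / eps).

    The zero theorem is proved for arbitrary functions: its conclusion speaks only of signs taken at
    neighbouring grid points, coordinate by coordinate. This allows maps built from integer parts.
    The parity count is made on a prism over the cube, joining the given map to a perturbation of
    the identity that has exactly one zero. *)

Lemma addb_involution (T : finType) (P Z : pred T) (b : T -> T) :
  (forall x, P x -> P (b x)) -> (forall x, P x -> b (b x) = x) ->
  (forall x, P x -> b x != x) -> (forall x, P x -> Z (b x) = Z x) ->
  \big[addb/false]_(x | P x) Z x = false.
Proof.
move=> Pb bK bx Zb.
rewrite (bigID (fun x => enum_rank x < enum_rank (b x))%N) /=.
rewrite [X in _ (+) X](reindex_onto b b) /=; last by move=> x /andP[/bK].
rewrite [X in _ (+) X](_ : _ =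
  \big[addb/false]_(i | P i && (enum_rank i < enum_rank (b i))%N) Z i) ?addbb //.
apply: eq_big => x.
  case Px: (P x) => /=.
    rewrite Pb //= bK // eqxx andbT ltnNge negbK leq_eqVlt.
    by rewrite (inj_eq val_inj) (inj_eq enum_rank_inj) eq_sym (negPf (bx _ Px)).
  apply/negbTE; rewrite !negb_and.
  case: (boolP (P (b x))) => //= Pbx; apply/orP; right.
  by apply/eqP => e; move: (Pb _ Pbx); rewrite e Px.
move=> /andP[/andP[Pbx _] /eqP e]; rewrite Zb //.
by move: (Pb _ Pbx); rewrite e.
Qed.

Section ZeroFacets.
Variables (R : realFieldType) (I : finType).

Definition relation_of (n : nat) (v : 'I_n -> I -> R) (a : 'I_n -> R) : Prop :=
  forall i, \sum_j a j * v j i = 0.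

(** The origin lies in the convex hull of the vectors other than [v k]. *)
Definition zero_facet (n : nat) (v : 'I_n -> I -> R) (k : 'I_n) : Prop :=
  exists a, [/\ a k = 0, forall j, 0 <= a j, \sum_j a j = 1 & relation_of v a].

(** For D + 2 vectors in dimension D: any D of them are linearly independent. *)
Definition in_general_position (n : nat) (v : 'I_n -> I -> R) : Prop :=
  forall a (k l : 'I_n), k != l -> a k = 0 -> a l = 0 -> relation_of v a ->
  forall j, a j = 0.

Lemma relation_comb n (v : 'I_n -> I -> R) a b x y :
  relation_of v a -> relation_of v b -> relation_of v (fun j => x * a j + y * b j).
Proof.
move=> ha hb i.
under eq_bigr do rewrite mulrDl -!mulrA.
by rewrite big_split -!mulr_sumr /= ha hb !mulr0 addr0.
Qed.

Lemma dependent_family (v : 'I_#|I|.+1 -> I -> R) :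
  exists2 a, relation_of v a & exists j, a j != 0.
Proof.
pose A : 'M[R]_(#|I|.+1, #|I|) := \matrix_(j, i) v j (enum_val i).
have : kermx A != 0.
  rewrite kermx_eq0 /row_free neq_ltn.
  by rewrite (leq_ltn_trans (rank_leq_col A)).
move=> /rowV0Pn[u /sub_kermxP uA u0].
exists (fun j => u 0 j).
  move=> i; have := congr1 (fun B : 'rV_ _ => B 0 (enum_rank i)) uA.
  rewrite !mxE => e; rewrite -[RHS]e; apply: eq_bigr => j _; rewrite !mxE.
  by rewrite enum_rankK.
apply/existsP; apply: contra_neqT u0 => /existsPn h.
by apply/rowP => j; rewrite mxE; apply/eqP; move: (h j); rewrite negbK.
Qed.

Lemma general_position_relation n (v : 'I_n.+2 -> I -> R) j0 k :
  #|I| = n -> in_general_position v -> j0 != k ->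
  exists b, [/\ relation_of v b, b j0 = 0 & b k = 1].
Proof.
move=> In gv j0k; subst n.
have [a ra [j aj]] := dependent_family (fun j => v (lift j0 j)).
pose b j := if unlift j0 j is Some i then a i else 0.
have rb : relation_of v b.
  move=> i; rewrite (bigD1 j0) //= /b unlift_none mul0r add0r.
  rewrite -[RHS](ra i) (reindex_onto (lift j0) (fun j => odflt ord0 (unlift j0 j))) /=.
    apply: eq_big => [t|t _]; rewrite ?liftK //.
    by rewrite eq_sym neq_lift eqxx.
  by move=> t; rewrite eq_sym => /unlift_some[u -> ->].
have bj : b (lift j0 j) != 0 by rewrite /b liftK.
have bk : b k != 0.
  apply: contra_neq bj => bk.
  by apply: (gv b k j0) => //; rewrite 1?eq_sym // /b unlift_none.
exists (fun j => (b k)^-1 * b j + 0 * b j); split; first exact: relation_comb.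
  by rewrite /b unlift_none !mulr0 addr0.
by rewrite mul0r addr0 mulVf.
Qed.

(* The nonnegative relations form a pointed two-dimensional cone, and the zero
   facets are its two extreme rays. *)
Lemma zero_facets_even n (v : 'I_n.+2 -> I -> R) :
  #|I| = n -> in_general_position v ->
  \big[addb/false]_k `[< zero_facet v k >] = false.
Proof.
move=> In gv.
have [/existsP[k /asboolP[a [ak age a1 ra]]]|/existsPn no] :=
    boolP [exists k, `[< zero_facet v k >]]; last first.
  by rewrite big1 // => k _; exact/negbTE/no.
have nontriv c j : relation_of v c -> c j != 0 ->
    forall t u, t != u -> c t = 0 -> c u != 0.
  move=> rc cj t u tu ct; apply: contra_neq cj => cu; exact: (gv c t u).
have apos j : j != k -> 0 < a j.
  move=> jk; rewrite lt0r age andbT.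
  have [i ai] : exists i, a i != 0.
    apply/existsP; apply: contra_eqT a1 => /existsPn h.
    rewrite big1 => [|i _]; first by rewrite eq_sym oner_neq0.
    by apply/eqP; move: (h i); rewrite negbK.
  by apply: (nontriv a i ra ai k j) => //; rewrite eq_sym.
have [j0 j0k] : exists j0, j0 != k.
  by exists (if k == ord0 then ord_max else ord0); case: ifP => [/eqP->|/negbT]; rewrite eq_sym.
have [b [rb _ bk]] := general_position_relation In gv j0k.
(* [r l] is the least multiple of [a] which, added to [b], makes it nonnegative; the sum [c] loses
   the coefficient [l] and spans the second extreme ray. *)
pose r j := - b j / a j.
have [l lk lmax] : exists2 l, l != k & forall j, j != k -> r j <= r l.
  have [l lk h] := @Order.TotalTheory.arg_maxP _ _ _ j0 (predC1 k) r j0k.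
  by exists l => // j /h.
pose c j := r l * a j + 1 * b j.
have rc : relation_of v c by exact: relation_comb.
have ck : c k = 1 by rewrite /c ak bk mulr0 add0r mulr1.
have cl : c l = 0.
  by rewrite /c /r; field; rewrite gt_eqF ?apos.
have cge j : 0 <= c j.
  have [->|jk] := eqVneq j k; first by rewrite ck.
  have := lmax j jk; rewrite {1}/r ler_pdivrMr ?apos // /c; lra.
have zk : zero_facet v k by exists a.
have zl : zero_facet v l.
  have s0 : 0 < \sum_j c j.
    rewrite (bigD1 k) //= ck ltr_pwDl // sumr_ge0 //.
  exists (fun j => (\sum_j c j)^-1 * c j + 0 * c j); split.
  - by rewrite cl !mulr0 addr0.
  - by move=> j; rewrite mul0r addr0 mulr_ge0 // invr_ge0 ltW.
  - by rewrite (eq_bigr (fun j => (\sum_j c j)^-1 * c j)) -?mulr_sumr ?mulVf ?gt_eqF // => j _; rewrite mul0r addr0.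
  - exact: relation_comb.
(* A relation [m] vanishing at [l'] equals [m k] times [r l' * a + b], since the difference vanishes
   at [k] and [l']. Nonnegativity at [l] forces [r l' = r l], and then [c] would vanish at both [l]
   and [l']. *)
have uniq l' : l' != k -> zero_facet v l' -> l' = l.
  move=> l'k [m [ml' mge m1 rm]].
  have mk : 0 < m k.
    rewrite lt0r mge andbT.
    have [i mi] : exists i, m i != 0.
      apply/existsP; apply: contra_eqT m1 => /existsPn h.
      rewrite big1 => [|i _]; first by rewrite eq_sym oner_neq0.
    by apply/eqP; move: (h i); rewrite negbK.
    exact: (nontriv m i rm mi l' k).
  have al' := apos _ l'k.
  have al := apos _ lk.
  pose x := m k * r l'.
  pose nu j := 1 * m j + (-1) * (x * a j + m k * b j).
  have rnu : relation_of v nu by do 2 apply: relation_comb => //.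
  have nuk : nu k = 0 by rewrite /nu ak bk; ring.
  have nul' : nu l' = 0.
    by rewrite /nu /x /r ml'; field; rewrite gt_eqF.
  have nu0 := gv nu l' k l'k nul' nuk rnu.
  have : r l <= r l'.
    have := mge l; have := nu0 l; rewrite /nu /x => e h.
    have h2 : 0 <= m k * (r l' * a l + b l).
      suff -> : m k * (r l' * a l + b l) = m l by [].
      by apply/eqP; rewrite -subr_eq0 -oppr_eq0; apply/eqP; rewrite -[RHS]e; ring.
    rewrite {1}/r ler_pdivrMr //.
    move: h2; rewrite pmulr_rge0 // -[X in _ -> X <= _]add0r lerBlDr //.
  move=> h; have e : r l' = r l by apply/eqP; rewrite eq_le h lmax.
  apply/eqP; apply: contraTT isT => ll' /=.
  have cl' : c l' = 0 by rewrite /c -e /r; field; rewrite gt_eqF.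
  have := gv c l' l ll' cl' cl rc k; rewrite ck => /eqP; by rewrite oner_eq0.
rewrite (bigD1 k) //= (bigD1 l) //= (asboolT zk) (asboolT zl).
rewrite big1 // => i /andP[ik il]; apply: asboolF => zi.
by move: il; rewrite (uniq i) // eqxx.
Qed.

End ZeroFacets.

(** * A triangulated cube with glued faces *)

Definition sgz_of (b : bool) : int := if b then 1 else -1.

Ltac ord_lia :=
  repeat match goal with |- context [nat_of_ord ?x] => move: (nat_of_ord x) => ? end;
  clear; intros; lia.

Section Triangulation.
Variables (R : realFieldType) (I : finType) (N : nat).
Variables (p : I -> I -> I) (e : I -> I -> bool).
Variables (can : (I -> int) -> I -> int) (gp : (I -> int) -> I -> I).
Variable (ge : (I -> int) -> I -> bool).
Notation D := #|I|.
Notation twoN := (2 * N%:Z).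

(** Barycentric subdivision of the cubes of side 2 that tile the prism [-2N, 2N]^I x [0, 2], [None]
    being the time coordinate. A simplex is a flag of faces: a cube, one of its corners, and the
    order in which coordinates move from the corner to the centre. Space coordinates of centres are
    odd, those of corners even. *)
Definition simplex : Type :=
  ({ffun I -> 'I_(2 * N)} * {ffun option I -> bool} *
   {ffun option I -> 'I_D.+1})%type.
HB.instance Definition _ := Finite.on simplex.

Implicit Types (s : simplex) (j : option I) (k : 'I_D.+2).

Definition center s j : int :=
  if j is Some i then 2 * (s.1.1 i)%:Z + 1 - twoN else 1.
Definition corner s j : int := center s j + sgz_of (s.1.2 j).
Definition rank s j : nat := s.2 j.
Definition vert s (k : nat) j : int :=
  if (rank s j < k)%N then center s j else corner s j.
Definition valid s : bool := injectiveb s.2.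

Definition space (v : option I -> int) : I -> int := fun i => v (Some i).

Definition glue (i : I) (x : I -> int) : I -> int :=
  fun i' => if e i i' then - x (p i i') else x (p i i').

Hypothesis pK : forall i, involutive (p i).
Hypothesis pii : forall i, p i i = i.
Hypothesis eii : forall i, e i i.
Hypothesis ep : forall i i', e i (p i i') = e i i'.
Hypothesis can_glue : forall i x, (forall i', `|x i'| <= twoN) ->
  `|x i| = twoN -> can (glue i x) = can x.
Hypothesis gp_glue : forall i x i', (forall i', `|x i'| <= twoN) ->
  `|x i| = twoN -> gp (glue i x) i' = gp x (p i i').
Hypothesis ge_glue : forall i x i', (forall i', `|x i'| <= twoN) ->
  `|x i| = twoN -> ge (glue i x) i' = e i i' (+) ge x (p i i').

Definition sgr (b : bool) : R := if b then -1 else 1.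

(** Equivariance is built in: the free data [w] is read at the representative [can] of the gluing
    class and carried back by the signed permutation [(gp, ge)]. *)
Definition val_at (w : (I -> int) -> int -> I -> R) (v : option I -> int) : I -> R :=
  fun i => sgr (ge (space v) i) * w (can (space v)) (v None) (gp (space v) i).

Definition cell (w : (I -> int) -> int -> I -> R) s : 'I_D.+2 -> I -> R :=
  fun k => val_at w (vert s k).

Definition at_rank s (r : nat) : option I := odflt None [pick j | rank s j == r].

Lemma rankK s (r : nat) : valid s -> (r <= D)%N -> rank s (at_rank s r) = r.
Proof.
move=> /injectiveP inj rD; rewrite /at_rank; case: pickP => [j /eqP //|no].
have [g _ gK] : bijective s.2.
  by apply: inj_card_bij => //; rewrite card_ord card_option.
have := no (g (Ordinal (rD : (r < D.+1)%N))); by rewrite /rank gK eqxx.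
Qed.

Lemma rank_inj s j j' : valid s -> rank s j = rank s j' -> j = j'.
Proof. by move=> /injectiveP inj /val_inj /inj. Qed.

Definition flip_sign s j0 : simplex :=
  (s.1.1, [ffun j => if j == j0 then ~~ s.1.2 j else s.1.2 j], s.2).
Definition swap_rank s (r : nat) : simplex :=
  (s.1, [ffun j => tperm (inord r.-1) (inord r) (s.2 j)]).
Definition cross s (i : I) : simplex :=
  ([ffun i' => if i' == i then
      insubd (s.1.1 i) (if s.1.2 (Some i) then (s.1.1 i).+1 else (s.1.1 i).-1)
    else s.1.1 i'], (flip_sign s (Some i)).1.2, s.2).
Definition glue_simplex s (i : I) : simplex :=
  ([ffun i' => if e i i' then rev_ord (s.1.1 (p i i')) else s.1.1 (p i i')],
   [ffun j => if j is Some i' then s.1.2 (Some (p i i')) (+) e i i'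
              else s.1.2 None],
   [ffun j => s.2 (omap (p i) j)]).

(** The simplex across the facet opposite vertex [k]: the other end of an edge, the other order of
    two consecutive coordinates, or the next cube; at the side of the prism the next cube is the one
    provided by the gluing. *)
Definition pivot (x : simplex * 'I_D.+2) : simplex * 'I_D.+2 :=
  ((if x.2 == ord0 then flip_sign x.1 (at_rank x.1 0)
    else if (x.2 < D.+1)%N then swap_rank x.1 x.2
    else if at_rank x.1 D is Some i then
      if `|corner x.1 (Some i)| < twoN then cross x.1 i else glue_simplex x.1 i
    else x.1), x.2).

(** The facets left out lie in the bottom or the top of the prism: there time is the last coordinate
    to move. *)
Definition interior_facet (x : simplex * 'I_D.+2) : bool :=
  valid x.1 && ~~ ((x.2 == ord_max) && (at_rank x.1 D == None)).

Lemma simplex_eq s s' : (forall i, s.1.1 i = s'.1.1 i) ->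
  (forall j, s.1.2 j = s'.1.2 j) -> (forall j, s.2 j = s'.2 j) -> s = s'.
Proof.
case: s s' => [[c b] r] [[c' b'] r'] /= h1 h2 h3.
by congr (_, _, _); apply/ffunP.
Qed.

Lemma rank_at_rank s j r : valid s -> (r <= D)%N -> rank s j = r -> at_rank s r = j.
Proof. by move=> vs rD h; apply: (rank_inj vs); rewrite rankK. Qed.

Lemma rank_le s j : (rank s j <= D)%N.
Proof. by rewrite /rank -ltnS. Qed.

Lemma rank_swap s (k : nat) j : (0 < k <= D)%N ->
  rank (swap_rank s k) j =
  if rank s j == k.-1 then k else if rank s j == k then k.-1 else rank s j.
Proof.
move=> /andP[k0 kD]; rewrite /rank /= ffunE.
have k1 : (k.-1 < D.+1)%N by lia.
rewrite permE /= -!val_eqE /= !inordK //.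
by case: ifP => _; rewrite ?inordK //; case: ifP => _; rewrite ?inordK.
Qed.

Lemma valid_swap s k : valid s -> valid (swap_rank s k).
Proof.
move=> /injectiveP inj; apply/injectiveP => j j'; rewrite !ffunE => /perm_inj.
exact: inj.
Qed.

Lemma pii_omap i j : omap (p i) (omap (p i) j) = j.
Proof. by case: j => //= i'; rewrite pK. Qed.

Lemma valid_glue s i : valid s -> valid (glue_simplex s i).
Proof.
move=> /injectiveP inj; apply/injectiveP => j j'; rewrite !ffunE => /inj h.
by rewrite -[j](pii_omap i) h pii_omap.
Qed.

Lemma rank_glue s i j : rank (glue_simplex s i) j = rank s (omap (p i) j).
Proof. by rewrite /rank ffunE. Qed.

Lemma at_rank_glue s i : valid s -> at_rank s D = Some i ->
  at_rank (glue_simplex s i) D = Some i.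
Proof.
move=> vs h; apply: rank_at_rank => //; first exact: valid_glue.
by rewrite rank_glue /= pii -h rankK.
Qed.

Lemma center_glue s i j : center (glue_simplex s i) j =
  if j is Some i' then
    if e i i' then - center s (Some (p i i')) else center s (Some (p i i'))
  else center s None.
Proof.
case: j => [i'|//]; rewrite /center ffunE; case: (e i i') => //=.
move: (ltn_ord (s.1.1 (p i i'))); ord_lia.
Qed.

Lemma corner_glue s i j : corner (glue_simplex s i) j =
  if j is Some i' then
    if e i i' then - corner s (Some (p i i')) else corner s (Some (p i i'))
  else corner s None.
Proof.
rewrite /corner center_glue /= ffunE; case: j => [i'|] //.
by case: (e i i') => /=; case: (s.1.2 _); rewrite /sgz_of /=; lia.
Qed.

Lemma vert_glue s i k j : vert (glue_simplex s i) k j =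
  if j is Some i' then
    if e i i' then - vert s k (Some (p i i')) else vert s k (Some (p i i'))
  else vert s k None.
Proof.
rewrite /vert rank_glue center_glue corner_glue; case: j => [i'|] //=.
by case: ifP; case: ifP.
Qed.

Lemma crossable s i : `|corner s (Some i)| < twoN ->
  ((if s.1.2 (Some i) then (s.1.1 i).+1 else (s.1.1 i).-1) < 2 * N)%N /\
  (s.1.2 (Some i) = false -> (0 < s.1.1 i)%N).
Proof.
rewrite /corner /center /sgz_of; have := ltn_ord (s.1.1 i).
case: (s.1.2 _) => /=; ord_lia.
Qed.

Lemma center_cross s i j : `|corner s (Some i)| < twoN ->
  center (cross s i) j =
  if j == Some i then center s j + 2 * sgz_of (s.1.2 j) else center s j.
Proof.
move=> h; have [h1 h2] := crossable h.
case: j => [i'|] //=; rewrite /cross /center /= ffunE (inj_eq Some_inj).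
case: eqP => [->|//]; rewrite val_insubd h1 /sgz_of.
move: h2; case: (s.1.2 _) => [_|/(_ erefl)]; ord_lia.
Qed.

Lemma corner_cross s i j : `|corner s (Some i)| < twoN ->
  corner (cross s i) j = corner s j.
Proof.
move=> h; rewrite {1}/corner center_cross // /corner /= ffunE.
case: eqP => // ->; rewrite /sgz_of; case: (s.1.2 _) => /=; lia.
Qed.

Lemma crossK s i : `|corner s (Some i)| < twoN -> cross (cross s i) i = s.
Proof.
move=> h; have [h1 h2] := crossable h.
apply: simplex_eq => [i'|j|//]; rewrite /= !ffunE.
  case: eqP => [->|//]; rewrite eqxx; apply: val_inj; rewrite val_insubd /=.
  rewrite val_insubd h1 /=; rewrite eqxx.
  move: (ltn_ord (s.1.1 i)) h2.
  case: (s.1.2 _) => h3 => [_|/(_ erefl)]; move: h3; case: ifP => /=; ord_lia.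
by case: eqP; rewrite ?negbK.
Qed.

Lemma glue_simplexK s i : valid s -> glue_simplex (glue_simplex s i) i = s.
Proof.
move=> vs; apply: simplex_eq => [i'|j|j]; rewrite /= !ffunE.
- rewrite pK ep; case: (e i i') => //; exact: rev_ordK.
- by case: j => [i'|//]; rewrite ffunE pK ep -addbA addbb addbF.
- by rewrite pii_omap.
Qed.

Lemma pivot_interior x : interior_facet x -> interior_facet (pivot x).
Proof.
case: x => s k /andP[/= vs hk]; rewrite /interior_facet /pivot /=.
have [->|k0] := eqVneq k ord0; first by apply/andP; split; [exact: vs|].
case: ltnP => kD.
  rewrite valid_swap //= negb_and; apply/orP; left.
  by rewrite -val_eqE /= neq_ltn kD.
have ek : k = ord_max by apply/val_inj/eqP; rewrite eqn_leq kD andbT -ltnS ltn_ord.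
move: hk; rewrite ek eqxx /=.
case E : (at_rank s D) => [i|//] _.
case: ifP => _; first by apply/andP; split; [exact: vs|rewrite (_ : at_rank _ D = Some i)].
by rewrite valid_glue //= at_rank_glue.
Qed.

Lemma pivotK x : interior_facet x -> pivot (pivot x) = x.
Proof.
case: x => s k /andP[/= vs hk]; rewrite /pivot /=.
have [->|k0] := eqVneq k ord0.
  congr (_, _); apply: simplex_eq => // j; rewrite /= !ffunE.
  by case: eqP; rewrite ?negbK.
case: ltnP => kD.
  congr (_, _); apply: simplex_eq => // j; rewrite /= !ffunE.
  exact: tpermK.
have ek : k = ord_max by apply/val_inj/eqP; rewrite eqn_leq kD andbT -ltnS ltn_ord.
move: hk; rewrite ek eqxx /=.
case E : (at_rank s D) => [i|//] _.
case: ifP => hc.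
  have -> : at_rank (cross s i) D = Some i by rewrite -E.
  by rewrite corner_cross // hc crossK.
rewrite at_rank_glue // corner_glue eii pii normrN hc.
by rewrite glue_simplexK.
Qed.

Lemma pivot_neq x : interior_facet x -> pivot x != x.
Proof.
case: x => s k /andP[/= vs hk]; rewrite /pivot /=.
have [->|k0] := eqVneq k ord0.
  apply/eqP => /(congr1 (fun x : simplex * 'I_D.+2 => x.1.1.2 (at_rank s 0))) /=.
  by rewrite ffunE eqxx; case: (s.1.2 _).
case: ltnP => kD.
  apply/eqP => /(congr1 (fun x : simplex * 'I_D.+2 => rank x.1 (at_rank s k))) /=.
  have hkD : (0 < k <= D)%N by rewrite -[(k <= D)%N]ltnS kD andbT lt0n.
  rewrite rank_swap // rankK ?(andP hkD).2 // eqxx.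
  move: hkD; case: eqP => h1; move: h1; ord_lia.
have ek : k = ord_max by apply/val_inj/eqP; rewrite eqn_leq kD andbT -ltnS ltn_ord.
move: hk; rewrite ek eqxx /=.
case E : (at_rank s D) => [i|//] _.
apply/eqP; case: ifP => hc /(congr1 (fun x : simplex * 'I_D.+2 => x.1.1.2 (Some i))) /=; rewrite ffunE.
  by rewrite eqxx; case: (s.1.2 _).
by rewrite pii eii addbT; case: (s.1.2 _).
Qed.

Lemma vert_box s k i : `|vert s k (Some i)| <= twoN.
Proof.
rewrite /vert /corner /center /sgz_of; have := ltn_ord (s.1.1 i).
case: ifP => _; last (case: (s.1.2 _)); ord_lia.
Qed.

Lemma zero_facet_transfer (v v' : 'I_D.+2 -> I -> R) k (q : I -> I) (sg : I -> bool) :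
  (forall k', k' != k -> forall i, v' k' i = sgr (sg i) * v k' (q i)) ->
  zero_facet v k -> zero_facet v' k.
Proof.
move=> h [a [ak age a1 ra]]; exists a; split => // i.
rewrite (eq_bigr (fun t => sgr (sg i) * (a t * v t (q i)))).
  by rewrite -mulr_sumr ra mulr0.
move=> t _; have [->|tk] := eqVneq t k; first by rewrite ak !mul0r mulr0.
by rewrite h // mulrCA.
Qed.

Lemma zero_facet_pivot w x : interior_facet x ->
  zero_facet (cell w x.1) x.2 -> zero_facet (cell w (pivot x).1) (pivot x).2.
Proof.
case: x => s k /andP[/= vs hk].
have same s' : (forall k' : 'I_D.+2, k' != k -> vert s' k' = vert s k') ->
    zero_facet (cell w s) k -> zero_facet (cell w s') k.
  move=> h; apply: (@zero_facet_transfer _ _ _ id (fun=> false)) => k' k'k i.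
  by rewrite /cell h // mul1r.
rewrite /pivot /=; have [e0|k0] := eqVneq k ord0.
  apply: same => k' k'k; apply: funext => j.
  rewrite /vert /corner /rank /= ffunE.
  case: eqP => // ->; move: (rankK vs (leq0n D)); rewrite /rank => ->.
  by have -> : (0 < k')%N by move: k'k; rewrite e0 -val_eqE /= lt0n.
case: ltnP => kD.
  apply: same => k' k'k; apply: funext => j; rewrite /vert.
  have hkD : (0 < k <= D)%N by rewrite -[(k <= D)%N]ltnS kD andbT lt0n.
  have -> : (rank (swap_rank s k) j < k')%N = (rank s j < k')%N.
    rewrite rank_swap //; move: k'k; rewrite -val_eqE /=.
    move: hkD; case: (rank s j =P k.-1) => [->|_]; first by ord_lia.
    case: (rank s j =P k) => [->|_]; ord_lia.
  by [].
have ek : k = ord_max by apply/val_inj/eqP; rewrite eqn_leq kD andbT -ltnS ltn_ord.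
move: hk; rewrite {1}ek eqxx /=.
case E : (at_rank s D) => [i|//] _.
have rkD : rank s (Some i) = D by rewrite -E rankK.
have k'D k' : k' != k -> (k' <= D)%N.
  by rewrite ek -val_eqE /= -ltnS ltn_neqAle -ltnS ltn_ord andbT.
case: ifP => hc.
  apply: same => k' /k'D hk'; apply: funext => j; rewrite /vert corner_cross //.
  rewrite center_cross // [rank (cross s i) j](_ : _ = rank s j) //.
  case: eqP => // ->; by rewrite rkD ltnNge hk'.
apply: (@zero_facet_transfer _ _ _ (p i) (e i)) => k' /k'D hk' i'.
have bx i1 : `|space (vert s k') i1| <= twoN by apply: vert_box.
have bi : `|space (vert s k') i| = twoN.
  rewrite /space /vert rkD ltnNge hk' /=; apply/eqP; rewrite eq_le.
  by rewrite [X in _ && X]leNgt hc andbT; have := vert_box s 0 i; rewrite /vert ltn0.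
have es : space (vert (glue_simplex s i) k') = glue i (space (vert s k')).
  by apply: funext => i1; rewrite /space vert_glue.
rewrite /cell /val_at es can_glue // gp_glue // ge_glue // vert_glue.
rewrite mulrA; congr (_ * _).
by rewrite /sgr; case: (e i i'); case: (ge _ _); rewrite /= ?mulrNN ?mulr1 ?mul1r.
Qed.

(** Each simplex has an even number of zero facets, and those counted by [interior_facet] pair off
    under [pivot]. *)
Lemma boundary_facets_even w :
  (forall s, valid s -> in_general_position (cell w s)) ->
  \big[addb/false]_(s | valid s && (at_rank s D == None))
     `[< zero_facet (cell w s) ord_max >] = false.
Proof.
move=> gen.
pose Z (x : simplex * 'I_D.+2) := `[< zero_facet (cell w x.1) x.2 >].
have tot : \big[addb/false]_(x : simplex * 'I_D.+2 | valid x.1) Z x = false.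
  transitivity (\big[addb/false]_(s | valid s) \big[addb/false]_k Z (s, k)).
    by rewrite pair_big_dep /=; apply: eq_big => [[s k]|[s k] _] //=; rewrite andbT.
  by rewrite big1 // => s vs; exact: (zero_facets_even erefl (gen s vs)).
have int : \big[addb/false]_(x | interior_facet x) Z x = false.
  apply: (@addb_involution _ _ _ pivot).
  - exact: pivot_interior.
  - exact: pivotK.
  - exact: pivot_neq.
  move=> x ix; apply/asboolP/asboolP => h; last exact: zero_facet_pivot.
  by rewrite -(pivotK ix); apply: zero_facet_pivot => //; exact: pivot_interior.
move: tot; rewrite (bigID interior_facet) /=.
rewrite (eq_bigl interior_facet) ?int; last first.
  by move=> x; rewrite /interior_facet; case: (valid x.1).
rewrite addFb => tot; rewrite -[RHS]tot.
rewrite [RHS](reindex_onto (fun s : simplex => (s, ord_max)) fst) /=.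
  by apply: eq_bigl => s; rewrite /interior_facet /= !eqxx andbT; case: (valid s) => //=; rewrite negbK.
move=> [s k] /= /andP[vs]; rewrite /interior_facet vs /= negbK.
by move=> /andP[/eqP -> _].
Qed.

End Triangulation.

(** * Generic perturbations *)

(** The product of the polynomials has fewer roots than its size, which is the number of candidates
    [kappa / (i + 1)]. *)
Lemma small_nonroot (R : realFieldType) (ps : seq {poly R}) (kappa : R) :
  0 < kappa -> (forall q, q \in ps -> q != 0) ->
  exists t, [/\ 0 < t, t <= kappa & forall q, q \in ps -> q.[t] != 0].
Proof.
move=> k0 ps0; pose q := \prod_(r <- ps) r.
have q0 : q != 0.
  by rewrite prodf_seq_neq0; apply/allP => r rps /=; apply: ps0.
pose rs := [seq kappa / i.+1%:R | i <- iota 0 (size q)].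
have urs : uniq rs.
  rewrite map_inj_uniq ?iota_uniq // => i j /(mulfI (lt0r_neq0 k0)) /invr_inj.
  by move=> /eqP; rewrite eqr_nat eqSS => /eqP.
have [/allP all_roots|/allPn[t]] := boolP (all (root q) rs).
  have : (size rs < size q)%N by apply: max_poly_roots => //; apply/allP.
  by rewrite size_map size_iota ltnn.
move=> /mapP[i _ ->]; rewrite rootE horner_prod => nz.
exists (kappa / i.+1%:R); split.
- by rewrite divr_gt0.
- by rewrite ler_pdivrMr // ler_peMr ?ler1n // ltW.
move=> r rps; apply: contra nz => /eqP r0; apply/eqP.
by rewrite (big_rem r) //= r0 mul0r.
Qed.

Section Generic.
Variables (R : realFieldType) (I : finType) (N : nat).
Variables (can : (I -> int) -> I -> int) (gp : (I -> int) -> I -> I).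
Variable (ge : (I -> int) -> I -> bool).
Notation D := #|I|.
Notation twoN := (2 * N%:Z).
Notation cellw := (cell can gp ge).
Notation simplex := (simplex I N).

Hypothesis gp_inj : forall x, injective (gp x).
Hypothesis can_inj : forall x y, (forall i, `|x i| <= twoN) ->
  (forall i, `|y i| <= twoN) -> (forall i, `|x i - y i| <= 1) ->
  can x = can y -> x = y.

Lemma vert_near (s : simplex) k k' j : `|vert s k j - vert s k' j| <= 1.
Proof.
rewrite /vert /corner /sgz_of; move: (center s j) (s.1.2 j) => a b.
by case: (_ < k)%N; case: (_ < k')%N; case: b; clear; lia.
Qed.

Lemma vert_inj (s : simplex) (k k' : 'I_D.+2) : valid s ->
  vert s k = vert s k' -> k = k'.
Proof.
move=> vs; wlog kk' : k k' / (k <= k')%N.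
  move=> h e; case/orP: (leq_total k k') => le; first exact: h.
  by apply/esym/h.
move=> e; apply: val_inj; apply/eqP; rewrite eqn_leq kk' /= leqNgt; apply/negP => lt.
have kD : (k <= D)%N by rewrite -ltnS; apply: leq_trans lt _; rewrite -ltnS.
have := congr1 (fun f => f (at_rank s k)) e.
rewrite /vert rankK // ltnn lt /corner /sgz_of.
move: (center _ _) (s.1.2 _) => a b; case: b; clear; lia.
Qed.

Definition minor_mx (w : (I -> int) -> int -> I -> R)
    (c : simplex * 'I_D.+2 * 'I_D.+1) : 'M[R]_D :=
  \matrix_(a, i) cellw w c.1.1 (lift c.1.2 (lift c.2 a)) (enum_val i).

Lemma cell_lin (w z : (I -> int) -> int -> I -> R) t (s : simplex) k i :
  cellw (fun x tau i => w x tau i + t * z x tau i) s k i =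
  cellw w s k i + t * cellw z s k i.
Proof. by rewrite /cell /val_at; ring. Qed.

Lemma minors_general_position (w : (I -> int) -> int -> I -> R) (s : simplex) :
  (forall k l, \det (minor_mx w (s, k, l)) != 0) ->
  in_general_position (cellw w s).
Proof.
move=> nz a k l0 kl ak al ra j.
have [l def_l _] : {l | l0 = lift k l & unlift k l0 = Some l} by apply: unlift_some.
pose u : 'rV[R]_D := \row_b a (lift k (lift l b)).
have [->//|jk] := eqVneq j k.
have [j1 -> _] : {j1 | j = lift k j1 & unlift k j = Some j1}.
  by apply: unlift_some; rewrite eq_sym.
have [->|jl] := eqVneq j1 l; first by rewrite -def_l.
have [b -> _] : {b | j1 = lift l b & unlift l j1 = Some b}.
  by apply: unlift_some; rewrite eq_sym.
suff u0 : u = 0 by have := congr1 (fun M : 'rV_ _ => M 0 b) u0; rewrite !mxE.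
have uA : u *m minor_mx w (s, k, l) = 0.
  apply/rowP => i; rewrite !mxE -[RHS](ra (enum_val i)).
  rewrite [RHS](bigD1 k) //= ak mul0r add0r.
  rewrite [RHS](reindex_onto (lift k) (fun j => odflt ord0 (unlift k j))) /=; last first.
    by move=> t; rewrite eq_sym => /unlift_some[v -> ->].
  rewrite [RHS](eq_bigl xpredT); last first.
    by move=> t; rewrite liftK eqxx andbT eq_sym neq_lift.
  rewrite [RHS](bigD1 l) //= -def_l al mul0r add0r.
  pose dflt : 'I_D := i.
  rewrite [RHS](reindex_onto (lift l) (fun j => odflt dflt (unlift l j))) /=; last first.
    by move=> t; rewrite eq_sym => /unlift_some[v -> ->].
  apply: eq_big => [t|t _]; first by rewrite liftK eqxx andbT eq_sym neq_lift.
  by rewrite !mxE.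
have uu : minor_mx w (s, k, l) \in unitmx by rewrite unitmxE unitfE.
by rewrite -[u](mulmxK uu) uA mul0mx.
Qed.

(** A direction of perturbation that makes the minor [c] the identity. It is well defined because
    distinct vertices of a simplex differ in their canonical representatives or in their times. *)
Definition probe (c : simplex * 'I_D.+2 * 'I_D.+1) (x : I -> int) (tau : int) : I -> R :=
  fun i =>
  if [pick a : 'I_D |
        `[< x = can (space (vert c.1.1 (lift c.1.2 (lift c.2 a)))) /\
            tau = vert c.1.1 (lift c.1.2 (lift c.2 a)) None >]] is Some a then
    let y := space (vert c.1.1 (lift c.1.2 (lift c.2 a))) in
    if i == gp y (enum_val a) then sgr R (ge y (enum_val a)) else 0
  else 0.

Lemma probe_le1 c x tau i : `|probe c x tau i| <= 1.
Proof.
rewrite /probe; case: pickP => [a _|_]; last by rewrite normr0.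
by case: ifP => _; rewrite ?normr0 // /sgr; case: ifP; rewrite ?normrN normr1.
Qed.

Lemma minor_probe c : valid c.1.1 -> minor_mx (probe c) c = 1%:M.
Proof.
move=> vs; apply/matrixP => a i; rewrite !mxE /cell /val_at /probe.
case: pickP => [a'|/(_ a)/asboolP[]//].
move=> /asboolP[ce te].
have ea : a = a'.
  apply/(@lift_inj _ c.2)/(@lift_inj _ c.1.2)/(vert_inj vs)/funext => -[j|//].
  apply: (congr1 (fun f => f j) (can_inj _ _ _ ce)) => i'.
  - exact: vert_box.
  - exact: vert_box.
  exact: vert_near.
rewrite -ea (inj_eq (@gp_inj _)) (inj_eq enum_val_inj) eq_sym.
case: eqP => [->|_]; last by rewrite mulr0.
by rewrite /sgr; case: ifP; rewrite ?mulrNN mulr1.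
Qed.

Definition det_poly (w z : (I -> int) -> int -> I -> R) c : {poly R} :=
  \det (map_mx polyC (minor_mx w c) + 'X *: map_mx polyC (minor_mx z c)).

Lemma horner_det_poly w z c t :
  (det_poly w z c).[t] = \det (minor_mx (fun x tau i => w x tau i + t * z x tau i) c).
Proof.
rewrite /det_poly -horner_evalE -det_map_mx; congr (\det _).
apply/matrixP => a i; rewrite !mxE /= !horner_evalE hornerD hornerM hornerX !hornerC.
by rewrite cell_lin.
Qed.

Lemma det_poly_probe w c : valid c.1.1 -> det_poly w (probe c) c != 0.
Proof.
move=> vs; rewrite /det_poly minor_probe //.
have -> : map_mx polyC (minor_mx w c) + 'X *: map_mx polyC 1%:M =
   char_poly_mx (- minor_mx w c).
  by rewrite /char_poly_mx map_mxN opprK addrC map_mx1 scalemx1.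
exact: (monic_neq0 (char_poly_monic _)).
Qed.

(** One minor is made nonzero at a time by moving along its [probe]. The minors already treated are
    nonzero at [t = 0], so they exclude only finitely many [t]; each move uses half of the
    allowance. *)
Lemma generic_values (w0 : (I -> int) -> int -> I -> R) (kappa : R) : 0 < kappa ->
  exists w, (forall x tau i, `|w x tau i - w0 x tau i| <= kappa) /\
    forall s : simplex, valid s -> in_general_position (cellw w s).
Proof.
move=> k0.
suff [w [w1 w2]] : exists w, (forall x tau i, `|w x tau i - w0 x tau i| <= kappa) /\
    forall c, c \in enum {: simplex * 'I_D.+2 * 'I_D.+1} -> valid c.1.1 ->
       \det (minor_mx w c) != 0.
  exists w; split=> // s vs; apply: minors_general_position => k l.
  by apply: w2 => //; rewrite mem_enum.
elim: (enum _) kappa k0 => [|c cs IH] kappa k0.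
  by exists w0; split => // x tau i; rewrite subrr normr0 ltW.
have [w [w1 w2]] := IH (kappa / 2) (divr_gt0 k0 (ltr0Sn _ _)).
have [vc|nvc] := boolP (valid c.1.1); last first.
  exists w; split=> [x tau i|c']; first by have := w1 x tau i; lra.
  by rewrite inE => /predU1P[->|/w2//]; rewrite (negPf nvc).
pose ps := [seq det_poly w (probe c) c' | c' <- c :: [seq c' <- cs | valid c'.1.1]].
have [|t [t0 tk tps]] := @small_nonroot R ps (kappa / 2) (divr_gt0 k0 (ltr0Sn _ _)).
  move=> q /mapP[c' + ->]; rewrite inE => /predU1P[->|].
    exact: det_poly_probe.
  rewrite mem_filter => /andP[vc' /w2 /(_ vc')] nz.
  apply: contraNneq nz => q0.
  have e0 : minor_mx (fun x tau i => w x tau i + 0 * probe c x tau i) c' = minor_mx w c'.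
    by apply/matrixP => a i; rewrite !mxE cell_lin mul0r addr0.
  by have := horner_det_poly w (probe c) c' 0; rewrite q0 horner0 e0 => <-.
exists (fun x tau i => w x tau i + t * probe c x tau i); split.
  move=> x tau i; rewrite addrAC; apply: le_trans (ler_normD _ _) _.
  have : `|t * probe c x tau i| <= kappa / 2.
    rewrite normrM (gtr0_norm t0); apply: le_trans tk.
    by rewrite ler_piMr ?probe_le1 // ltW.
  have := w1 x tau i; lra.
move=> c' c'in vc'; rewrite -horner_det_poly; apply: tps; apply/mapP; exists c' => //.
by move: c'in; rewrite !inE mem_filter vc'.
Qed.

End Generic.

(** * Approximate zeros of glued maps *)

Lemma increasing_ordinal n (f : 'I_n -> 'I_n) :
  (forall i j : 'I_n, (i < j)%N -> (f i < f j)%N) -> forall i, f i = i.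
Proof.
move=> fi.
have up k (i : 'I_n) : nat_of_ord i = k -> (k <= f i)%N.
  elim: k i => [|k IH] i ik //.
  have kn : (k < n)%N by rewrite -ltnS -ik ltnS ltnW // ik.
  have := fi (Ordinal kn) i; rewrite /= ik ltnSn => /(_ isT).
  exact/leq_ltn_trans/IH.
have down k (i : 'I_n) : (i + k = n.-1)%N -> (f i + k <= n.-1)%N.
  elim: k i => [|k IH] i ik.
    by rewrite addn0; move: (ltn_ord (f i)); ord_lia.
  have kn : (i.+1 < n)%N by move: ik (ltn_ord i); ord_lia.
  have h1 : (f (Ordinal kn) + k <= n.-1)%N by apply: IH => /=; move: ik; ord_lia.
  by rewrite addnS; apply: leq_trans h1; rewrite ltn_add2r; apply: fi.
move=> i; apply: val_inj; apply/eqP; rewrite eqn_leq (up _ i erefl) andbT.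
have in1 : (i <= n.-1)%N by move: (ltn_ord i); ord_lia.
by rewrite -(leq_add2r (n.-1 - i)) subnKC //; apply: down; exact: subnKC.
Qed.

Lemma ord_neq_max n (k : 'I_n.+2) : k != ord_max -> (k <= n)%N.
Proof. by rewrite -val_eqE -ltnS => km; rewrite ltn_neqAle km -ltnS ltn_ord. Qed.

Section BorsukUlam.
Variables (R : realFieldType) (I : finType) (N : nat).
Variables (p : I -> I -> I) (e : I -> I -> bool).
Variables (can : (I -> int) -> I -> int) (gp : (I -> int) -> I -> I).
Variable (ge : (I -> int) -> I -> bool).
Variable Psi : (I -> int) -> I -> R.
Notation D := #|I|.
Notation twoN := (2 * N%:Z).
Notation cellw := (cell can gp ge).
Notation simplex := (simplex I N).
Notation box x := (forall i', `|x i'| <= twoN).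

Hypothesis N_gt0 : (0 < N)%N.
Hypothesis pK : forall i, involutive (p i).
Hypothesis pii : forall i, p i i = i.
Hypothesis eii : forall i, e i i.
Hypothesis ep : forall i i', e i (p i i') = e i i'.
Hypothesis can_glue : forall i x, box x -> `|x i| = twoN -> can (glue p e i x) = can x.
Hypothesis gp_glue : forall i x i', box x -> `|x i| = twoN ->
  gp (glue p e i x) i' = gp x (p i i').
Hypothesis ge_glue : forall i x i', box x -> `|x i| = twoN ->
  ge (glue p e i x) i' = e i i' (+) ge x (p i i').
Hypothesis gp_inj : forall x, injective (gp x).
Hypothesis can_inj : forall x y, box x -> box y ->
  (forall i, `|x i - y i| <= 1) -> can x = can y -> x = y.
Hypothesis canE : forall x i,
  x i = if ge x i then - can x (gp x i) else can x (gp x i).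
Hypothesis can0 : can (fun=> 0) = fun=> 0.
Hypothesis gp0 : forall i, gp (fun=> 0) i = i.
Hypothesis ge0 : forall i, ge (fun=> 0) i = false.
Hypothesis PsiE : forall x i, box x -> Psi x i = sgr R (ge x i) * Psi (can x) (gp x i).

(** The bottom of the prism carries the identity, except that the value at the origin is moved to
    [- q]. The coordinates of [q] are positive and pairwise distinct, so the ray along [q] is
    interior to a single simplex at the origin, [star_simplex], which carries the only zero. *)
Let q (i : I) : R := (D - enum_rank i)%:R.

Let base (x : I -> int) (i : I) : R :=
  if `[< x = fun=> 0 >] then - q i else (x i)%:~R.

(** Reference map at the bottom, given map at the top; the middle level [tau = 1] receives its
    values from the generic perturbation. *)
Let w0 (x : I -> int) (tau : int) (i : I) : R :=
  if tau == 0 then base x i else if tau == 2 then Psi x i else 0.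

Let on_boundary (s : simplex) := valid s && (at_rank s D == None).

Lemma at_time (s : simplex) k : on_boundary s -> (k <= D)%N ->
  vert s k None = if s.1.2 None then 2 else 0.
Proof.
move=> /andP[vs /eqP h] kD; rewrite /vert.
have -> : rank s None = D by rewrite -h rankK.
by rewrite ltnNge kD /= /corner /sgz_of /=; case: (s.1.2 None).
Qed.

Lemma can_eq0 x : can x = (fun=> 0) -> x = fun=> 0.
Proof. by move=> h; apply: funext => i; rewrite canE h oppr0 if_same. Qed.

Lemma signed_base x i : sgr R (ge x i) * base (can x) (gp x i) = base x i.
Proof.
rewrite /base; have [->|x0] := pselect (x = fun=> 0).
  by rewrite can0 asboolT // gp0 ge0 mul1r.
rewrite !asboolF //; last by move/can_eq0.
by rewrite [in RHS]canE /sgr; case: ifP => _; rewrite ?mul1r // mulN1r mulrNz.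
Qed.

Section Values.
Variables (kappa : R) (w : (I -> int) -> int -> I -> R).
Hypothesis ww0 : forall x tau i, `|w x tau i - w0 x tau i| <= kappa.

Lemma cell_near (s : simplex) (k : 'I_D.+2) i :
  `|cellw w s k i - sgr R (ge (space (vert s k)) i) *
      w0 (can (space (vert s k))) (vert s k None) (gp (space (vert s k)) i)| <= kappa.
Proof.
rewrite /cell /val_at -mulrBr normrM [`|sgr _ _|](_ : _ = 1) ?mul1r ?ww0 //.
by rewrite /sgr; case: ifP; rewrite ?normrN normr1.
Qed.

Lemma bottom_value (s : simplex) (k : 'I_D.+2) i : on_boundary s -> (k <= D)%N ->
  s.1.2 None = false -> `|cellw w s k i - base (space (vert s k)) i| <= kappa.
Proof.
move=> bs kD sN; have := cell_near s k i.
by rewrite at_time // sN /w0 eqxx signed_base.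
Qed.

Lemma top_value (s : simplex) (k : 'I_D.+2) i : on_boundary s -> (k <= D)%N ->
  s.1.2 None = true -> `|cellw w s k i - Psi (space (vert s k)) i| <= kappa.
Proof.
move=> bs kD sN; have := cell_near s k i.
rewrite at_time // sN /w0 /= -PsiE // => i'; exact: vert_box.
Qed.

(* A positive (or negative) coordinate on all vertices of a face keeps 0 away
   from its convex hull. *)
Lemma no_zero_facet (s : simplex) (i : I) (b : bool) :
  (forall k : 'I_D.+2, (k <= D)%N -> 0 < (-1) ^+ b * cellw w s k i) ->
  ~ zero_facet (cellw w s) ord_max.
Proof.
move=> pos [a [am age a1 /(_ i) ra]].
have : 0 < \sum_j a j * ((-1) ^+ b * cellw w s j i).
  have t0 k : 0 <= a k * ((-1) ^+ b * cellw w s k i).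
    have [->|km] := eqVneq k ord_max; first by rewrite am mul0r.
    by rewrite mulr_ge0 // ltW // pos // ord_neq_max.
  rewrite lt0r sumr_ge0 // andbT psumr_neq0 //.
  have : \sum_j a j != 0 by rewrite a1 oner_neq0.
  rewrite psumr_neq0 // => /hasP[k kin /= ak]; apply/hasP; exists k => //=.
  have km : k != ord_max by apply: contraTneq ak => ->; rewrite am ltxx.
  by rewrite mulr_gt0 ?pos ?ord_neq_max // lt0r ak age.
rewrite (eq_bigr (fun j => (-1) ^+ b * (a j * cellw w s j i))) -?mulr_sumr ?ra ?mulr0 ?ltxx //.
by move=> j _; rewrite mulrCA.
Qed.

End Values.

Lemma center_odd (s : simplex) i : exists z : int, center s (Some i) = 2 * z + 1.
Proof. by exists ((s.1.1 i)%:Z - N%:Z); rewrite /center; lia. Qed.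

(** A nonzero corner coordinate is even, so on all vertices of the simplex it keeps its sign and has
    absolute value at least 1. *)
Lemma bottom_corner kappa w (s : simplex) :
  (forall x tau i, `|w x tau i - w0 x tau i| <= kappa) -> kappa < 1 ->
  on_boundary s -> s.1.2 None = false -> zero_facet (cellw w s) ord_max ->
  forall i, corner s (Some i) = 0.
Proof.
move=> ww0 k1 bs sN zf i.
have [//|/eqP c0] := eqVneq (corner s (Some i)) 0; exfalso; move: zf.
have [z cz] := center_odd s i.
have key (k : nat) : if corner s (Some i) < 0 then vert s k (Some i) <= -1
             else 1 <= vert s k (Some i).
  move: c0 cz; rewrite /vert /corner /sgz_of; move: (center _ _) (s.1.2 _) => cc bb.
  by case: (_ < k)%N; case: bb => h1 h2; case: ifP; move: h1 h2; clear; lia.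
have value (k : 'I_D.+2) : (k <= D)%N ->
    `|cellw w s k i - (vert s k (Some i))%:~R| <= kappa.
  move=> kD; have := bottom_value ww0 i bs kD sN; rewrite /base asboolF //.
  move=> /(congr1 (fun f => f i)); rewrite /space => v0; move: (key k).
  by rewrite v0; case: ifP.
have [neg|pos] := ltP (corner s (Some i)) 0.
  apply: (@no_zero_facet w s i true) => k kD.
  have := key k; rewrite neg => vk; have := value k kD; rewrite ler_norml.
  have : (vert s k (Some i))%:~R <= -1 :> R by rewrite -[-1]/((-1)%:~R) ler_int.
  by rewrite expr1 => h /andP[]; lra.
apply: (@no_zero_facet w s i false) => k kD.
have := key k; rewrite ltNge pos => vk; have := value k kD; rewrite ler_norml.
have : 1 <= (vert s k (Some i))%:~R :> R by rewrite -[1]/(1%:~R) ler_int.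
by rewrite expr0 => h /andP[]; lra.
Qed.
Definition star_simplex : simplex :=
  ([ffun=> Ordinal (ltn_Pmull (isT : (1 < 2)%N) N_gt0)], [ffun=> false],
   [ffun j => if j is Some i then widen_ord (leqnSn D) (enum_rank i) else ord_max]).

Let mu (s : simplex) (a : 'I_D.+2 -> R) (i : I) : R :=
  \sum_(k : 'I_D.+2 | (rank s (Some i) < k)%N) a k.

(** Coordinate [i] of the relation: each vertex past the rank of [i] contributes its centre
    coordinate, the corner contributes [- q i], and the other vertices contribute 0, up to [kappa]
    each. *)
Lemma bottom_equation kappa w (s : simplex) a i :
  (forall x tau i, `|w x tau i - w0 x tau i| <= kappa) ->
  on_boundary s -> s.1.2 None = false -> (forall i, corner s (Some i) = 0) ->
  a ord_max = 0 -> relation_of (cellw w s) a ->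
  `|(center s (Some i))%:~R * mu s a i - a ord0 * q i| <= kappa * \sum_k `|a k|.
Proof.
move=> ww0 bs sN c0 am /(_ i) ra.
have vs : valid s by case/andP: bs.
pose b (k : 'I_D.+2) : R := if k == ord0 then - q i else
  if (rank s (Some i) < k)%N then (center s (Some i))%:~R else 0.
have baseE (k : 'I_D.+2) : (k <= D)%N -> base (space (vert s k)) i = b k.
  move=> kD; rewrite /base /b; have [->|k0] := eqVneq k ord0.
    rewrite asboolT //; apply: funext => i'; by rewrite /space /vert ltn0.
  have kpos : (0 < k)%N by rewrite lt0n.
  rewrite asboolF; last first.
    have r0 := rankK vs (leq0n D).
    case E : (at_rank s 0) r0 => [i1|] r0.
      move=> /(congr1 (fun f => f i1)); rewrite /space /vert r0 kpos.
      have [z ->] := center_odd s i1; clear; lia.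
    have : rank s None = D by case/andP: bs => _ /eqP <-; rewrite rankK.
    by rewrite r0 => D0; move: kpos; rewrite ltnNge (leq_trans kD) // -D0.
  by rewrite /space /vert; case: ifP => // _; rewrite c0.
have -> : (center s (Some i))%:~R * mu s a i - a ord0 * q i = \sum_k a k * b k.
  rewrite [RHS](bigD1 ord0) //= {1}/b eqxx mulrN addrC; congr (_ + _).
  rewrite /mu mulr_sumr [LHS](bigID (fun k => k == ord0)) /=.
  rewrite big1 ?add0r; last by move=> k /andP[/[swap] /eqP ->]; rewrite ltn0.
  rewrite [RHS](bigID (fun k : 'I_D.+2 => (rank s (Some i) < k)%N)) /= [X in _ = _ + X]big1 ?addr0.
    rewrite (eq_bigl (fun k : 'I_D.+2 => (k != ord0) && (rank s (Some i) < k)%N)); last first.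
      by move=> k; rewrite andbC.
    apply: eq_bigr => k /andP[k0 rk]; by rewrite /b (negPf k0) rk mulrC.
  by move=> k /andP[k0 rk]; rewrite /b (negPf k0) (negPf rk) mulr0.
have -> : \sum_k a k * b k = \sum_k a k * (b k - cellw w s k i).
  rewrite [RHS](eq_bigr (fun k => a k * b k - a k * cellw w s k i)).
    by rewrite sumrB ra subr0.
  by move=> k _; rewrite mulrBr.
apply: le_trans (ler_norm_sum _ _ _) _; rewrite mulr_sumr; apply: ler_sum => k _.
have [->|km] := eqVneq k ord_max; first by rewrite am mul0r normr0 mulr0.
have kD := ord_neq_max km.
rewrite normrM mulrC ler_wpM2r // -baseE // distrC; exact: bottom_value.
Qed.

(** The coordinate of rank 0 has [mu = 1 - a ord0], which bounds [a ord0] below by roughly 1 / (D +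
    1). Then the centre has the signs of [q]; and as [mu] decreases with the rank while [q]
    decreases with [enum_rank], the two orders coincide. *)
Lemma bottom_unique kappa w (s : simplex) :
  (forall x tau i, `|w x tau i - w0 x tau i| <= kappa) ->
  kappa * (8 * D.+1%:R) <= 1 -> 0 < kappa ->
  on_boundary s -> s.1.2 None = false -> zero_facet (cellw w s) ord_max ->
  s = star_simplex.
Proof.
move=> ww0 ksmall k0 bs sN zf.
have vs : valid s by case/andP: bs.
have rN : rank s None = D by case/andP: bs => _ /eqP <-; rewrite rankK.
have D1 : 1 <= D.+1%:R :> R by rewrite ler1n.
have c0 : forall i, corner s (Some i) = 0.
  by apply: bottom_corner ww0 _ bs sN zf; nra.
have [a [am age a1 ra]] := zf.
have eqn i : `|(center s (Some i))%:~R * mu s a i - a ord0 * q i| <= kappa.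
  apply: le_trans (bottom_equation i ww0 bs sN c0 am ra) _.
  by rewrite (eq_bigr a) ?a1 ?mulr1 // => k _; rewrite ger0_norm.
have cpm i : center s (Some i) = if s.1.2 (Some i) then -1 else 1.
  by move: (c0 i); rewrite /corner /sgz_of; case: (s.1.2 _); clear; lia.
have q1 i : 1 <= q i by rewrite /q ler1n subn_gt0.
have qD i : q i <= D%:R by rewrite /q ler_nat leq_subr.
have mu_ge0 i : 0 <= mu s a i by apply: sumr_ge0.
have first_rank (i : I) : exists i0, mu s a i0 = 1 - a ord0.
  have r0 := rankK vs (leq0n D).
  case E : (at_rank s 0) r0 => [i0|] r0; last first.
    have : (0 < rank s None)%N.
      by rewrite rN (leq_ltn_trans _ (ltn_ord (enum_rank i))).
    by rewrite r0.
  exists i0; rewrite -a1 [in RHS](bigD1 ord0) //= [a ord0 + _]addrC addrK.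
  by apply: eq_bigl => k; rewrite r0 lt0n.
have a0k (i : I) : 2 * kappa < a ord0.
  have [i0 m0] := first_rank i.
  have := eqn i0; have := q1 i0; have := qD i0; rewrite m0 cpm.
  have a0 := age ord0; have DD : D.+1%:R = D%:R + 1 :> R by rewrite natr1.
  have Dge : 0 <= D%:R :> R by [].
  have a01 : 0 <= 1 - a ord0 by rewrite -m0.
  case: (s.1.2 _) => h1 h2; rewrite ler_norml => /andP[h3 h4].
    have : a ord0 <= a ord0 * q i0 by rewrite ler_peMr.
    move: h3 h4 ksmall; rewrite mulrN1z mulN1r; nra.
  have h5 : a ord0 * q i0 <= a ord0 * D%:R by rewrite ler_wpM2l.
  move: h3 h4 ksmall; rewrite mulr1z mul1r DD; nra.
have cpos i : s.1.2 (Some i) = false.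
  apply/negP => ci; have := eqn i; rewrite cpm ci mulrN1z mulN1r ler_norml => /andP[h _].
  have := a0k i; have := mu_ge0 i; have : a ord0 <= a ord0 * q i by rewrite ler_peMr.
  by clear a0k; lra.
have mono i i' : (rank s (Some i) < rank s (Some i'))%N ->
    (enum_rank i <= enum_rank i')%N.
  move=> lt; rewrite leqNgt; apply/negP => lt'.
  have q' : q i + 1 <= q i'.
    by rewrite /q natr1 ler_nat ltn_sub2l // ltn_ord.
  have mm : mu s a i' <= mu s a i.
    rewrite /mu [leRHS](bigID (fun k : 'I_D.+2 => rank s (Some i') < k)%N) /=.
    rewrite [X in _ <= X + _](eq_bigl (fun k : 'I_D.+2 => rank s (Some i') < k)%N).
      by rewrite lerDl sumr_ge0.
    move=> k /=; case: (ltnP (rank s (Some i')) k) => h; rewrite ?andbF // andbT.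
    exact: ltn_trans lt h.
  have := eqn i; have := eqn i'; rewrite !cpm !cpos mulr1z !mul1r !ler_norml.
  move=> /andP[h1 h2] /andP[h3 h4].
  have := a0k i; have : a ord0 * (q i + 1) <= a ord0 * q i' by rewrite ler_wpM2l.
  by clear a0k; lra.
have rD i : (rank s (Some i) < D)%N.
  rewrite ltn_neqAle rank_le andbT; apply/eqP => h.
  by have := rank_inj vs (etrans h (esym rN)).
pose f (r : 'I_D) : 'I_D := Ordinal (rD (enum_val r)).
have fE : forall r, f r = r.
  apply: increasing_ordinal => r r' lt; rewrite /f /= ltnNge leq_eqVlt negb_or.
  apply/andP; split.
    apply/eqP => /(rank_inj vs) [] /enum_val_inj h; by move: lt; rewrite h ltnn.
  by apply/negP => /mono; rewrite !enum_valK leqNgt lt.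
apply: simplex_eq => [i|j|j]; rewrite ffunE.
- apply: val_inj => /=; have := cpm i; rewrite cpos /center; ord_lia.
- by case: j.
- apply: val_inj; case: j => [i|] /=; last exact: rN.
  by have := congr1 val (fE (enum_rank i)); rewrite /f /= enum_rankK.
Qed.
Lemma star_boundary : on_boundary star_simplex.
Proof.
have v : valid star_simplex.
  apply/injectiveP => j j'; rewrite !ffunE => /(congr1 val).
  case: j j' => [i|] [i'|] //= h.
  - by congr Some; apply/enum_rank_inj/val_inj.
  - by have := ltn_ord (enum_rank i); rewrite h ltnn.
  - by have := ltn_ord (enum_rank i'); rewrite -h ltnn.
rewrite /on_boundary v /=; apply/eqP; apply: rank_at_rank => //.
by rewrite /rank ffunE.
Qed.

(** Normalised by [a ord0 = 1], the equations put [mu] close to [q], whose consecutive differences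
    are 1; so the other coefficients of the facet are close to 1, hence positive. *)
Lemma star_zero_facet kappa w :
  (forall x tau i, `|w x tau i - w0 x tau i| <= kappa) ->
  kappa * (8 * D.+1%:R) <= 1 -> 0 < kappa ->
  in_general_position (cellw w star_simplex) ->
  zero_facet (cellw w star_simplex) ord_max.
Proof.
move=> ww0 ksmall k0 gen; set s := star_simplex.
have bs : on_boundary s := star_boundary.
have [a [ra am a0]] := @general_position_relation R I D _ ord_max ord0 erefl gen isT.
have c0 i : corner s (Some i) = 0.
  by rewrite /corner /center !ffunE /= /sgz_of; clear; lia.
pose L := \sum_k `|a k|.
have L0 : 0 <= L by apply: sumr_ge0.
have eqn i : `|mu s a i - q i| <= kappa * L.
  have := bottom_equation i ww0 bs (ffunE _ _) c0 am ra; rewrite a0 mul1r.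
  suff -> : center s (Some i) = 1 by rewrite mulr1z mul1r.
  by rewrite /center ffunE /=; clear; lia.
pose m (r : nat) := \sum_(k : 'I_D.+2 | (r < k)%N) a k.
have mE r : (r <= D)%N -> `|m r - (D - r)%:R| <= kappa * L.
  rewrite leq_eqVlt => /predU1P[->|rD].
    rewrite subnn subr0 /m (bigD1 ord_max) //= am add0r big1 ?normr0.
      exact: mulr_ge0 (ltW k0) L0.
    by move=> k /andP[Dk km]; have := ord_neq_max km; rewrite leqNgt Dk.
  have := eqn (enum_val (Ordinal rD)); rewrite /q /mu enum_valK /=.
  rewrite (eq_bigl (fun k : 'I_D.+2 => r < k)%N) // => k.
  by rewrite /rank ffunE /= enum_valK.
have diff (k : 'I_D.+2) : k != ord0 -> a k = m k.-1 - m k.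
  rewrite -val_eqE /= -lt0n => k0'; rewrite /m (bigD1 k) /=; last by rewrite prednK.
  rewrite (eq_bigl (fun k1 : 'I_D.+2 => k < k1)%N) ?addrK // => k1.
  by rewrite prednK // ltn_neqAle -val_eqE eq_sym andbC.
have near1 (k : 'I_D.+2) : k != ord0 -> k != ord_max -> `|a k - 1| <= 2 * (kappa * L).
  move=> k0' km; have kD := ord_neq_max km; rewrite diff //.
  have := mE k kD; have := mE k.-1 (leq_trans (leq_pred _) kD).
  have kpos : (0 < k)%N by rewrite lt0n.
  have -> : (D - k.-1)%:R = (D - k)%:R + 1 :> R.
    by rewrite natr1 -subSn // -[in RHS](prednK kpos) subSS.
  by rewrite !ler_norml => /andP[h1 h2] /andP[h3 h4]; apply/andP; split; lra.
have LD : L <= 1 + D.+1%:R * (1 + 2 * (kappa * L)).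
  rewrite {1}/L (bigD1 ord0) //= a0 normr1 lerD2l.
  apply: le_trans (_ : \sum_(k : 'I_D.+2 | k != ord0) (1 + 2 * (kappa * L)) <= _).
    apply: ler_sum => k k0'; have [->|km] := eqVneq k ord_max.
      by rewrite am normr0; have := mulr_ge0 (ltW k0) L0; lra.
    have := near1 k k0' km; rewrite !ler_norml => /andP[h1 h2]; apply/andP; split; lra.
  rewrite sumr_const -[_ *+ _]mulr_natl ler_wpM2r //.
    by have := mulr_ge0 (ltW k0) L0; lra.
  by rewrite ler_nat (cardC1 ord0) card_ord.
have D1 : 1 <= D.+1%:R :> R by rewrite ler1n.
have kL : 2 * (kappa * L) <= 2 / 3.
  have L2 : L <= 4 / 3 * (1 + D.+1%:R) by nra.
  have : kappa * L <= kappa * (4 / 3 * (1 + D.+1%:R)) by rewrite ler_wpM2l // ltW.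
  have : kappa <= kappa * D.+1%:R by rewrite ler_peMr // ltW.
  lra.
have age k : 0 <= a k.
  have [->|k0'] := eqVneq k ord0; first by rewrite a0.
  have [->|km] := eqVneq k ord_max; first by rewrite am.
  by have := near1 k k0' km; rewrite ler_norml => /andP[]; lra.
have S0 : 0 < \sum_k a k by rewrite (bigD1 ord0) //= a0 ltr_pwDl // sumr_ge0.
exists (fun j => (\sum_k a k)^-1 * a j + 0 * a j); split.
- by rewrite am !mulr0 addr0.
- by move=> j; rewrite mul0r addr0 mulr_ge0 // invr_ge0 ltW.
- rewrite (eq_bigr (fun j => (\sum_k a k)^-1 * a j)) -?mulr_sumr ?mulVf ?gt_eqF //.
  by move=> j _; rewrite mul0r addr0.
- exact: relation_comb.
Qed.

(** Otherwise, around every grid point some coordinate of [Psi] has a constant sign, so no top facet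
    is a zero facet, and the single one at the bottom contradicts parity. *)
Theorem glued_cube_zero (kappa : R) : 0 < kappa -> exists2 x, box x &
  forall i, (exists y, [/\ box y, forall i', `|y i' - x i'| <= 1 & Psi y i <= kappa]) /\
    (exists y, [/\ box y, forall i', `|y i' - x i'| <= 1 & - kappa <= Psi y i]).
Proof.
move=> kappa0; apply: contrapT => no.
have {}no x : box x -> exists i (b : bool), forall y, box y ->
    (forall i', `|y i' - x i'| <= 1) -> kappa < (-1) ^+ b * Psi y i.
  move=> bx; apply: contrapT => h; apply: no; exists x => // i; split.
    apply: contrapT => h1; apply: h; exists i, false => y yb yx.
    rewrite mul1r ltNge; apply/negP => py; apply: h1; by exists y.
  apply: contrapT => h1; apply: h; exists i, true => y yb yx.
  rewrite mulN1r ltNge; apply/negP => py; apply: h1; exists y; split=> //; lra.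
pose k1 := Num.min (kappa / 2) (8 * D.+1%:R)^-1.
have k10 : 0 < k1 by rewrite lt_min divr_gt0 //= invr_gt0 mulr_gt0.
have k1k : k1 <= kappa / 2 by rewrite ge_min lexx.
have k1s : k1 * (8 * D.+1%:R) <= 1.
  by rewrite -ler_pdivlMr ?mulr_gt0 // mul1r ge_min lexx orbT.
have [w [ww0 gen]] := generic_values ge gp_inj can_inj w0 k10.
have := boundary_facets_even pK pii eii ep can_glue gp_glue ge_glue gen.
rewrite (bigD1 star_simplex) /=; last exact: star_boundary.
rewrite asboolT; last first.
  by apply: (star_zero_facet ww0) => //; apply: gen; case/andP: star_boundary.
rewrite big1 // => s /andP[bs sne]; apply: asboolF => zf.
case sN : (s.1.2 None); last first.
  by move: sne; rewrite (bottom_unique ww0 k1s k10 bs sN zf) eqxx.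
have [i [b hb]] := no (space (vert s 0)) (fun i => vert_box s 0 i).
apply: (@no_zero_facet w s i b) zf => k kD.
have := top_value ww0 i bs kD sN.
have := hb (space (vert s k)) (fun i => vert_box s k i) (fun i => vert_near _ _ _ _).
by case: b {hb}; rewrite ?mul1r ?mulN1r => h1; rewrite ler_norml => /andP[h2 h3]; lra.
Qed.
End BorsukUlam.

(** * A Brouwer theorem without continuity *)

Section Normalise.
Variables (T : finType) (N : nat).
Implicit Types u : T -> int.
Notation twoN := (2 * N%:Z).

Definition extremal u : pred T := fun a => `|u a| == twoN.
(* The choice of [pick] depends on the set of extremal coordinates only, hence
   is the same for [u] and [- u]. *)
Definition neg_first u : bool := if [pick a | extremal u a] is Some a then u a < 0 else false.

Lemma neg_first_boundary u : neg_first u -> exists a, extremal u a.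
Proof. by rewrite /neg_first; case: pickP => // a; exists a. Qed.

Lemma neg_first0 : (0 < N)%N -> neg_first (fun=> 0) = false.
Proof. by move=> N0; rewrite /neg_first; case: pickP => // a; rewrite ltxx. Qed.

Lemma neg_firstN u : (0 < N)%N -> (exists a, extremal u a) ->
  neg_first (fun a => - u a) = ~~ neg_first u.
Proof.
move=> N0 [a ua]; rewrite /neg_first.
rewrite (eq_pick (_ : extremal (fun a => - u a) =1 extremal u)); last first.
  by move=> b; rewrite /extremal normrN.
case: pickP => [b|/(_ a)]; last by rewrite ua.
rewrite /extremal => /eqP ub; rewrite oppr_lt0 -leNgt le_eqVlt.
case: eqP => // b0; move: ub; rewrite -b0 normr0; move: N0; clear; lia.
Qed.

Lemma near_opp_eq u u' : (0 < N)%N -> (forall a, `|u a - u' a| <= 1) ->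
  (forall a, u a = - u' a) -> neg_first u -> False.
Proof.
move=> N0 near opp /neg_first_boundary[a /eqP ua].
by have := near a; have := opp a; move: ua N0; clear; lia.
Qed.
End Normalise.

Lemma large_nat (R : realType) (x : R) : exists n : nat, (0 < n)%N /\ x <= n%:R.
Proof.
exists (Num.bound `|x|).+1; split => //; apply: le_trans (ler_norm _) _.
by apply: ltW; apply: lt_le_trans (archi_boundP (normr_ge0 _)) _; rewrite ler_nat.
Qed.

Lemma le0_of_inverse (R : realType) (n : nat) (x : R) :
  (forall j, (n <= j)%N -> x <= j.+1%:R^-1) -> x <= 0.
Proof.
move=> h; rewrite leNgt; apply/negP => x0; have [j [j0 jP]] := large_nat x^-1.
have := h (maxn n j) (leq_maxl _ _); rewrite leNgt => /negP; apply.
by rewrite invf_plt ?posrE ?ltr0Sn //; apply: le_lt_trans jP _; rewrite ltr_nat ltnS leq_maxr.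
Qed.

Definition clip01 (R : realType) (t : R) : R := if t <= 0 then 0 else if 1 <= t then 1 else t.

Lemma clip01_itv (R : realType) (t : R) : 0 <= clip01 t <= 1.
Proof.
by rewrite /clip01; have [?|?] := leP t 0; last have [?|?] := leP 1 t;
  apply/andP; split; lra.
Qed.

Lemma clip01_lip (R : realType) (t u : R) : `|clip01 t - clip01 u| <= `|t - u|.
Proof.
rewrite /clip01; have h1 := ler_norm (t - u); have h2 := ler_norm (u - t).
rewrite distrC in h2; rewrite ler_norml.
by have [?|?] := leP t 0; have [?|?] := leP u 0; have [?|?] := leP 1 t;
  have [?|?] := leP 1 u; apply/andP; split; lra.
Qed.

Section Brouwer.
Variables (R : realType) (I : finType) (v : (I -> R) -> I -> R).
Hypothesis v01 : forall x, (forall i, 0 <= x i <= 1) -> forall i, 0 <= v x i <= 1.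

(** The grid [-2N, 2N] is stretched onto [-1, 2] and clipped to [0, 1]. [Psi] is the displacement
    inside and the odd function [y / (2 * N)] on the boundary; near the boundary both have the sign
    of [y], so the zero found comes from the displacement. *)
Lemma boxwise_brouwer (kappa : R) : 0 < kappa -> exists2 x : I -> R, (forall i, 0 <= x i <= 1) &
  forall i, (exists a, [/\ forall j, 0 <= a j <= 1, forall j, `|a j - x j| <= kappa &
                          a i <= v a i + kappa]) /\
            (exists b, [/\ forall j, 0 <= b j <= 1, forall j, `|b j - x j| <= kappa &
                          v b i <= b i + kappa]).
Proof.
move=> kappa0.
have [N [N0 Nk]] := large_nat (8 + kappa^-1).
have N0' : 0 < N%:R :> R by rewrite ltr0n.
have N8 : 8 <= N%:R :> R by apply: le_trans Nk; rewrite lerDl invr_ge0 ltW.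
have Nkap : 1 <= kappa * N%:R.
  rewrite mulrC -ler_pdivrMr // mul1r; apply: le_trans Nk; lra.
pose t (y : I -> int) (i : I) : R := 1 / 2 + (y i)%:~R * (3 / (4 * N%:R)).
pose w (y : I -> int) (i : I) := clip01 (t y i).
have w01 y i : 0 <= w y i <= 1 by exact: clip01_itv.
pose bd (y : I -> int) := [exists i, extremal N y i].
pose Psi (y : I -> int) (i : I) : R := if bd y then (y i)%:~R / (2 * N%:R) else t y i - v (w y) i.
pose can (y : I -> int) := if neg_first N y then (fun i => - y i) else y.
pose gp (y : I -> int) (i : I) := i.
pose ge (y : I -> int) (i : I) := neg_first N y.
have bdN y : bd (fun i => - y i) = bd y by apply: eq_existsb => i; rewrite /extremal normrN.
pose e := fun _ _ : I => true; pose p := fun _ i : I => i.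
have glueE i y : glue p e i y = (fun i => - y i) by apply/funext.
have canD y i : y i = if ge y i then - can y i else can y i.
  by rewrite /ge /can; case: (neg_first N y); rewrite ?opprK.
have bde (i : I) (y : I -> int) : `|y i| = 2 * N%:Z -> exists a, extremal N y a.
  by move=> h; exists i; apply/eqP.
have Psibd y i : bd y -> Psi y i = (y i)%:~R / (2 * N%:R) by rewrite /Psi => ->.
have Psiin y i : ~~ bd y -> Psi y i = t y i - v (w y) i by rewrite /Psi => /negbTE ->.
have k0' : 0 < Num.min (kappa / 2) (1 / 4) by rewrite lt_min; apply/andP; split; lra.
have [| | | |i y yb yi|i y i' yb yi|i y i' yb yi| |y y' yb yb' near| | | | |y i yb|x xb hx] :=
    @glued_cube_zero R I N p e can gp ge Psi N0 _ _ _ _ _ _ _ _ _ _ _ _ _ _ _ k0' => //.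
- rewrite glueE /can neg_firstN //; last exact: bde yi.
  by case: (neg_first N y) => //=; apply/funext => j; rewrite opprK.
- by rewrite glueE /ge neg_firstN //; exact: bde yi.
- by move=> x j j'.
- rewrite /can; case ny: (neg_first N y); case ny': (neg_first N y') => // h.
  + by apply/funext => j; have /(congr1 -%R) := congr1 (@^~ j) h; rewrite !opprK.
  + by case: (near_opp_eq N0 near _ ny) => j; rewrite -[y' j](congr1 (@^~ j) h) opprK.
  + case: (@near_opp_eq _ _ y' y N0 _ _ ny') => [j|j]; first by rewrite distrC.
    by rewrite (congr1 (@^~ j) h) opprK.
- by rewrite /can neg_first0.
- by rewrite /ge neg_first0.
- rewrite /ge /can /gp; case ny: (neg_first N y); last by rewrite mul1r.
  rewrite !Psibd ?bdN; first by rewrite rmorphN /=; ring.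
    by have [a ya] := neg_first_boundary ny; apply/existsP; exists a.
  by have [a ya] := neg_first_boundary ny; apply/existsP; exists a.
have stepN : 3 / (4 * N%:R) <= kappa.
  by rewrite ler_pdivrMr ?mulr_gt0 //; lra.
have lip y j : `|y j - x j| <= 1 -> `|w y j - w x j| <= kappa.
  move=> yx; apply: le_trans (clip01_lip _ _) _.
  have -> : t y j - t x j = (y j - x j)%:~R * (3 / (4 * N%:R)).
    by rewrite /t rmorphB /=; ring.
  rewrite normrM (ger0_norm (x := 3 / _)) ?divr_ge0 ?mulr_ge0 ?ler0n //.
  apply: le_trans stepN; rewrite ler_piMl ?divr_ge0 ?mulr_ge0 ?ler0n //.
  by rewrite -intr_norm (_ : 1 = 1%:~R) // ler_int.
(* If a neighbour of the zero were on the boundary, the points with controlled sign would be at most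
   two steps from it: hence the margin 2. *)
have tbig y j : (y j <= 2 - 2 * N%:Z -> Psi y j < - (1 / 4)) /\ (2 * N%:Z - 2 <= y j -> 1 / 4 < Psi y j).
  have NV : (N%:R : R)^-1 <= 1 / 8 by rewrite invf_ple ?posrE ?divr_gt0 // div1r invrK.
  have NVN : (N%:R : R)^-1 * N%:R = 1 by rewrite mulVf // gt_eqF.
  have NV0 : 0 < (N%:R : R)^-1 by rewrite invr_gt0.
  have [vl vu] := andP (v01 (w01 y) j).
  split; rewrite -(ler_int R) ?rmorphB /= ?rmorphM /= => h.
    have h' : (y j)%:~R * N%:R^-1 <= (2 - 2 * N%:R) * (N%:R)^-1 :> R by rewrite ler_wpM2r // ltW.
    have [b|b] := boolP (bd y); first by rewrite Psibd // invfM; lra.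
    by rewrite Psiin // /t invfM; lra.
  have h' : (2 * N%:R - 2) * (N%:R)^-1 <= (y j)%:~R * N%:R^-1 :> R by rewrite ler_wpM2r // ltW.
  have [b|b] := boolP (bd y); first by rewrite Psibd // invfM; lra.
  by rewrite Psiin // /t invfM; lra.
have k4 : Num.min (kappa / 2) (1 / 4) <= 1 / 4 :> R by rewrite ge_min lexx orbT.
have kk : Num.min (kappa / 2) (1 / 4) <= kappa :> R.
  by apply: le_trans (_ : kappa / 2 <= _); [rewrite ge_min lexx | lra].
have interior y : (forall i, `|y i| <= 2 * N%:Z) -> (forall j, `|y j - x j| <= 1) -> ~~ bd y.
  move=> yb yx; apply/existsP => -[j]; rewrite /extremal => /eqP yj.
  have [[a [_ ax aP]] [b [_ bx bP]]] := hx j.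
  have := yx j; have := ax j; have := bx j.
  have := (tbig a j).2; have := (tbig b j).1; move: yj aP bP k4 => + aP bP k4.
  have [y0|y0] := leP 0 (y j).
    move=> yj _ h _ ha hy; have: 2 * N%:Z - 2 <= a j by move: yj ha hy y0; clear; lia.
    by move/h; lra.
  move=> yj h _ hb _ hy; have: b j <= 2 - 2 * N%:Z by move: yj hb hy y0; clear; lia.
  by move/h; lra.
exists (w x) => [i|i]; first exact: w01.
have [[a [ab ax aP]] [b [bb bx bP]]] := hx i.
split; [exists (w a) | exists (w b)]; split=> //; try by move=> j; apply: lip.
  move: aP; rewrite Psiin ?interior // (_ : w a i = clip01 (t a i)) // /clip01; have := v01 (w01 a) i; clear -kk kappa0.
  by move=> /andP[? ?] ?; have [?|?] := leP (t a i) 0; last have [?|?] := leP 1 (t a i); lra.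
move: bP; rewrite Psiin ?interior // (_ : w b i = clip01 (t b i)) // /clip01; have := v01 (w01 b) i; clear -kk kappa0.
by move=> /andP[? ?] ?; have [?|?] := leP (t b i) 0; last have [?|?] := leP 1 (t b i); lra.
Qed.
End Brouwer.

(** * Cubes do not embed in complexes of smaller dimension *)

Section PartialSums.
Variable R : realType.

Definition cumsum (k : nat) (p : 'I_k -> R) (j : nat) : R := \sum_(i < k | (i < j)%N) p i.

Lemma cumsum0 k (p : 'I_k -> R) : cumsum p 0 = 0.
Proof. exact: big_pred0. Qed.

Lemma cumsum_last k (p : 'I_k -> R) : cumsum p k = \sum_i p i.
Proof. by apply: eq_bigl => i; rewrite ltn_ord. Qed.

Lemma cumsumS k (p : 'I_k -> R) (i : 'I_k) : cumsum p i.+1 = cumsum p i + p i.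
Proof.
rewrite /cumsum (bigD1 i) //= addrC; congr (_ + _); apply: eq_bigl => j.
by rewrite ltnS (leq_eqVlt j) -val_eqE /=; case: ltngtP.
Qed.

Lemma cumsum_mono k (p : 'I_k -> R) i j : (forall i, 0 <= p i) -> (i <= j)%N -> cumsum p i <= cumsum p j.
Proof.
move=> p0 ij; rewrite /cumsum [leRHS](bigID (fun l : 'I_k => (l < i)%N)) /= [X in _ <= X + _](eq_bigl (fun l : 'I_k => (l < i)%N)).
  by rewrite lerDl sumr_ge0.
by move=> l /=; case: (ltnP l i) => li; rewrite ?andbF // andbT (leq_trans li).
Qed.

Lemma cumsum_near k (p p' : 'I_k -> R) e j : (forall i, `|p i - p' i| <= e) ->
  `|cumsum p j - cumsum p' j| <= k%:R * e.
Proof.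
move=> near; rewrite /cumsum -sumrB; apply: le_trans (ler_norm_sum _ _ _) _.
apply: le_trans (_ : \sum_(i < k | (i < j)%N) e <= _); first exact: ler_sum.
apply: le_trans (_ : \sum_(i < k) e <= _); last by rewrite sumr_const card_ord mulr_natl.
rewrite [leRHS](bigID (fun i : 'I_k => (i < j)%N)) /= lerDl sumr_ge0 // => i _.
by apply: le_trans (near i).
Qed.

End PartialSums.

Section CubeToSimplex.
Variables (R : realType) (M k : nat) (f : ('I_M -> R) -> 'I_k -> R) (delta : R).
Notation in_cube x := (forall i, 0 <= x i <= 1).
Hypothesis f_sum1 : forall x, \sum_i f x i = 1.
Hypothesis f_unif : forall e : R, 0 < e -> exists2 r, 0 < r &
  forall x y, in_cube x -> in_cube y -> (forall j, `|x j - y j| <= r) -> forall i, `|f x i - f y i| <= e.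
Hypothesis delta_gt0 : 0 < delta.
Hypothesis f_sep : forall x y, in_cube x -> in_cube y ->
  (forall i, `|f x i - f y i| <= delta) -> forall j, `|x j - y j| <= 1 / 4.

Notation cum x j := (cumsum (f x) j).

(** Distinct nonzero partial sums thus have distinct last nonzero terms, which is how elements of
    the support are counted. *)
Let cum_last_nonzero x (j : 'I_k.+1) : cum x j != 0 -> exists2 i : 'I_k, f x i != 0 & cum x j = \sum_(i' < k | (i' <= i)%N) f x i'.
Proof.
move=> n0; have [i ij fi] : exists2 i : 'I_k, (i < j)%N & f x i != 0.
  apply: contrapT => h; case/eqP: n0; apply: big1 => i ij; apply/eqP/negbNE/negP => fi.
  by apply: h; exists i.
have Pi : (i < j)%N && (f x i != 0) by rewrite ij fi.
case: (@arg_maxnP _ i (fun i : 'I_k => (i < j)%N && (f x i != 0)) (@nat_of_ord k) Pi) => a /andP[aj fa] amax.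
exists a => //; rewrite /cumsum (bigID (fun i : 'I_k => (i <= a)%N)) /= [X in _ + X]big1 ?addr0.
  by apply: eq_bigl => b; case: (leqP b a) => ba; rewrite ?andbF // andbT (leq_ltn_trans ba).
move=> b /andP[bj]; rewrite -ltnNge => ab; apply/eqP/negbNE/negP => fb.
by have := amax b; rewrite bj fb => /(_ isT); rewrite /= leqNgt ab.
Qed.

(** At one point [x], M + 1 distinct nonzero partial sums are found: for each direction [i] one
    whose product by [L] is [- (i + 1) / (M + 1)] modulo 1 up to [eps], and the full sum 1 for the
    residue 0. *)
Lemma cube_to_simplex_support :
  exists2 x, in_cube x & (M < #|finset (fun i => f x i != 0%R)|)%N.
Proof.
have [L [L0 LD]] := large_nat (2 / delta).
have L0' : 0 < L%:R :> R by rewrite ltr0n.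
pose th (t : nat) : R := t%:R / M.+1%:R.
pose lab (i : 'I_M) x (j : 'I_k.+1) : int := Num.floor (L%:R * cum x j + th i.+1).
have lab_sep i x y : in_cube x -> in_cube y -> lab i x = lab i y -> forall j, `|x j - y j| <= 1 / 4.
  move=> cx cy xy; apply: f_sep => // l.
  have h (j : 'I_k.+1) : `|cum x j - cum y j| <= delta / 2.
    rewrite -(ler_pM2l L0') -{1}(ger0_norm (ltW L0')) -normrM.
    apply: le_trans (_ : 1 <= _).
      have := congr1 (@^~ j) xy; rewrite /lab => xyj.
      have /andP[] := floor_itv (L%:R * cum x j + th i.+1).
      have /andP[] := floor_itv (L%:R * cum y j + th i.+1).
      rewrite xyj rmorphD /= ler_norml => h1 h2 h3 h4.
      by apply/andP; split; lra.
    move: LD; rewrite ler_pdivrMr // => LD; lra.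
  have fE z : f z l = cum z l.+1 - cum z l by rewrite cumsumS addrC addKr.
  rewrite !fE; have := h (lift ord0 l); have := h (widen_ord (leqnSn k) l); rewrite lift0 /=.
  by rewrite !ler_norml => /andP[? ?] /andP[? ?]; apply/andP; split; lra.
(* [v] is constant on label classes, whose width is at most 1/4, and coordinate [i] of [v x] is far
   from that of [x]: the value 0 forces [x i > 1/4], the value 1 forces [x i <= 1/2]. An approximate
   fixed point therefore has a change of each label nearby. *)
pose v x (i : 'I_M) : R :=
  if `[< exists y, [/\ in_cube y, lab i y = lab i x & 1 / 2 < y i] >] then 0 else 1.
have v01 x : in_cube x -> forall i, 0 <= v x i <= 1.
  by move=> _ i; rewrite /v; case: ifP => _; rewrite ?lexx ler01.
have vlab i x y : lab i x = lab i y -> v x i = v y i by rewrite /v => ->.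
(* A quarter of the spacing of the thresholds, so that different thresholds cannot be met at the
   same partial sum. *)
pose eps : R := (4 * M.+1%:R)^-1.
have eps0 : 0 < eps by rewrite invr_gt0 mulr_gt0.
have Mn0 : M.+1%:R != 0 :> R by rewrite pnatr_eq0.
have epsM : eps * M.+1%:R = 1 / 4 by rewrite /eps invfM -mulrA mulVf // mulr1 div1r.
have [r r0 rP] := f_unif (divr_gt0 eps0 (mulr_gt0 L0' (ltr0Sn R k))).
have kap0 : 0 < Num.min r (1 / 8) by rewrite lt_min r0; lra.
have [x cx xP] := boxwise_brouwer v01 kap0.
have kr : Num.min r (1 / 8) <= r by rewrite ge_min lexx.
have k8 : Num.min r (1 / 8) <= 1 / 8 :> R by rewrite ge_min lexx orbT.
have cl a j : in_cube a -> (forall i, `|a i - x i| <= Num.min r (1 / 8)) ->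
    `|L%:R * cum a j - L%:R * cum x j| <= eps.
  move=> ca ax; have := rP a x ca cx (fun i => le_trans (ax i) kr) => {}ax.
  rewrite -mulrBr normrM (ger0_norm (ltW L0')).
  apply: le_trans (ler_wpM2l (ltW L0') (cumsum_near j ax)) _.
  rewrite (_ : _ * _ = eps * (k%:R / k.+1%:R)); last first.
    have Kn0 : k.+1%:R != 0 :> R by rewrite pnatr_eq0.
    have Ln0 : L%:R != 0 :> R by rewrite gt_eqF.
    by move: Kn0 Ln0; move: (k.+1%:R : R) (L%:R : R) => K l K0 l0; field; apply/andP.
  by rewrite ler_piMr ?(ltW eps0) // ler_pdivrMr ?ltr0Sn // mul1r ler_nat.
have hit (t : 'I_M.+1) : exists (j : 'I_k.+1) (m : int), cum x j != 0 /\ `|L%:R * cum x j + th t - m%:~R| <= eps :> R.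
  case: (unliftP ord0 t) => [i|] ->; last first.
    exists ord_max, (L%:Z); rewrite /= cumsum_last f_sum1 oner_eq0; split=> //.
    by rewrite /th mul0r addr0 mulr1 subrr normr0 ltW.
  rewrite lift0.
  have [[a [ca ax av]] [b [cb bx bv]]] := xP i.
  have va : v a i != 0.
    apply/negP => /eqP v0; move: av; rewrite v0 add0r; move: v0; rewrite /v.
    case: asboolP => [[y [cy ya yi]] _|_ /eqP]; last by rewrite oner_eq0.
    by have := lab_sep _ _ _ cy ca ya i; rewrite ler_norml => /andP[? ?]; lra.
  have vb : v b i = 0.
    apply/eqP/negbNE/negP => v0; move: bv v0; rewrite /v.
    case: asboolP => [_|nb]; first by rewrite eqxx.
    have : ~ (1 / 2 < b i) by move=> bi; apply: nb; exists b.
    by move/negP; rewrite -leNgt; lra.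
  have [j jab] : exists j, lab i a j != lab i b j.
    apply: contrapT => h; case/eqP: va; rewrite -vb; apply: vlab; apply/funext => j.
    by apply/eqP/negbNE/negP => jab; apply: h; exists j.
  have ha := cl a j ca ax; have hb := cl b j cb bx.
  have [m mP] : exists m : int, `|L%:R * cum x j + th i.+1 - m%:~R| <= eps :> R.
    have /andP[a1 a2] := floor_itv (L%:R * cum a j + th i.+1).
    have /andP[b1 b2] := floor_itv (L%:R * cum b j + th i.+1).
    rewrite -/(lab i a j) in a1 a2; rewrite -/(lab i b j) in b1 b2.
    move: ha hb; rewrite !ler_norml => /andP[? ?] /andP[? ?].
    case: (ltgtP (lab i a j) (lab i b j)) jab => // ab _.
      exists (lab i b j); rewrite ler_norml.
      have : (lab i a j + 1)%:~R <= (lab i b j)%:~R :> R by rewrite ler_int -ltzD1 ltrD2r.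
      by move=> ?; apply/andP; split; lra.
    exists (lab i a j); rewrite ler_norml.
    have : (lab i b j + 1)%:~R <= (lab i a j)%:~R :> R by rewrite ler_int -ltzD1 ltrD2r.
    by move=> ?; apply/andP; split; lra.
  exists j, m; split=> //; apply/negP => /eqP c0; move: mP; rewrite c0 mulr0 add0r.
  rewrite -(ler_pM2r (ltr0Sn R M)) -{1}(ger0_norm (ler0n R M.+1)) -normrM mulrBl divfK ?pnatr_eq0 //.
  rewrite epsM.
  move=> h; have : `|i.+1%:Z - m * M.+1%:Z| < 1.
    rewrite -(ltr_int R) intr_norm rmorphB /= rmorphM /=; apply: le_lt_trans h _.
    by rewrite (_ : 1%:~R = 1 :> R) //; lra.
  have := ltn_ord i; move: (nat_of_ord i) => i0; have [] := leP m 0; clear; nia.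
have {hit} [h hP] := choice hit.
have hz t : exists i : 'I_k, f x i != 0 /\ cum x (h t) = \sum_(i' < k | (i' <= i)%N) f x i'.
  by case: (hP t) => m [/cum_last_nonzero[i]]; exists i.
have {hz} [g gP] := choice hz.
exists x => //.
have thE u : th u * M.+1%:R = u%:Z%:~R :> R by rewrite /th divfK.
have ginj : injective g.
  move=> t t' tt'.
  have ct : cum x (h t) = cum x (h t') by rewrite (gP t).2 (gP t').2 tt'.
  case: (hP t) => m [_ mP]; case: (hP t') => m' [_ mP']; rewrite ct in mP.
  have : `|(t%:Z - t'%:Z) - (m - m') * M.+1%:Z| < 1.
    rewrite -(ltr_int R) intr_norm !rmorphB /= rmorphM /= rmorphB /=.
    have -> : (t%:~R - t'%:~R - (m%:~R - m'%:~R) * M.+1%:~R : R) =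
        ((L%:R * cum x (h t') + th t - m%:~R) - (L%:R * cum x (h t') + th t' - m'%:~R)) * M.+1%:R.
      by rewrite -(thE t) -(thE t'); ring.
    rewrite normrM (ger0_norm (ler0n R _)); apply: le_lt_trans (_ : 2 * eps * M.+1%:R < _).
      rewrite ler_wpM2r ?ler0n //; apply: le_trans (ler_normB _ _) _; lra.
    by rewrite -mulrA epsM (_ : 1%:~R = 1 :> R) //; lra.
  move=> hh; apply: val_inj; move: hh (ltn_ord t) (ltn_ord t') => /=.
  move: (nat_of_ord t) (nat_of_ord t') (m - m') => a b c.
  by have [c0|c0|->] := ltgtP c 0; [move: c0 | move: c0 |]; clear; nia.
have <- : #|g @: [set: 'I_M.+1]%SET| = M.+1 by rewrite card_imset // cardsT card_ord.
by apply/subset_leq_card/fintype.subsetP => i /imsetP[t _ ->]; rewrite inE; case: (gP t).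
Qed.
End CubeToSimplex.

(** * Bounded uniformly continuous functions *)

Lemma uniform_radius (R : realType) (I : finType) (P : I -> R -> Prop) :
  (forall i q q', q <= q' -> P i q' -> P i q) -> (forall i, exists2 q, 0 < q & P i q) ->
  exists2 q, 0 < q & forall i, P i q.
Proof.
move=> mono ex.
have [q qP] : exists q : I -> R, forall i, 0 < q i /\ P i (q i).
  have ex' i : exists q, 0 < q /\ P i q by have [q q0 qP] := ex i; exists q.
  by have [q qP] := choice ex'; exists q.
exists (\big[Num.min/1]_i q i); first by apply: lt_bigmin => // i _; case: (qP i).
by move=> i; apply: mono (qP i).2; exact: bigmin_le.
Qed.

Section UniformContinuity.
Variables (R : realType) (X : Type) (dom : X -> Prop) (near : R -> X -> X -> Prop).
Hypothesis near_mono : forall r r' x y, r <= r' -> near r x y -> near r' x y.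
Implicit Types g h : X -> R.

Definition ucont g := forall e, 0 < e -> exists2 r, 0 < r &
  forall x y, dom x -> dom y -> near r x y -> `|g x - g y| <= e.
Definition ubounded g := exists2 C, 0 < C & forall x, dom x -> `|g x| <= C.
(** Boundedness is carried along because products need it. *)
Definition uc g := ubounded g /\ ucont g.

Lemma uc_ext g h : (forall x, dom x -> g x = h x) -> uc h -> uc g.
Proof.
move=> gh [[C C0 hC] hc]; split; first by exists C => // x dx; rewrite gh ?hC.
move=> e /hc[r r0 hr]; exists r => // x y dx dy; rewrite !gh //; exact: hr.
Qed.

Lemma uc_const c : uc (fun=> c).
Proof.
split; first by exists (`|c| + 1) => [|x _]; [have := normr_ge0 c; lra | lra].
by move=> e e0; exists 1 => // x y _ _ _; rewrite subrr normr0 ltW.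
Qed.

(* Every closure property below is an instance of this: a pointwise modulus
   linear in the moduli of two functions. *)
Lemma ucont2 g h k c : 0 < c -> ucont g -> ucont h ->
  (forall x y, dom x -> dom y -> `|k x - k y| <= c * (`|g x - g y| + `|h x - h y|)) -> ucont k.
Proof.
move=> c0 gc hc kP e e0.
have e' : 0 < e / (2 * c) by rewrite divr_gt0 ?mulr_gt0.
have [r r0 rP] := gc _ e'; have [q q0 qP] := hc _ e'.
exists (Num.min r q) => [|x y dx dy xy]; first by rewrite lt_min r0.
apply: le_trans (kP x y dx dy) _; rewrite mulrC -ler_pdivlMr //.
have : near r x y by apply: near_mono xy; rewrite ge_min lexx.
have : near q x y by apply: near_mono xy; rewrite ge_min lexx orbT.
move=> /(qP x y dx dy) ? /(rP x y dx dy) ?.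
have -> : e / c = e / (2 * c) + e / (2 * c) by rewrite invfM mulrA -mulrDl -splitr.
exact: lerD.
Qed.

Lemma uc_add g h : uc g -> uc h -> uc (fun x => g x + h x).
Proof.
move=> [[C C0 gC] gc] [[D D0 hD] hc]; split.
  exists (C + D) => [|x dx]; first by rewrite addr_gt0.
  by apply: le_trans (ler_normD _ _) _; rewrite lerD ?gC ?hD.
apply: (ucont2 ltr01 gc hc) => x y dx dy; rewrite mul1r.
have -> : g x + h x - (g y + h y) = (g x - g y) + (h x - h y) by ring.
exact: ler_normD.
Qed.

Lemma uc_mul g h : uc g -> uc h -> uc (fun x => g x * h x).
Proof.
move=> [[C C0 gC] gc] [[D D0 hD] hc]; split.
  exists (C * D) => [|x dx]; first by rewrite mulr_gt0.
  by rewrite normrM ler_pM ?gC ?hD.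
apply: (ucont2 (addr_gt0 C0 D0) gc hc) => x y dx dy.
have -> : g x * h x - g y * h y = (g x - g y) * h x + g y * (h x - h y) by ring.
apply: le_trans (ler_normD _ _) _; rewrite !normrM.
have := normr_ge0 (g x - g y); have := normr_ge0 (h x - h y).
have := hD x dx; have := gC y dy; move: `|g x - g y| `|h x - h y| `|h x| `|g y| => a b c d.
move=> dC cD b0 a0; have := ler_wpM2l a0 cD; have := ler_wpM2r b0 dC.
by have := mulr_ge0 a0 (ltW C0); have := mulr_ge0 b0 (ltW D0); lra.
Qed.

Lemma uc_opp g : uc g -> uc (fun x => - g x).
Proof. by move=> gc; apply: uc_ext (uc_mul (uc_const (-1)) gc) => x _; rewrite mulN1r. Qed.

Lemma uc_sub g h : uc g -> uc h -> uc (fun x => g x - h x).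
Proof. by move=> gc /uc_opp; apply: uc_add. Qed.

Lemma uc_sum (I : finType) (g : I -> X -> R) : (forall i, uc (g i)) -> uc (fun x => \sum_i g i x).
Proof.
move=> gc; suff : forall r : seq I, uc (fun x => \sum_(i <- r) g i x) by [].
elim=> [|i r' ih]; first by apply: uc_ext (uc_const 0) => x _; rewrite big_nil.
by apply: uc_ext (uc_add (gc i) ih) => x _; rewrite big_cons.
Qed.

Lemma uc_norm g : uc g -> uc (fun x => `|g x|).
Proof.
move=> [[C C0 gC] gc]; split; first by exists C => // x dx; rewrite normr_id gC.
apply: (ucont2 ltr01 gc gc) => x y dx dy; rewrite mul1r.
by have := lerB_dist (g x) (g y); have := lerB_dist (g y) (g x); rewrite (distrC (g y)) ler_norml => ? ?;
   have := normr_ge0 (g x - g y) => ?; apply/andP; split; lra.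
Qed.

Lemma uc_max g h : uc g -> uc h -> uc (fun x => Num.max (g x) (h x)).
Proof.
move=> gc hc; apply: uc_ext (uc_mul (uc_const (1 / 2)) (uc_add (uc_add gc hc) (uc_norm (uc_sub gc hc)))) => x _.
by have [gh|gh] := leP (g x) (h x); [rewrite ler0_norm | rewrite gtr0_norm]; lra.
Qed.

Lemma uc_bigmax (I : finType) (g : I -> X -> R) :
  (forall i, uc (g i)) -> uc (fun x => \big[Num.max/0]_i g i x).
Proof.
move=> gc; suff : forall r : seq I, uc (fun x => \big[Num.max/0]_(i <- r) g i x) by [].
elim=> [|i r' ih]; first by apply: uc_ext (uc_const 0) => x _; rewrite big_nil.
by apply: uc_ext (uc_max (gc i) ih) => x _; rewrite big_cons.
Qed.

(** For square roots [a] and [b], [1/a - 1/b] is [(b ^ 2 - a ^ 2) / (a b (a + b))], and the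
    denominator is at least the cube of [Num.sqrt c]. *)
Lemma uc_inv_sqrt g c : 0 < c -> (forall x, dom x -> c <= g x) -> uc g -> uc (fun x => (Num.sqrt (g x))^-1).
Proof.
move=> c0 cg [[C C0 gC] gc].
have sc0 : 0 < Num.sqrt c by rewrite sqrtr_gt0.
have sg x : dom x -> Num.sqrt c <= Num.sqrt (g x) by move=> dx; apply: ler_wsqrtr; apply: cg.
split.
  exists (Num.sqrt c)^-1; first by rewrite invr_gt0.
  move=> x dx; rewrite ger0_norm ?invr_ge0 ?sqrtr_ge0 // lef_pV2 ?posrE ?sg //.
  exact: lt_le_trans (sg x dx).
pose K := (Num.sqrt c)^-1 ^+ 3.
have K0 : 0 < K by rewrite exprn_gt0 // invr_gt0.
apply: (ucont2 K0 gc gc) => x y dx dy.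
have := sg x dx; have := sg y dy; set a := Num.sqrt (g x); set b := Num.sqrt (g y) => hb ha.
have a0 : 0 < a by exact: lt_le_trans ha.
have b0 : 0 < b by exact: lt_le_trans hb.
have -> : g x - g y = (a - b) * (a + b).
  transitivity (a ^+ 2 - b ^+ 2); last by ring.
  by rewrite /a /b !sqr_sqrtr //; apply: le_trans (ltW c0) (cg _ _).
have -> : a^-1 - b^-1 = (b - a) / (a * b) by field; rewrite !gt_eqF.
rewrite !normrM normfV (distrC b) mulrDr.
rewrite (ger0_norm (ltW (mulr_gt0 a0 b0))) (ger0_norm (ltW (addr_gt0 a0 b0))).
have h : (a * b)^-1 <= K * (a + b).
  rewrite /K; move: ha hb sc0; set s := Num.sqrt c => ha hb s0.
  rewrite invfM -ler_pdivrMr ?addr_gt0 //.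
  have va : a^-1 <= s^-1 by rewrite lef_pV2.
  have vb : b^-1 <= s^-1 by rewrite lef_pV2.
  have vab : (a + b)^-1 <= s^-1 by rewrite lef_pV2 ?posrE ?addr_gt0 //; lra.
  rewrite exprS expr2 mulrA; apply: ler_pM => //; rewrite ?mulr_ge0 ?invr_ge0 //; try lra.
  by apply: ler_pM => //; rewrite invr_ge0 ltW.
have n0 := normr_ge0 (a - b); have ab := ltW (addr_gt0 a0 b0).
have p0 := mulr_ge0 (ltW K0) (mulr_ge0 n0 ab).
have : `|a - b| * (a * b)^-1 <= `|a - b| * (K * (a + b)) by rewrite ler_wpM2l.
by rewrite mulrCA; lra.
Qed.

Lemma ucont_comp (I : finType) (F : (I -> R) -> R) (g : I -> X -> R) :
  (forall e, 0 < e -> exists2 r, 0 < r & forall a b, (forall i, `|a i - b i| <= r) -> `|F a - F b| <= e) ->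
  (forall i, ucont (g i)) -> ucont (fun x => F (g^~ x)).
Proof.
move=> Fc gc e /Fc[r r0 rP].
have [q q0 qP] := uniform_radius (fun i q q' qq (h : forall x y, dom x -> dom y -> near q' x y -> `|g i x - g i y| <= r)
  x y dx dy xy => h x y dx dy (near_mono qq xy)) (fun i => gc i r r0).
by exists q => // x y dx dy xy; apply: rP => i; apply: qP.
Qed.
End UniformContinuity.

(** * Trees of vectors *)

(* Coordinates of a configuration: one vector of length [m] per inner node of
   the complete binary tree of height [h]. *)
Fixpoint tree_index (m h : nat) : finType :=
  if h is h'.+1 then ('I_m + (tree_index m h' + tree_index m h'))%type : finType
  else void : finType.

Section TreeIndex.
Variable m : nat.
Notation idx := (tree_index m).

Definition root_part (A : Type) h (x : idx h.+1 -> A) : 'I_m -> A := fun a => x (inl a).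
Definition left_part (A : Type) h (x : idx h.+1 -> A) : idx h -> A := fun j => x (inr (inl j)).
Definition right_part (A : Type) h (x : idx h.+1 -> A) : idx h -> A := fun j => x (inr (inr j)).
Definition join (A : Type) h (u : 'I_m -> A) (L R : idx h -> A) : idx h.+1 -> A :=
  fun i => match i with inl a => u a | inr (inl j) => L j | inr (inr j) => R j end.

Lemma join_inj (A : Type) h (u u' : 'I_m -> A) (L R L' R' : idx h -> A) :
  join u L R = join u' L' R' -> [/\ u = u', L = L' & R = R'].
Proof.
move=> e; split; apply/funext => j.
- exact: (congr1 (fun f => f (inl j : idx h.+1)) e).
- exact: (congr1 (fun f => f (inr (inl j) : idx h.+1)) e).
- exact: (congr1 (fun f => f (inr (inr j) : idx h.+1)) e).
Qed.

Lemma joinE (A : Type) h (x : idx h.+1 -> A) :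
  x = join (root_part x) (left_part x) (right_part x).
Proof. by apply/funext => -[a|[j|j]]. Qed.

(* Gluing at a coordinate of a node negates the vector of that node and
   exchanges its two subtrees. *)
Fixpoint tree_perm h : idx h -> idx h -> idx h :=
  if h is h'.+1 then fun i i' : idx h'.+1 =>
    match i, i' with
    | inl _, inl b => inl b
    | inl _, inr (inl j) => inr (inr j)
    | inl _, inr (inr j) => inr (inl j)
    | inr (inl i0), inr (inl j) => inr (inl (tree_perm i0 j))
    | inr (inr i0), inr (inr j) => inr (inr (tree_perm i0 j))
    | _, _ => i'
    end else fun _ i' => i'.

Fixpoint tree_sign h : idx h -> idx h -> bool :=
  if h is h'.+1 then fun i i' : idx h'.+1 =>
    match i, i' with
    | inl _, inl b => true
    | inr (inl i0), inr (inl j) => tree_sign i0 j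
    | inr (inr i0), inr (inr j) => tree_sign i0 j
    | _, _ => false
    end else fun _ _ => true.

Lemma tree_permK h (i : idx h) : involutive (tree_perm i).
Proof.
elim: h i => [|h ih] //= [a|[i|i]] [b|[j|j]] //; first by congr (inr (inl _)); apply: ih.
by congr (inr (inr _)); apply: ih.
Qed.

Lemma tree_permii h (i : idx h) : tree_perm i i = i.
Proof.
elim: h i => [|h ih] //= [a|[i|i]] //; first by congr (inr (inl _)); apply: ih.
by congr (inr (inr _)); apply: ih.
Qed.

Lemma tree_signii h (i : idx h) : tree_sign i i.
Proof. by elim: h i => [|h ih] //= [a|[i|i]] //; apply: ih. Qed.

Lemma tree_sign_perm h (i i' : idx h) : tree_sign i (tree_perm i i') = tree_sign i i'.
Proof. by elim: h i i' => [|h ih] //= [a|[i|i]] [b|[j|j]] //; apply: ih. Qed.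

Variable N : nat.
Hypothesis N_gt0 : (0 < N)%N.
Notation twoN := (2 * N%:Z).
Notation box x := (forall i', `|x i'| <= twoN).

(** Normal form for the gluings: from the root down, a node whose first extremal coordinate is
    negative is negated and its subtrees exchanged. [tree_gp] and [tree_ge] record where a
    coordinate goes and with which sign. *)
Fixpoint tree_can h : (idx h -> int) -> idx h -> int :=
  if h is h'.+1 then fun x : idx h'.+1 -> int =>
    if neg_first N (root_part x)
    then join (fun a => - root_part x a) (tree_can (right_part x)) (tree_can (left_part x))
    else join (root_part x) (tree_can (left_part x)) (tree_can (right_part x))
  else fun x => x.

Fixpoint tree_gp h : (idx h -> int) -> idx h -> idx h :=
  if h is h'.+1 then fun (x : idx h'.+1 -> int) (i : idx h'.+1) =>
    match i with
    | inl a => inl a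
    | inr (inl j) => let j' := tree_gp (left_part x) j in
        if neg_first N (root_part x) then inr (inr j') else inr (inl j')
    | inr (inr j) => let j' := tree_gp (right_part x) j in
        if neg_first N (root_part x) then inr (inl j') else inr (inr j')
    end
  else fun _ i => i.

Fixpoint tree_ge h : (idx h -> int) -> idx h -> bool :=
  if h is h'.+1 then fun (x : idx h'.+1 -> int) (i : idx h'.+1) =>
    match i with
    | inl a => neg_first N (root_part x)
    | inr (inl j) => tree_ge (left_part x) j
    | inr (inr j) => tree_ge (right_part x) j
    end
  else fun _ _ => false.

Notation tglue h := (glue (@tree_perm h) (@tree_sign h)).

Lemma glue_root h (a : 'I_m) (x : idx h.+1 -> int) :
  tglue h.+1 (inl a) x = join (fun b => - root_part x b) (right_part x) (left_part x).
Proof. by apply/funext => -[b|[j|j]]. Qed.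
Lemma glue_left h (i : idx h) (x : idx h.+1 -> int) :
  tglue h.+1 (inr (inl i)) x = join (root_part x) (tglue h i (left_part x)) (right_part x).
Proof. by apply/funext => -[b|[j|j]]. Qed.
Lemma glue_right h (i : idx h) (x : idx h.+1 -> int) :
  tglue h.+1 (inr (inr i)) x = join (root_part x) (left_part x) (tglue h i (right_part x)).
Proof. by apply/funext => -[b|[j|j]]. Qed.

Lemma neg_first_flip h (a : 'I_m) (x : idx h.+1 -> int) : `|x (inl a)| = twoN ->
  neg_first N (fun b => - root_part x b) = ~~ neg_first N (root_part x).
Proof. by move=> xa; apply: neg_firstN => //; exists a; apply/eqP. Qed.

Lemma tree_can_glue h (i : idx h) x : `|x i| = twoN -> tree_can (tglue h i x) = tree_can x.
Proof.
elim: h i x => [|h ih] //= [a|[i|i]] x xi.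
- rewrite glue_root /= (neg_first_flip xi).
  case: (neg_first N (root_part x)) => //=.
  by congr join; apply/funext => b; rewrite /root_part /= opprK.
- rewrite glue_left /= [left_part (join _ _ _)](_ : _ = tglue h i (left_part x)) //.
  by rewrite [tree_can (glue _ _ _ _)]ih.
- rewrite glue_right /= [right_part (join _ _ _)](_ : _ = tglue h i (right_part x)) //.
  by rewrite [tree_can (glue _ _ _ _)]ih.
Qed.

Lemma tree_gp_glue h (i : idx h) x i' : `|x i| = twoN ->
  tree_gp (tglue h i x) i' = tree_gp x (tree_perm i i').
Proof.
elim: h i x i' => [|h ih] //= [a|[i|i]] x [b|[j|j]] xi //.
- by rewrite glue_root /= (neg_first_flip xi) if_neg.
- by rewrite glue_root /= (neg_first_flip xi) if_neg.
- by rewrite glue_left /=; rewrite -[tree_gp _ (tree_perm _ _)]ih.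
- by rewrite glue_right /=; rewrite -[tree_gp _ (tree_perm _ _)]ih.
Qed.

Lemma tree_ge_glue h (i : idx h) x i' : `|x i| = twoN ->
  tree_ge (tglue h i x) i' = tree_sign i i' (+) tree_ge x (tree_perm i i').
Proof.
elim: h i x i' => [|h ih] //= [a|[i|i]] x [b|[j|j]] xi //; last 2 first.
- by rewrite glue_left; apply: ih.
- by rewrite glue_right; apply: ih.
- by rewrite glue_root /= (neg_first_flip xi).
Qed.

Lemma tree_gp_inj h (x : idx h -> int) : injective (tree_gp x).
Proof.
elim: h x => [|h ih] x //= [a|[i|i]] [b|[j|j]] //; do ?[by case: ifP | by case: ifP => _ [] /ih -> | by case].
Qed.

(** Neighbours take the same decision at every node: otherwise their vectors there would be opposite
    with an extremal coordinate, hence at distance 4N. *)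
Lemma tree_can_inj h (x y : idx h -> int) :
  (forall i, `|x i - y i| <= 1) -> tree_can x = tree_can y -> x = y.
Proof.
elim: h x y => [|h ih] x y //= near.
have nl i : `|left_part x i - left_part y i| <= 1 by apply: near.
have nr i : `|right_part x i - right_part y i| <= 1 by apply: near.
have nu i : `|root_part x i - root_part y i| <= 1 by apply: near.
case nx: (neg_first N (root_part x)); case ny: (neg_first N (root_part y)) => /join_inj[eu el er].
- rewrite (joinE x) (joinE y); congr join; [|exact: ih er|exact: ih el].
  by apply/funext => a; have := congr1 (fun f => - f a) eu; rewrite /= !opprK.
- by case: (near_opp_eq N_gt0 nu _ nx) => a; rewrite -[root_part y a](congr1 (@^~ a) eu) /= opprK.
- case: (@near_opp_eq _ _ (root_part y) (root_part x) N_gt0 _ _ ny) => a; first by rewrite distrC.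
  by rewrite [root_part x a](congr1 (@^~ a) eu) opprK.
- by rewrite (joinE x) (joinE y) eu (ih _ _ nl el) (ih _ _ nr er).
Qed.

Lemma tree_canE h (x : idx h -> int) i :
  x i = if tree_ge x i then - tree_can x (tree_gp x i) else tree_can x (tree_gp x i).
Proof.
elim: h x i => [|h ih] x //= [a|[i|i]].
- by case: (neg_first N (root_part x)); rewrite /= ?opprK.
- by rewrite [LHS](ih (left_part x) i); case: (neg_first N (root_part x)).
- by rewrite [LHS](ih (right_part x) i); case: (neg_first N (root_part x)).
Qed.

Lemma tree_can0 h : tree_can (fun=> 0 : int) = (fun=> 0) :> (idx h -> int).
Proof.
elim: h => [|h ih] //=; rewrite [root_part _](_ : _ = fun=> 0) // neg_first0 //.
by rewrite [tree_can (left_part _)]ih; apply/funext => -[a|[j|j]].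
Qed.

Lemma tree_gp0 h (i : idx h) : tree_gp (fun=> 0 : int) i = i.
Proof.
elim: h i => [|h ih] //= [a|[i|i]] //; rewrite [root_part _](_ : _ = fun=> 0) // neg_first0 //.
  by congr (inr (inl _)); apply: ih.
by congr (inr (inr _)); apply: ih.
Qed.

Lemma tree_ge0 h (i : idx h) : tree_ge (fun=> 0 : int) i = false.
Proof. by elim: h i => [|h ih] //= [a|[i|i]]; [exact: neg_first0 | exact: ih | exact: ih]. Qed.

End TreeIndex.

(** * Sums and discrepancies over the leaves of a tree *)

Section PathSums.
Variable R : realType.

Fixpoint path_sum (h : nat) (g : seq bool -> R) : R :=
  if h is h'.+1 then path_sum h' (fun l => g (false :: l)) + path_sum h' (fun l => g (true :: l))
  else g [::].

Lemma path_sum_ext h g g' : (forall l, size l = h -> g l = g' l) -> path_sum h g = path_sum h g'.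
Proof.
elim: h g g' => [|h ih] g g' gg' /=; first exact: gg'.
by congr (_ + _); apply: ih => l lh; apply: gg'; rewrite /= lh.
Qed.

Lemma path_sum_le h g g' : (forall l, size l = h -> g l <= g' l) -> path_sum h g <= path_sum h g'.
Proof.
elim: h g g' => [|h ih] g g' gg' /=; first exact: gg'.
by apply: lerD; apply: ih => l lh; apply: gg'; rewrite /= lh.
Qed.

Lemma path_sum_const h c : path_sum h (fun=> c) = 2 ^+ h * c.
Proof. by elim: h => [|h ih] /=; rewrite ?expr0 ?mul1r // ih exprS; ring. Qed.

Lemma path_sum_near h g v c : (forall l, size l = h -> `|g l - v| <= c) ->
  `|path_sum h g - 2 ^+ h * v| <= 2 ^+ h * c.
Proof.
move=> gv; have h1 : path_sum h g <= 2 ^+ h * (v + c).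
  by rewrite -path_sum_const; apply: path_sum_le => l /gv; rewrite ler_norml => /andP[_]; lra.
have h2 : 2 ^+ h * (v - c) <= path_sum h g.
  by rewrite -path_sum_const; apply: path_sum_le => l /gv; rewrite ler_norml => /andP[]; lra.
by rewrite ler_norml; apply/andP; split; lra.
Qed.

Variable m : nat.
(** The equations to solve, one per tree coordinate: at each node the sums over its two subtrees
    agree. Exchanging the subtrees negates the equation of the node and permutes those below, as the
    gluings do. *)
Fixpoint discrepancy (h : nat) : (seq bool -> 'I_m -> R) -> tree_index m h -> R :=
  if h is h'.+1 then fun phi (i : tree_index m h'.+1) =>
    match i with
    | inl a => path_sum h' (fun l => phi (false :: l) a) - path_sum h' (fun l => phi (true :: l) a)
    | inr (inl j) => discrepancy (fun l => phi (false :: l)) j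
    | inr (inr j) => discrepancy (fun l => phi (true :: l)) j
    end
  else fun _ _ => 0.

Lemma discrepancy_ext h phi phi' i : (forall l a, size l = h -> phi l a = phi' l a) ->
  @discrepancy h phi i = discrepancy phi' i.
Proof.
elim: h phi phi' i => [|h ih] phi phi' i e //=; case: i => [a|[j|j]].
- by congr (_ - _); apply: path_sum_ext => l lh; apply: e; rewrite /= lh.
- by apply: ih => l a lh; apply: e; rewrite /= lh.
- by apply: ih => l a lh; apply: e; rewrite /= lh.
Qed.

(** By induction the values inside each half differ by at most [c]; the half sums differ by at most
    [k], so the averages do too, and crossing from one half to the other costs [2 * c + k]. *)
Lemma small_discrepancy h phi k : 0 <= k -> (forall i, `|@discrepancy h phi i| <= k) ->
  forall l l' a, size l = h -> size l' = h -> `|phi l a - phi l' a| <= (2 ^+ h - 1) * k.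
Proof.
move=> k0; elim: h phi => [|h ih] phi hd l l' a.
  by move=> /size0nil -> /size0nil ->; rewrite subrr normr0 expr0 subrr mul0r.
have p1 : 1 <= 2 ^+ h :> R by rewrite exprn_ege1 // ler1n.
set c := (2 ^+ h - 1) * k.
have cE : (2 ^+ h.+1 - 1) * k = 2 * c + k by rewrite /c exprS; ring.
have c0 : 0 <= c by rewrite mulr_ge0 // subr_ge0.
have hf := ih (fun l => phi (false :: l)) (fun j => hd (inr (inl j))).
have ht := ih (fun l => phi (true :: l)) (fun j => hd (inr (inr j))).
have cross l1 l2 : size l1 = h -> size l2 = h ->
    `|phi (false :: l1) a - phi (true :: l2) a| <= (2 ^+ h.+1 - 1) * k.
  move=> s1 s2; rewrite cE; clear cE c0.
  have a1 := path_sum_near (fun l sl => hf l l1 a sl s1).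
  have a2 := path_sum_near (fun l sl => ht l l2 a sl s2).
  have a3 := hd (inl a); rewrite /= in a3.
  rewrite -/c in a1 a2; move: a1 a2 a3; rewrite /=.
  set s := path_sum _ _; set t := path_sum _ _; move: (phi _ a) (phi _ a) => x y.
  have p0 := lt_le_trans ltr01 p1; rewrite !ler_norml.
  have : k <= 2 ^+ h * k by rewrite ler_peMl.
  clearbody c; move: (2 ^+ h) p0 => p p0; clear -p0.
  by move=> ? /andP[? ?] /andP[? ?] /andP[? ?]; apply/andP; split; rewrite -(ler_pM2l p0); lra.
case: l => // -[] l [] s1; case: l' => // -[] l' [] s2.
- by apply: le_trans (ht _ _ _ s1 s2) _; rewrite cE -/c; lra.
- by rewrite distrC; apply: cross.
- exact: cross.
- by apply: le_trans (hf _ _ _ s1 s2) _; rewrite cE -/c; lra.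
Qed.
End PathSums.

(** * Points at the leaves, and their coincidence under a map *)

Section Leaves.
Variables (R : realType) (m : nat) (K : finType) (S : Type).
Notation E := (K -> R).
Notation idx := (tree_index m).
Variable B : S -> ('I_m -> R) -> bool -> E -> E.
Hypothesis B_antipodal : forall s u b c, (forall a, `|u a| <= 1) -> (exists a, `|u a| = 1) ->
  B s (fun a => - u a) b c = B s u (~~ b) c.
Hypothesis B_uc : forall (X : Type) dom near s b (u : X -> 'I_m -> R) (c : X -> E),
  (forall r r' x y, r <= r' -> near r x y -> near r' x y) ->
  (forall a, uc dom near (u^~ a)) -> (forall x a, dom x -> `|u x a| <= 1) ->
  (forall k, uc dom near (c^~ k)) -> forall k, uc dom near (fun x => B s (u x) b (c x) k).

(** The map at the root is applied last and the one next to the leaf first, starting from the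
    origin. By [B_antipodal], negating a boundary vector exchanges the two branches at its node. *)
Fixpoint leaf (st : seq S) : (idx (size st) -> R) -> seq bool -> E :=
  if st is s :: st' then fun x l =>
    B s (root_part x) (head false l)
      (leaf (if head false l then right_part x else left_part x) (behead l))
  else fun _ _ _ => 0.

Lemma leaf_uc (X : Type) dom near (st : seq S) (x : X -> idx (size st) -> R) l :
  (forall r r' x y, r <= r' -> near r x y -> near r' x y) ->
  (forall i, uc dom near (x^~ i)) -> (forall z i, dom z -> `|x z i| <= 1) ->
  forall k, uc dom near (fun z => leaf (x z) l k).
Proof.
move=> nm; elim: st x l => [|s st ih] x l xu xb k /=; first exact: uc_const.
apply: B_uc => // [a|z a dz|]; first exact: (xu (inl a)).
  exact: xb.
by case: (head false l); apply: ih => [i|z i dz]; [exact: (xu (inr (inr i))) | exact: xb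
   | exact: (xu (inr (inl i))) | exact: xb].
Qed.

Section Grid.
Variable N : nat.
Hypothesis N_gt0 : (0 < N)%N.
Notation twoN := (2 * N%:Z).

Definition scaled (I : Type) (x : I -> int) : I -> R := fun i => (x i)%:~R / (2 * N%:R).

Lemma scaled_le1 (I : Type) (x : I -> int) i : `|x i| <= twoN -> `|scaled x i| <= 1.
Proof.
move=> xi; have N0 : 0 < 2 * N%:R :> R by rewrite mulr_gt0 ?ltr0n.
rewrite /scaled normrM normfV (gtr0_norm N0) ler_pdivrMr // mul1r -intr_norm.
by rewrite -[2 * _](_ : (2 * N%:Z)%:~R = _) ?ler_int // rmorphM.
Qed.

Let B_flip s (u : 'I_m -> int) b c : (forall a, `|u a| <= twoN) -> neg_first N u ->
  B s (scaled (fun a => - u a)) b c = B s (scaled u) (~~ b) c.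
Proof.
move=> ub /neg_first_boundary[a /eqP ua].
have -> : scaled (fun a => - u a) = (fun a => - scaled u a).
  by apply/funext => b'; rewrite /scaled rmorphN mulNr.
apply: B_antipodal => [a'|]; first exact: scaled_le1.
exists a; rewrite /scaled normrM normfV -intr_norm ua rmorphM /= ger0_norm ?mulr_ge0 ?ler0n //.
by rewrite divff // mulf_neq0 ?pnatr_eq0 // -lt0n.
Qed.

Let box h (x : idx h -> int) := forall i, `|x i| <= twoN.

(** Passing to the normal form only permutes the leaves. *)
Lemma leaf_sum_can st (phi : E -> R) (x : idx (size st) -> int) : box x ->
  path_sum (size st) (fun l => phi (leaf (scaled x) l)) =
  path_sum (size st) (fun l => phi (leaf (scaled (tree_can N x)) l)).
Proof.
elim: st phi x => [|s st ih] phi x bx //=.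
have bl : box (left_part x) by move=> i; apply: bx.
have br : box (right_part x) by move=> i; apply: bx.
have bu a : `|root_part x a| <= twoN by apply: bx.
have El := ih (fun c => phi (B s (scaled (root_part x)) false c)) _ bl.
have Er := ih (fun c => phi (B s (scaled (root_part x)) true c)) _ br.
rewrite [X in X + _]El [X in _ + X]Er.
case nx: (neg_first N (root_part x)); last by [].
rewrite addrC; congr (_ + _); apply: path_sum_ext => l _ /=.
  by congr phi; rewrite [RHS](B_flip _ _ _ bu nx).
by congr phi; rewrite [RHS](B_flip _ _ _ bu nx).
Qed.

Lemma discrepancy_can st (phi : E -> 'I_m -> R) (x : idx (size st) -> int) i : box x ->
  discrepancy (fun l => phi (leaf (scaled x) l)) i =
  sgr R (tree_ge N x i) * discrepancy (fun l => phi (leaf (scaled (tree_can N x)) l)) (tree_gp N x i).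
Proof.
elim: st phi x i => [|s st ih] phi x i bx //=.
have bl : box (left_part x) by move=> j; apply: bx.
have br : box (right_part x) by move=> j; apply: bx.
have bu a : `|root_part x a| <= twoN by apply: bx.
have El a := leaf_sum_can (fun c => phi (B s (scaled (root_part x)) false c) a) bl.
have Er a := leaf_sum_can (fun c => phi (B s (scaled (root_part x)) true c) a) br.
have Dl j := ih (fun c => phi (B s (scaled (root_part x)) false c)) _ j bl.
have Dr j := ih (fun c => phi (B s (scaled (root_part x)) true c)) _ j br.
case: i => [a|[j|j]].
- rewrite [X in X - _]El [X in _ - X]Er.
  case nx: (neg_first N (root_part x)); last by rewrite mul1r.
  rewrite mulN1r opprB; congr (_ - _); apply: path_sum_ext => l _ /=.
    by congr phi; rewrite [RHS](B_flip _ _ _ bu nx).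
  by congr phi; rewrite [RHS](B_flip _ _ _ bu nx).
- rewrite [LHS]Dl; case nx: (neg_first N (root_part x)); last by [].
  congr (_ * _); apply: discrepancy_ext => l b _ /=.
  by congr phi; rewrite [RHS](B_flip _ _ _ bu nx).
- rewrite [LHS]Dr; case nx: (neg_first N (root_part x)); last by [].
  congr (_ * _); apply: discrepancy_ext => l b _ /=.
  by congr phi; rewrite [RHS](B_flip _ _ _ bu nx).
Qed.
End Grid.

Lemma uc_path_sum (X : Type) dom (near : R -> X -> X -> Prop) h (g : X -> seq bool -> R) :
  (forall r r' x y, r <= r' -> near r x y -> near r' x y) ->
  (forall l, uc dom near (g^~ l)) -> uc dom near (fun z => path_sum h (g z)).
Proof.
move=> nm; elim: h g => [|h ih] g gu /=; first exact: gu.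
by apply: uc_add => //; apply: ih => l; apply: gu.
Qed.

Lemma uc_discrepancy (X : Type) dom (near : R -> X -> X -> Prop) h (g : X -> seq bool -> 'I_m -> R) :
  (forall r r' x y, r <= r' -> near r x y -> near r' x y) ->
  (forall l a, uc dom near (fun z => g z l a)) ->
  forall i : idx h, uc dom near (fun z => discrepancy (g z) i).
Proof.
move=> nm; elim: h g => [|h ih] g gu //= [a|[j|j]].
- by apply: uc_sub => //; apply: uc_path_sum => // l; apply: gu.
- by apply: ih => l a; apply: gu.
- by apply: ih => l a; apply: gu.
Qed.

(** [glued_cube_zero] makes all discrepancies small. Half of [kappa / 2 ^ h] is the tolerance of the
    zero, the other half the variation of a discrepancy between neighbouring grid points. *)
Theorem tree_coincidence (F : E -> 'I_m -> R) (st : seq S) (kappa : R) :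
  (forall e, 0 < e -> exists2 r, 0 < r &
     forall a b, (forall i, `|a i - b i| <= r) -> forall j, `|F a j - F b j| <= e) ->
  (exists C, forall a j, `|F a j| <= C) -> 0 < kappa ->
  exists2 z, (forall i, `|z i| <= 1) & forall l l' a, size l = size st -> size l' = size st ->
    `|F (@leaf st z l) a - F (@leaf st z l') a| <= kappa.
Proof.
move=> Fc [C FC] kappa0; set h := size st.
pose dom (z : idx h -> R) := forall i, `|z i| <= 1.
pose near (r : R) (z z' : idx h -> R) := forall i, `|z i - z' i| <= r.
have nm r r' x y : r <= r' -> near r x y -> near r' x y by move=> rr xy i; apply: le_trans rr.
have xu (i : idx h) : uc dom near (fun z => z i).
  by split; [exists 1 | move=> e e0; exists e].
have Fu l a : uc dom near (fun z : idx h -> R => F (@leaf st z l) a).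
  split; first by exists (`|C| + 1) => [|x _]; [have := normr_ge0 C; lra | have := ler_norm C; have := FC (@leaf st x l) a; lra].
  apply: (@ucont_comp _ _ _ _ nm _ (fun c => F c a) (fun k z => @leaf st z l k)).
    by move=> e /Fc[r r0 rP]; exists r => // u v uv; apply: rP.
  by move=> k; apply: (proj2 (leaf_uc (st := st) (x := id) l nm xu _ k)).
pose Phi (z : idx h -> R) := fun l a => F (@leaf st z l) a.
have p0 : 0 < 2 ^+ h :> R by rewrite exprn_gt0.
have e0 : 0 < kappa / 2 ^+ h / 2 by rewrite !divr_gt0.
have [r r0 rP] : exists2 r, 0 < r & forall (i : idx h) x y, dom x -> dom y -> near r x y ->
    `|discrepancy (Phi x) i - discrepancy (Phi y) i| <= kappa / 2 ^+ h / 2.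
  apply: uniform_radius => [i q q' qq H x y dx dy xy|i].
    by apply: H => //; apply: nm qq _.
  exact: (proj2 (uc_discrepancy nm Fu i) _ e0).
have [N [N0 Nr]] := large_nat r^-1.
have N0' : 0 < N%:R :> R by rewrite ltr0n.
have [||||||||||||||x bx xP] :=
  @glued_cube_zero R (idx h) N (@tree_perm m h) (@tree_sign m h) (@tree_can m N h) (@tree_gp m N h)
    (@tree_ge m N h) (fun x => discrepancy (Phi (scaled N x))) N0 _ _ _ _ _ _ _ _ _ _ _ _ _ _ _ e0.
- exact: tree_permK.
- exact: tree_permii.
- exact: tree_signii.
- exact: tree_sign_perm.
- by move=> i x _; apply: tree_can_glue.
- by move=> i x i' _; apply: tree_gp_glue.
- by move=> i x i' _; apply: tree_ge_glue.
- exact: tree_gp_inj.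
- by move=> x y _ _; apply: tree_can_inj.
- exact: tree_canE.
- exact: tree_can0.
- exact: tree_gp0.
- exact: tree_ge0.
- by move=> x i bx; apply: (@discrepancy_can N N0 st F x i bx).
have dx : dom (scaled N x) by move=> i; apply: scaled_le1.
exists (scaled N x) => // l l' a sl sl'.
apply: le_trans (_ : (2 ^+ h - 1) * (kappa / 2 ^+ h) <= _); last first.
  by rewrite mulrBl mul1r mulrC divfK ?gt_eqF // gerBl divr_ge0 // ltW.
apply: (@small_discrepancy _ _ h (Phi (scaled N x))) => // [|i].
  by rewrite divr_ge0 // ltW.
have near_x y : (forall i, `|y i| <= 2 * N%:Z) -> (forall i, `|y i - x i| <= 1) ->
    `|discrepancy (Phi (scaled N y)) i - discrepancy (Phi (scaled N x)) i| <= kappa / 2 ^+ h / 2.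
  move=> yb yx; apply: rP => // [j|j]; first exact: scaled_le1.
  rewrite /scaled -mulrBl -rmorphB normrM normfV -intr_norm (gtr0_norm (x := 2 * N%:R)) ?mulr_gt0 //.
  apply: le_trans (_ : 1 / (2 * N%:R) <= _).
    by rewrite ler_wpM2r ?invr_ge0 ?mulr_ge0 ?ler0n // (_ : 1 = 1%:~R) // ler_int.
  rewrite div1r invf_ple ?posrE ?mulr_gt0 //; lra.
have [[y [yb yx yP]] [y' [yb' yx' yP']]] := xP i.
have := near_x y yb yx; have := near_x y' yb' yx'; rewrite !ler_norml.
by move=> /andP[? ?] /andP[? ?]; apply/andP; split; lra.
Qed.
End Leaves.

(** * Gaussian decay along a tree *)

Lemma fact_double (k : nat) : (2 ^ k * k`! <= (k.*2)`!)%N.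
Proof.
elim: k => [|k ih] //; rewrite doubleS !factS expnS.
by have := fact_gt0 k; move: (2 ^ k)%N (k`!) (k.*2)`! ih => a b c; rewrite -muln2; clear; nia.
Qed.

(** Odd terms cancel, and even ones compare through [fact_double]. *)
Lemma series_cosh_le (R : realType) (z : R) n :
  series (exp_coeff z) n.*2 + series (exp_coeff (- z)) n.*2 <= 2 * series (exp_coeff (z ^+ 2 / 2)) n.
Proof.
elim: n => [|n ih]; first by rewrite /series /= !big_geq // addr0 mulr0.
rewrite doubleS /series /= !big_nat_recr //= -!/(series _ _) in ih *.
have odd_cancel : exp_coeff z n.*2.+1 + exp_coeff (- z) n.*2.+1 = 0.
  by rewrite /exp_coeff /= -mulrDl exprNn -signr_odd /= odd_double expr1 mulN1r subrr mul0r.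
have even : exp_coeff z n.*2 + exp_coeff (- z) n.*2 <= 2 * exp_coeff (z ^+ 2 / 2) n.
  rewrite /exp_coeff /= exprNn -signr_odd odd_double expr0 mul1r -mul2n exprM.
  have zn : 0 <= (z ^+ 2) ^+ n by rewrite exprn_ge0 // sqr_ge0.
  have h : ((2 * n)`!%:R : R)^-1 <= (2 ^+ n)^-1 * (n`!%:R)^-1.
    rewrite -invfM lef_pV2 ?posrE ?mulr_gt0 ?exprn_gt0 ?ltr0n ?fact_gt0 //.
    by rewrite -natrX -natrM ler_nat mul2n fact_double.
  by have := ler_wpM2l zn h; rewrite expr_div_n; lra.
rewrite -!/(series _ _); lra.
Qed.

Lemma cosh_le (R : realType) (z : R) : expR z + expR (- z) <= 2 * expR (z ^+ 2 / 2).
Proof.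
have dbl (u : R) : ((fun n => series (exp_coeff u) n.*2) @ \oo --> expR u)%classic.
  apply: (@cvg_comp _ _ _ double (series (exp_coeff u)) _ \oo%classic); last exact: is_cvg_series_exp_coeff.
  by move=> A [N _ NA]; exists N => // n Nn; apply: NA => /=; apply: leq_trans Nn _; rewrite -addnn leq_addr.
have h := cvgD (FF := eventually_filter) (dbl z) (dbl (- z)).
rewrite -(cvg_lim _ h) //; apply: limr_le; first exact: cvgP h.
apply: nearW => n; apply: le_trans (series_cosh_le z n) _; rewrite ler_wpM2l //.
apply: nondecreasing_cvgn_le; last exact: is_cvg_series_exp_coeff.
apply/nondecreasing_seqP => k; rewrite /series /= big_nat_recr //= lerDl.
by rewrite /exp_coeff /= divr_ge0 ?exprn_ge0 ?divr_ge0 ?sqr_ge0 ?ler0n.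
Qed.

Section Reflection.
Variables (R : realType) (V A : finType).
Notation E := ((V + A)%type -> R).
Implicit Types (u : V -> R) (c y : E).

Definition dotV u c : R := \sum_v u v * c (inl v).

(* [c |-> al u + H c] where [H] exchanges the unit vectors [u] and [e_j]. *)
Definition tilt u (j : A) (al : R) c : E := fun k =>
  match k with
  | inl v => c (inl v) + (al + c (inr j) - dotV u c) * u v
  | inr a => if a == j then dotV u c else c (inr a)
  end.

(** The inverse isometry, [y |-> H (y - al u)]. *)
Definition untilt u (j : A) (al : R) y : E := fun k =>
  match k with
  | inl v => y (inl v) - (dotV u y - y (inr j)) * u v
  | inr a => if a == j then dotV u y - al else y (inr a)
  end.

Definition wnorm (wV : R) (wA : A -> R) y : R :=
  wV * (\sum_v y (inl v) ^+ 2) + \sum_a wA a * y (inr a) ^+ 2.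

Lemma sum_sqr_shift u (x : V -> R) (t : R) : \sum_v u v ^+ 2 = 1 ->
  \sum_v (x v + t * u v) ^+ 2 = \sum_v x v ^+ 2 + 2 * t * (\sum_v u v * x v) + t ^+ 2.
Proof.
move=> u1; rewrite -[t ^+ 2]mulr1 -[X in t ^+ 2 * X]u1 !mulr_sumr -!big_split /=.
by apply: eq_bigr => v _; ring.
Qed.

Lemma tilt_dist u j al c y : \sum_v u v ^+ 2 = 1 ->
  wnorm 1 (fun=> 1) (fun k => tilt u j al c k - y k) =
  wnorm 1 (fun=> 1) (fun k => c k - untilt u j al y k).
Proof.
move=> u1; rewrite /wnorm (bigD1 j) //= [in RHS](bigD1 j) //= eqxx.
rewrite (eq_bigr (fun a => 1 * (c (inr a) - y (inr a)) ^+ 2)); last by move=> a /negbTE ->.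
rewrite [in RHS](eq_bigr (fun a => 1 * (c (inr a) - y (inr a)) ^+ 2)); last by move=> a /negbTE ->.
set p := dotV u c; set s := dotV u y; set q := c (inr j); set r := y (inr j).
have dE : \sum_v u v * (c (inl v) - y (inl v)) = p - s.
  by rewrite /p /s /dotV -sumrB; apply: eq_bigr => v _; ring.
rewrite (eq_bigr (fun v => ((c (inl v) - y (inl v)) + (al + q - p) * u v) ^+ 2)); last first.
  by move=> v _; congr (_ ^+ 2); ring.
rewrite [in RHS](eq_bigr (fun v => ((c (inl v) - y (inl v)) + (s - r) * u v) ^+ 2)); last first.
  by move=> v _; congr (_ ^+ 2); ring.
rewrite !sum_sqr_shift // dE; ring.
Qed.

Lemma untilt_wnorm u j al b b' (w : A -> R) y : \sum_v u v ^+ 2 = 1 -> w j = b' ->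
  wnorm b w (untilt u j al y) =
  wnorm b (fun a => if a == j then b else w a) y - b * dotV u y ^+ 2 + b' * (dotV u y - al) ^+ 2.
Proof.
move=> u1 wj; rewrite /wnorm (bigD1 j) //= [in RHS](bigD1 j) //= eqxx wj.
rewrite (eq_bigr (fun a => w a * y (inr a) ^+ 2)); last by move=> a /negbTE ->.
rewrite [in RHS](eq_bigr (fun a => w a * y (inr a) ^+ 2)); last by move=> a /negbTE ->.
rewrite (eq_bigr (fun v => (y (inl v) + (- (dotV u y - y (inr j))) * u v) ^+ 2)); last first.
  by move=> v _; congr (_ ^+ 2); ring.
by rewrite sum_sqr_shift // -/(dotV u y); ring.
Qed.

(* With [al ^+ 2 = (b' - b) / (2 b' ^+ 2)] the inequality [cosh t <= exp (t ^ 2 / 2)]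
   makes the dependence on [dotV u y] disappear. *)
Lemma tilt_average u j b rho (w : A -> R) y : \sum_v u v ^+ 2 = 1 -> 0 < rho -> rho <= 1 ->
  0 < b -> w j = b / rho ->
  expR (- wnorm b w (untilt u j (Num.sqrt (rho * (1 - rho) / (2 * b))) y)) +
  expR (- wnorm b w (untilt (fun v => - u v) j (Num.sqrt (rho * (1 - rho) / (2 * b))) y)) <=
  2 * expR (- ((1 - rho) / 2)) * expR (- wnorm b (fun a => if a == j then b else w a) y).
Proof.
move=> u1 rho0 rho1 b0 wj; set al := Num.sqrt _.
have al2 : al ^+ 2 = rho * (1 - rho) / (2 * b).
  by rewrite sqr_sqrtr // divr_ge0 ?mulr_ge0 ?subr_ge0 // ltW.
have uN1 : \sum_v (- u v) ^+ 2 = 1 by rewrite -u1; apply: eq_bigr => v _; rewrite sqrrN.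
rewrite (untilt_wnorm _ _ _ u1 wj) (untilt_wnorm _ _ _ uN1 wj).
have -> : dotV (fun v => - u v) y = - dotV u y.
  by rewrite /dotV -sumrN; apply: eq_bigr => v _; rewrite mulNr.
set s := dotV u y; set Q := wnorm _ _ _.
pose t := 2 * (b / rho) * al * s.
have rn : rho != 0 by rewrite gt_eqF.
have bn : b != 0 by rewrite gt_eqF.
have t2 : t ^+ 2 / 2 = (b / rho - b) * s ^+ 2.
  by rewrite /t !exprMn al2; field; rewrite rn bn.
have bal : b / rho * al ^+ 2 = (1 - rho) / 2 by rewrite al2; field; rewrite rn bn.
pose c := - Q - t ^+ 2 / 2 - (1 - rho) / 2.
have -> : - (Q - b * s ^+ 2 + b / rho * (s - al) ^+ 2) = c + t.
  by rewrite /c t2 -bal /t; ring.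
have -> : - (Q - b * (- s) ^+ 2 + b / rho * (- s - al) ^+ 2) = c - t.
  by rewrite /c t2 -bal /t; ring.
have -> : expR (c + t) + expR (c - t) = expR c * (expR t + expR (- t)) by rewrite !expRD mulrDr.
apply: le_trans (ler_wpM2l (expR_ge0 _) (cosh_le t)) _.
have -> : expR c = expR (- ((1 - rho) / 2)) * expR (- Q) * expR (- (t ^+ 2 / 2)).
  by rewrite -!expRD; congr expR; rewrite /c; ring.
rewrite le_eqVlt; apply/orP; left; apply/eqP.
rewrite (expRN (t ^+ 2 / 2)); have := expR_gt0 (t ^+ 2 / 2); move: (expR _) (expR _) (expR _) => p q r r0.
by field; rewrite gt_eqF.
Qed.
End Reflection.

(** * A hemisphere of directions *)

Section Direction.
Variables (R : realType) (m : nat).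
Implicit Types x : 'I_m -> R.

Definition maxnorm x : R := \big[Num.max/0]_a `|x a|.
(** After normalisation, a map from the cube [-1, 1]^m to the upper hemisphere of the unit sphere of
    dimension m; it is odd on the boundary of the cube, where the last coordinate vanishes. *)
Definition raw_direction x (v : option 'I_m) : R := if v is Some a then x a else 1 - maxnorm x.
Definition raw_sqr x : R := \sum_v raw_direction x v ^+ 2.
Definition direction x v : R := raw_direction x v * (Num.sqrt (raw_sqr x))^-1.

Lemma maxnormN x : maxnorm (fun a => - x a) = maxnorm x.
Proof. by apply: eq_bigr => a _; rewrite normrN. Qed.

(** With [t] the sup norm, the sum is at least [t ^ 2 + (1 - t) ^ 2]. *)
Lemma raw_sqr_ge x : 1 / 2 <= raw_sqr x.
Proof.
rewrite /raw_sqr (bigD1 None) //=; set s := \sum_(v | _) _.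
have s0 : 0 <= s by apply: sumr_ge0 => v _; apply: sqr_ge0.
have ts : maxnorm x <= Num.sqrt s.
  apply: bigmax_le => [|a _]; first exact: sqrtr_ge0.
  rewrite -sqrtr_sqr ler_sqrt // /s (bigD1 (Some a)) //= lerDl.
  by apply: sumr_ge0 => v _; apply: sqr_ge0.
have t0 : 0 <= maxnorm x by apply: bigmax_ge_id.
have : maxnorm x ^+ 2 <= s by rewrite -[s]sqr_sqrtr // ler_sqr ?nnegrE ?sqrtr_ge0.
have : 0 <= (maxnorm x - 1 / 2) ^+ 2 by exact: sqr_ge0.
by clear; clearbody s; move: (maxnorm x) => t; rewrite !expr2; lra.
Qed.

Lemma direction_unit x : \sum_v direction x v ^+ 2 = 1.
Proof.
have h := raw_sqr_ge x; have g0 : 0 < raw_sqr x by lra.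
under eq_bigr do rewrite exprMn.
by rewrite -mulr_suml -/(raw_sqr x) exprVn sqr_sqrtr ?(ltW g0) // divff // gt_eqF.
Qed.

Lemma direction_antipodal x v : (forall a, `|x a| <= 1) -> (exists a, `|x a| = 1) ->
  direction (fun a => - x a) v = - direction x v.
Proof.
move=> x1 [a xa]; have t1 : maxnorm x = 1.
  apply/eqP; rewrite eq_le bigmax_le //= -xa; exact: le_bigmax.
have rawN w : raw_direction (fun a => - x a) w = - raw_direction x w.
  by case: w => [b|] //=; rewrite maxnormN t1 subrr oppr0.
rewrite /direction rawN mulNr; congr (- (_ * (Num.sqrt _)^-1)).
by apply: eq_bigr => w _; rewrite rawN sqrrN.
Qed.

Lemma uc_direction (X : Type) dom (near : R -> X -> X -> Prop) (x : X -> 'I_m -> R) :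
  (forall r r' z z', r <= r' -> near r z z' -> near r' z z') ->
  (forall a, uc dom near (x^~ a)) -> forall v, uc dom near (fun z => direction (x z) v).
Proof.
move=> nm xu.
have ru v : uc dom near (fun z => raw_direction (x z) v).
  case: v => [a|] /=; first exact: xu.
  by apply: uc_sub => //; [exact: uc_const | apply: uc_bigmax => // a; apply: uc_norm].
move=> v; apply: uc_mul => //; apply: (@uc_inv_sqrt _ _ _ _ nm _ (1 / 2)) => [|z _|]; first by lra.
  exact: raw_sqr_ge.
by apply: uc_sum => // w; apply: uc_ext (uc_mul nm (ru w) (ru w)) => z _; rewrite expr2.
Qed.
End Direction.

Section GaussianDecay.
Variables (R : realType) (m : nat) (A : finType) (rho : R).
Hypothesis rho0 : 0 < rho.
Hypothesis rho1 : rho <= 1.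
Notation V := (option 'I_m).
Notation E := ((V + A)%type -> R).

Definition signed_direction (x : 'I_m -> R) (b : bool) (v : V) : R := sgr R b * direction x v.

Definition tilt_step (s : A * R) (x : 'I_m -> R) (b : bool) (c : E) : E :=
  tilt (signed_direction x b) s.1 (Num.sqrt (rho * (1 - rho) / (2 * s.2))) c.

Lemma tilt_step_antipodal s u b c : (forall a, `|u a| <= 1) -> (exists a, `|u a| = 1) ->
  tilt_step s (fun a => - u a) b c = tilt_step s u (~~ b) c.
Proof.
move=> u1 eu; rewrite /tilt_step; congr (tilt _ _ _ _); apply/funext => v.
by rewrite /signed_direction direction_antipodal //; case: b; rewrite /sgr /=; ring.
Qed.

Lemma tilt_step_uc (X : Type) dom near s b (u : X -> 'I_m -> R) (c : X -> E) :
  (forall r r' x y, r <= r' -> near r x y -> near r' x y) ->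
  (forall a, uc dom near (u^~ a)) -> (forall x a, dom x -> `|u x a| <= 1) ->
  (forall k, uc dom near (c^~ k)) -> forall k, uc dom near (fun x => tilt_step s (u x) b (c x) k).
Proof.
move=> nm uu _ cu.
have su v : uc dom near (fun z => signed_direction (u z) b v).
  by apply: uc_mul => //; [exact: uc_const | exact: uc_direction].
have du : uc dom near (fun z => dotV (signed_direction (u z) b) (c z)).
  by apply: uc_sum => // v; apply: uc_mul => //; apply: cu.
case=> [v|a]; rewrite /tilt_step /=.
  apply: uc_add => //; apply: uc_mul => //; apply: uc_sub => //; apply: uc_add => //.
  exact: uc_const.
by case: (a == s.1).
Qed.

Lemma signed_direction_unit x b : \sum_v signed_direction x b v ^+ 2 = 1.
Proof.
rewrite -(direction_unit x); apply: eq_bigr => v _.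
by rewrite /signed_direction exprMn; case: b; rewrite /sgr ?sqrrN expr1n mul1r.
Qed.

Notation leaf := (@leaf R m (V + A)%type (A * R)%type tilt_step).
Notation dist2 c y := (wnorm 1 (fun=> 1) (fun k => c k - y k)).
Notation decay := (2 * expR (- ((1 - rho) / 2))).

(** Read from the root: a round visits all of [A] at one weight, and the weight is divided by [rho]
    from each round to the next, so the Gaussian at the leaves has squared scale [rho ^ T / b]. *)
Fixpoint phases (b : R) (T : nat) : seq (A * R) :=
  if T is T'.+1 then [seq (a, b) | a <- enum A] ++ phases (b / rho) T' else [::].

Lemma size_phases b T : size (phases b T) = (#|A| * T)%N.
Proof.
by elim: T b => [|T ih] b /=; rewrite ?muln0 // size_cat size_map -cardE ih mulnS.
Qed.

(** A round lowers all weights from [b / rho] to [b]: on [V] at once, which only increases the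
    Gaussian, and on [A] one coordinate at a time by [tilt_average], each time with the factor
    [decay]. The centre must be arbitrary, because the isometry is moved from the leaf onto it. *)
Lemma phase_bound (D bT b : R) (st : seq (A * R)) (js : seq A) : 0 < b -> 0 <= D -> uniq js ->
  (forall x y, path_sum (size st) (fun l => expR (- (bT * dist2 (@leaf st x l) y))) <=
     D * expR (- wnorm (b / rho) (fun=> b / rho) y)) ->
  forall x y, path_sum (size ([seq (a, b) | a <- js] ++ st))
     (fun l => expR (- (bT * dist2 (@leaf ([seq (a, b) | a <- js] ++ st) x l) y))) <=
     D * decay ^+ (size js) * expR (- wnorm b (fun a => if a \in js then b else b / rho) y).
Proof.
move=> b0 D0 + hst; elim: js => [|j js ih] /=.
  move=> _ x y; rewrite expr0 mulr1; apply: le_trans (hst x y) _.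
  rewrite ler_wpM2l // ler_expR lerN2 /wnorm lerD2r ler_wpM2r ?sumr_ge0 // => [v _|].
    exact: sqr_ge0.
  by rewrite ler_pdivlMr // ler_piMr // ltW.
move=> /andP[jjs ujs] x y.
have {}ih := ih ujs.
set w := fun a => if a \in js then b else b / rho.
have wj : w j = b / rho by rewrite /w (negbTE jjs).
set al := Num.sqrt (rho * (1 - rho) / (2 * b)).
have half (c : bool) (z : tree_index m (size ([seq (a, b) | a <- js] ++ st)) -> R) :
    path_sum (size ([seq (a, b) | a <- js] ++ st))
      (fun l => expR (- (bT * dist2 (tilt (signed_direction (root_part x) c) j al (leaf z l)) y))) <=
    D * decay ^+ size js * expR (- wnorm b w (untilt (signed_direction (root_part x) c) j al y)).
  apply: le_trans (ih z _); rewrite le_eqVlt; apply/orP; left; apply/eqP.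
  apply: path_sum_ext => l _.
  by rewrite tilt_dist // signed_direction_unit.
apply: le_trans (lerD (half false _) (half true _)) _.
rewrite -mulrDr exprSr mulrA -[X in _ <= X]mulrA ler_wpM2l //.
  by rewrite mulr_ge0 // exprn_ge0 // mulr_ge0 // expR_ge0.
have := tilt_average y (signed_direction_unit (root_part x) false) rho0 rho1 b0 wj.
have -> : (fun v => - signed_direction (root_part x) false v) = signed_direction (root_part x) true.
  by apply/funext => v; rewrite /signed_direction /sgr mul1r mulN1r.
have -> // : (fun a => if a \in j :: js then b else b / rho) = (fun a => if a == j then b else w a).
by apply/funext => a; rewrite in_cons /w; case: (a == j).
Qed.

Theorem gaussian_decay (b : R) T x y : 0 < b ->
  path_sum (size (phases b T))
    (fun l => expR (- (b / rho ^+ T * dist2 (@leaf (phases b T) x l) y))) <=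
  decay ^+ (#|A| * T) * expR (- (b * wnorm 1 (fun=> 1) y)).
Proof.
have wb (c : R) (z : E) : wnorm c (fun=> c) z = c * wnorm 1 (fun=> 1) z :> R.
  rewrite /wnorm mul1r mulrDr; congr (_ + _); rewrite mulr_sumr.
  by apply: eq_bigr => a _; rewrite mul1r.
elim: T b x y => [|T ih] b x y b0.
  rewrite muln0 !expr0 mul1r invr1 mulr1 /=.
  suff -> : dist2 (0 : E) y = wnorm 1 (fun=> 1) y by [].
  by rewrite /wnorm; congr (_ * _ + _); apply: eq_bigr => k _; rewrite sub0r sqrrN.
have k0 : 0 <= decay by rewrite mulr_ge0 // expR_ge0.
have b'0 : 0 < b / rho by rewrite divr_gt0.
have st z w : path_sum (size (phases (b / rho) T)) (fun l => expR (- (b / rho ^+ T.+1 * dist2 (@leaf (phases (b / rho) T) z l) w))) <=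
     decay ^+ (#|A| * T) * expR (- wnorm (b / rho) (fun=> b / rho) w).
  have -> : b / rho ^+ T.+1 = b / rho / rho ^+ T by rewrite exprS invfM mulrA.
  by rewrite (wb (b / rho)); exact: (ih (b / rho) z w b'0).
have := phase_bound b0 (exprn_ge0 _ k0) (enum_uniq A) st x y.
have -> : (fun a => if a \in enum A then b else b / rho) = (fun=> b).
  by apply/funext => a; rewrite mem_enum.
by rewrite (wb b) -exprD -cardE addnC -mulnS.
Qed.
End GaussianDecay.

(** * The waist inequality *)

Section Fold.
Variable R : realType.
Implicit Types t s : R.

Definition nearest_half t : int := Num.floor ((t + 1) / 2).
(* distance to the nearest even integer *)
Definition fold t : R := `|t - 2 * (nearest_half t)%:~R|.

Lemma fold_itv t : 0 <= fold t <= 1.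
Proof.
rewrite /fold normr_ge0 /= ler_norml; have := floor_itv ((t + 1) / 2).
by rewrite rmorphD /= => /andP[? ?]; apply/andP; split; lra.
Qed.

Lemma fold_le t (j : int) : fold t <= `|t - 2 * j%:~R|.
Proof.
have /andP[_ f1] := fold_itv t; have [<-//|nj] := eqVneq (nearest_half t) j.
have [a1 a2] : (nearest_half t)%:~R <= (t + 1) / 2 /\ (t + 1) / 2 < (nearest_half t)%:~R + 1.
  by have /andP[] := floor_itv ((t + 1) / 2); rewrite rmorphD.
apply: le_trans f1 _; case: (ltgtP (nearest_half t) j) nj => // h _.
  have : (nearest_half t + 1)%:~R <= j%:~R :> R by rewrite ler_int -ltzD1 ltrD2r.
  by rewrite rmorphD /= => ?; rewrite ler_normr; apply/orP; right; lra.
have : (j + 1)%:~R <= (nearest_half t)%:~R :> R by rewrite ler_int -ltzD1 ltrD2r.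
by rewrite rmorphD /= => ?; rewrite ler_normr; apply/orP; left; lra.
Qed.

Lemma fold_lip t s : `|fold t - fold s| <= `|t - s|.
Proof.
have half a b : fold a - fold b <= `|a - b|.
  rewrite lerBlDr; apply: le_trans (fold_le a (nearest_half b)) _.
  rewrite /fold (_ : a - 2 * _ = (a - b) + (b - 2 * (nearest_half b)%:~R)) ?ler_normD //.
  by rewrite addrA subrK.
by rewrite ler_norml half andbT; have := half s t; rewrite distrC; lra.
Qed.

(** The preimages of [y] under [fold], that is, its images under the group generated by reflections
    in the integers. *)
Definition unfold_at (b : bool) (j : int) (y : R) : R := 2 * j%:~R + sgr R b * y.

Lemma fold_unfold t y : exists b, `|t - unfold_at b (nearest_half t) y| = `|fold t - y|.
Proof.
rewrite /fold /unfold_at; have [h|h] := leP 0 (t - 2 * (nearest_half t)%:~R).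
  by exists false; rewrite (ger0_norm h); congr `|_|; rewrite /sgr; ring.
by exists true; rewrite (ltr0_norm h) -normrN; congr `|_|; rewrite /sgr; ring.
Qed.

Lemma expR_half_pow (k : nat) : expR (- k%:R) <= (1 / 2) ^+ k :> R.
Proof.
rewrite -[- k%:R]mulrN1 expRM_natl; apply: lerXn2r; rewrite ?nnegrE ?expR_ge0 //.
have h : 1 + 1 <= expR 1 :> R by exact: expR_ge1Dx.
by rewrite expRN div1r lef_pV2 ?posrE ?expR_gt0 //; lra.
Qed.

Lemma geometric_le (n : nat) : \sum_(i < n) (1 / 2) ^+ i <= 2 :> R.
Proof.
have -> : \sum_(i < n) (1 / 2) ^+ i = 2 - 2 * (1 / 2) ^+ n :> R.
  by elim: n => [|n ih]; rewrite ?big_ord0 ?expr0 ?mulr1 ?subrr // big_ord_recr /= ih exprSr; lra.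
by rewrite lerBlDr lerDl mulr_ge0 // exprn_ge0 //; lra.
Qed.

(** Zero is represented twice, which only enlarges the sums below. *)
Definition signed_nat (i : nat) (b : bool) : int := if b then - i%:Z else i%:Z.

Lemma nearest_signed t (Z : nat) : `|t| <= Z%:R ->
  exists (i : 'I_Z.+2) b, nearest_half t = signed_nat i b.
Proof.
move=> tZ; have iZ : (absz (nearest_half t) < Z.+2)%N.
  suff : `|nearest_half t| <= Z.+1%:Z by move: (nearest_half t) => z; clear; lia.
  rewrite -(ler_int R) intr_norm.
  have /andP[_ f1] := fold_itv t; rewrite /fold ler_norml in f1; case/andP: f1 => ? ?.
  have -> : (Z.+1%:Z)%:~R = Z%:R + 1 :> R by rewrite natr1.
  move: tZ; rewrite !ler_norml => /andP[? ?].
  have : 0 <= Z%:R :> R by [].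
  by move=> ?; apply/andP; split; lra.
exists (Ordinal iZ), (nearest_half t < 0) => /=; rewrite /signed_nat.
by case: ltrP; move: (nearest_half t) => z; clear; lia.
Qed.

(** For [i >= 1] the lattice point has absolute value at least [2 i - 1], whose square is at least
    [i]. *)
Lemma gauss_lattice_term y i b b' : 0 <= y <= 1 ->
  expR (- unfold_at b (signed_nat i b') y ^+ 2) <= (1 / 2) ^+ i.
Proof.
move=> /andP[y0 y1]; apply: le_trans (expR_half_pow i); rewrite ler_expR lerN2.
case: i => [|i]; first exact: sqr_ge0.
have i0 : 0 <= i%:R :> R by [].
rewrite /unfold_at /signed_nat /sgr.
by case: b'; rewrite ?rmorphN /=; (have -> : (i.+1%:Z)%:~R = i%:R + 1 :> R by rewrite natr1);
  rewrite -?natr1; move: (i%:R) i0 => x x0; case: b; nra.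
Qed.

(** The 8 collects a 2 for the sign of the integer, a 2 for the reflection and a 2 for the geometric
    series. *)
Lemma gauss_lattice_sum (Z : nat) y : 0 <= y <= 1 ->
  \sum_(j : 'I_Z * bool * bool) expR (- unfold_at j.2 (signed_nat j.1.1 j.1.2) y ^+ 2) <= 8.
Proof.
move=> y01; apply: le_trans (_ : \sum_(j : 'I_Z * bool * bool) (1 / 2) ^+ j.1.1 <= _).
  by apply: ler_sum => j _; apply: gauss_lattice_term.
rewrite -(pair_bigA _ (fun (i : 'I_Z * bool) (b : bool) => (1 / 2) ^+ i.1)) /=.
under eq_bigr do rewrite big_bool /=.
rewrite -(pair_bigA _ (fun (i : 'I_Z) (b : bool) => (1 / 2) ^+ i + (1 / 2) ^+ i)) /=.
under eq_bigr do rewrite big_bool /=.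
by rewrite !big_split /=; have := geometric_le Z; lra.
Qed.
End Fold.

Section Waist.
Variables (R : realType) (m : nat) (A : finType).
Notation K := (option 'I_m + A)%type.
Notation in_cube x := (forall k, 0 <= x k <= 1).

Lemma path_sum_sum (I : finType) h (g : I -> seq bool -> R) :
  path_sum h (fun l => \sum_i g i l) = \sum_i path_sum h (g i).
Proof. by elim: h g => [|h ih] g //=; rewrite !ih big_split. Qed.

Lemma wnorm1E (x : K -> R) : wnorm 1 (fun=> 1) x = \sum_k x k ^+ 2.
Proof.
by rewrite /wnorm big_sumType /= mul1r; congr (_ + _); apply: eq_bigr => a _; rewrite mul1r.
Qed.

Lemma lattice_sum (I : finType) (Z : nat) (y : I -> R) : in_cube y ->
  \sum_(f : {ffun I -> 'I_Z * bool * bool})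
    expR (- \sum_k unfold_at (f k).2 (signed_nat (f k).1.1 (f k).1.2) (y k) ^+ 2) <= 8 ^+ #|I|.
Proof.
move=> y01.
pose g k (j : 'I_Z * bool * bool) := expR (- unfold_at j.2 (signed_nat j.1.1 j.1.2) (y k) ^+ 2).
rewrite (eq_bigr (fun f : {ffun I -> 'I_Z * bool * bool} => \prod_k g k (f k))); last first.
  by move=> f _; rewrite -sumrN expR_sum.
rewrite -(bigA_distr_bigA g) -prodr_const; apply: ler_prod => k _.
by rewrite sumr_ge0 ?gauss_lattice_sum // => j _; apply: expR_ge0.
Qed.

Variables (rho : R) (H : (K -> R) -> 'I_m -> R) (q T : nat) (eps eta C : R).
Hypothesis rho0 : 0 < rho.
Hypothesis rho1 : rho <= 1.
Hypothesis eta0 : 0 < eta.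
Hypothesis eps0 : 0 <= eps.
Hypothesis epsT : eps ^+ 2 <= rho ^+ T.
Hypothesis H_unif : forall e, 0 < e -> exists2 r, 0 < r & forall x y, in_cube x -> in_cube y ->
  (forall k, `|x k - y k| <= r) -> forall a, `|H x a - H y a| <= e.
Hypothesis H_bounded : forall x a, in_cube x -> `|H x a| <= C.
Hypothesis H_cover : forall x0, in_cube x0 -> exists U : 'I_q -> (K -> R) -> Prop,
  (forall x, in_cube x -> (forall a, `|H x a - H x0 a| <= eta) -> exists i, U i x) /\
  (forall i x y, in_cube x -> in_cube y -> U i x -> U i y -> forall k, `|x k - y k| <= eps).

Let foldc (x : K -> R) : K -> R := fun k => fold (x k).
Let foldc01 x : in_cube (foldc x).
Proof. by move=> k; exact: fold_itv. Qed.

(** Gaussians are summed over leaves, members of the cover and reflected centres. Each leaf is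
    within [eps], in every coordinate, of some reflected centre and contributes at least exp (-
    #|K|). For each centre the sum over leaves is bounded by [gaussian_decay], and summing over the
    reflections gives 8 ^ #|K|. *)
Theorem waist_bound : expR ((1 - rho) / 2 * (#|A| * T)%:R) <= q%:R * (8 * expR 1) ^+ #|{: K}|.
Proof.
pose st : seq (A * R) := phases A rho 1 T; pose h := size st.
pose lf z l := @leaf R m _ _ (@tilt_step R m A rho) st z l.
have hE : h = (#|A| * T)%N by exact: size_phases.
have Fu e : 0 < e -> exists2 r, 0 < r & forall x y : K -> R,
    (forall k, `|x k - y k| <= r) -> forall a, `|H (foldc x) a - H (foldc y) a| <= e.
  move=> /H_unif[r r0 rP]; exists r => // x y xy; apply: rP => // k.
  exact: le_trans (fold_lip _ _) (xy k).
have Fb : exists C, forall x a, `|H (foldc x) a| <= C by exists C => x a; apply: H_bounded.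
have [z z1 zP] := tree_coincidence (@tilt_step_antipodal R m A rho) (@tilt_step_uc R m A rho) st Fu Fb eta0.
pose l0 := nseq h false.
have [U [Ucov Usmall]] := H_cover (foldc01 (lf z l0)).
have Uex l : size l = h -> exists i, U i (foldc (lf z l)).
  by move=> lh; apply: Ucov => // a; apply: zP; rewrite ?size_nseq.
(* The centre of a member of the cover is the folded image of a leaf lying in it; members met by no
   leaf get the origin. *)
have yex i : exists y : K -> R, in_cube y /\ forall l, size l = h -> U i (foldc (lf z l)) ->
    forall k, `|fold (lf z l k) - y k| <= eps.
  have [[l1 [l1h Ul1]]|no] := pselect (exists l, size l = h /\ U i (foldc (lf z l))).
    by exists (foldc (lf z l1)); split=> // l lh Ul; apply: Usmall Ul Ul1.
  by exists (fun=> 0); split=> [k|l lh Ul]; [rewrite lexx ler01 | case: no; exists l].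
have {yex} [y yP] := choice yex.
(* The leaves are finitely many, so reflections up to a fixed range [Z] reach them all. *)
have [Z [_ ZP]] := large_nat (\big[Num.max/0]_(l : h.-tuple bool) \big[Num.max/0]_k `|lf z l k|).
have Zb l k : size l = h -> `|lf z l k| <= Z%:R.
  move=> lh; apply: le_trans ZP; have th : size l == h by apply/eqP.
  apply: le_trans (le_bigmax _ _ (Tuple th)); exact: (le_bigmax _ (fun k => `|lf z l k|)).
pose yf i (f : {ffun K -> 'I_Z.+2 * bool * bool}) : K -> R :=
  fun k => unfold_at (f k).2 (signed_nat (f k).1.1 (f k).1.2) (y i k).
pose D c w : R := wnorm 1 (fun=> 1) (fun k : K => c k - w k).
pose bT : R := 1 / rho ^+ T.
have rT : 0 < rho ^+ T by rewrite exprn_gt0.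
have bT0 : 0 <= bT by rewrite divr_ge0 // ltW.
have hit l : size l = h -> expR (- #|{: K}|%:R) <=
    \sum_i \sum_f expR (- (bT * D (lf z l) (yf i f))).
  move=> lh; have [i Ui] := Uex l lh.
  have fex k : exists j : 'I_Z.+2 * bool * bool,
      `|lf z l k - unfold_at j.2 (signed_nat j.1.1 j.1.2) (y i k)| <= eps.
    have [n [b nb]] := nearest_signed (Zb l k lh).
    have [b' bE] := fold_unfold (lf z l k) (y i k).
    by exists (n, b, b'); rewrite /= -nb bE; apply: (proj2 (yP i)).
  have [f0 f0P] := choice fex; pose f := [ffun k => f0 k].
  apply: le_trans (_ : expR (- (bT * D (lf z l) (yf i f))) <= _).
    rewrite ler_expR lerN2 /D wnorm1E mulr_sumr -sum1_card natr_sum; apply: ler_sum => k _.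
    rewrite /bT mulrAC mul1r ler_pdivrMr // mul1r; apply: le_trans epsT.
    rewrite -real_normK ?num_real // ler_sqr ?nnegrE //.
    by have := f0P k; rewrite /yf /f !ffunE.
  rewrite (bigD1 i) //= (bigD1 f) //= -addrA lerDl.
  apply: addr_ge0; apply: sumr_ge0 => *; first exact: expR_ge0.
  by apply: sumr_ge0 => *; exact: expR_ge0.
have total : 2 ^+ h * expR (- #|{: K}|%:R) <= q%:R * (2 ^+ h * expR (- ((1 - rho) / 2)) ^+ h * 8 ^+ #|{: K}|).
  rewrite -path_sum_const; apply: le_trans (path_sum_le hit) _.
  rewrite path_sum_sum.
  have -> : q%:R * (2 ^+ h * expR (- ((1 - rho) / 2)) ^+ h * 8 ^+ #|{: K}|) =
      \sum_(i < q) (2 ^+ h * expR (- ((1 - rho) / 2)) ^+ h * 8 ^+ #|{: K}|) :> R.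
    by rewrite sumr_const card_ord mulr_natl.
  apply: ler_sum => i _; rewrite path_sum_sum.
  have gd f := gaussian_decay rho0 rho1 z (yf i f) ltr01.
  apply: le_trans (ler_sum _ (fun f _ => gd f)) _.
  rewrite -mulr_sumr -exprMn -hE ler_wpM2l ?exprn_ge0 ?mulr_ge0 ?expR_ge0 //.
  under eq_bigr do rewrite wnorm1E mul1r.
  by apply: lattice_sum; case: (yP i).
have e1 : expR 1 ^+ #|{: K}| = expR #|{: K}|%:R :> R by rewrite -expRM_natl mulr1.
have e2 : expR (- ((1 - rho) / 2)) ^+ h = (expR ((1 - rho) / 2 * h%:R))^-1.
  by rewrite -expRM_natl -expRN mulrN mulrC.
have p0 : 0 < 2 ^+ h :> R by rewrite exprn_gt0.
move: total; rewrite -hE exprMn e1 e2 expRN.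
have := expR_gt0 (#|{: K}|%:R : R); have := expR_gt0 ((1 - rho) / 2 * h%:R).
move: (expR _) (expR _) (2 ^+ h) (8 ^+ _) p0 => E B P c p0 B0 E0 total.
have := ler_wpM2r (ltW (mulr_gt0 B0 E0)) total; rewrite -(ler_pM2l p0 B).
have -> : P / E * (B * E) = P * B by field; rewrite gt_eqF.
have -> // : q%:R * (P / B * c) * (B * E) = P * (q%:R * (c * E)).
by field; rewrite gt_eqF.
Qed.
End Waist.

(** * Compact metric spaces *)

Lemma dist_gt_open (R : realType) (X Y : Type) (d : X -> X -> R) (D : Y -> Y -> R) (g : X -> Y) x y e :
  (forall a b, D a b = D b a) -> (forall a b c, D a c <= D a b + D b c) -> mcont d D g ->
  e < D (g x) (g y) ->
  exists2 r, 0 < r & forall x' y', d x x' < r -> d y y' < r -> e < D (g x') (g y').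
Proof.
move=> Dsym Dtri gc h; have e0 : 0 < (D (g x) (g y) - e) / 2 by rewrite divr_gt0 // subr_gt0.
have [r r0 rP] := gc x _ e0; have [r' r'0 rP'] := gc y _ e0.
exists (Num.min r r') => [|x' y']; first by rewrite lt_min r0.
rewrite !lt_min => /andP[/rP h1 _] /andP[_ /rP' h2].
have := Dtri (g x) (g x') (g y); have := Dtri (g x') (g y') (g y); rewrite (Dsym (g y') (g y)); lra.
Qed.

Lemma gap_open (R : realType) (X : Type) (d : X -> X -> R) (g : X -> R) x y e : mcontR d g ->
  e < `|g x - g y| -> exists2 r, 0 < r & forall x' y', d x x' < r -> d y y' < r -> e < `|g x' - g y'|.
Proof. by apply: (@dist_gt_open _ _ R) => *; [exact: distrC | exact: ler_distD]. Qed.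

Section Compactness.
Variables (R : realType) (X : Type) (d : X -> X -> R).
Hypothesis dm : is_metric d.
Hypothesis dc : mcompact d.

Lemma dist_ge0 x y : 0 <= d x y. Proof. by case: dm. Qed.
Lemma dist_xx x : d x x = 0. Proof. by case: dm => _ h _ _; apply/h. Qed.
Lemma dist_sym x y : d x y = d y x. Proof. by case: dm. Qed.
Lemma dist_tri x y z : d x z <= d x y + d y z. Proof. by case: dm. Qed.

Lemma mopen_ball x r : mopen d (fun y => d x y < r).
Proof.
move=> y xy; exists (r - d x y); first by lra.
by move=> z yz; have := dist_tri x y z; lra.
Qed.

Lemma compact_uniform (P : X -> R -> nat -> Prop) :
  (forall x r r' j j', r' <= r -> (j <= j')%N -> P x r j -> P x r' j') ->
  (forall x, exists r j, 0 < r /\ forall x', d x x' < r -> P x' r j) ->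
  exists r j, 0 < r /\ forall x, P x r j.
Proof.
move=> mono loc.
have loc' x : exists p : R * nat, 0 < p.1 /\ forall x', d x x' < p.1 -> P x' p.1 p.2.
  by have [r [j h]] := loc x; exists (r, j).
have [rj rjP] := choice loc'.
have [|n [f cov]] := dc (fun x => @mopen_ball x (rj x).1).
  by move=> x; exists x; rewrite dist_xx; case: (rjP x).
exists (\big[Num.min/1]_(i < n) (rj (f i)).1), (\max_(i < n) (rj (f i)).2).
split; first by apply: lt_bigmin => // i _; case: (rjP (f i)).
move=> x; have [i xi] := cov x; apply: mono ((rjP (f i)).2 x xi).
  exact: (bigmin_le _ i (fun i => (rj (f i)).1)).
exact: (leq_bigmax i).
Qed.

(** Compactness in [x] puts some [E j], for second arguments near [y], inside [W y]; compactness in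
    [y] makes [j] uniform. The centre [y] may differ from [y'], which is why [W y] is asked to be
    open only for fixed [y]. *)
Lemma tube (E : nat -> X -> X -> Prop) (W : X -> X -> Prop) :
  (forall j j' x y, (j <= j')%N -> E j' x y -> E j x y) ->
  (forall j x y, ~ E j x y -> exists2 r, 0 < r & forall x' y', d x x' < r -> d y y' < r -> ~ E j x' y') ->
  (forall y, mopen d (W y)) ->
  (forall x y, (forall j, E j x y) -> W y x) ->
  exists j, forall y', exists y, forall x, E j x y' -> W y x.
Proof.
move=> Edec Eclosed Wopen EW.
have loc y : exists r j, 0 < r /\ forall y', d y y' < r -> forall x, E j x y' -> W y x.
  have [|x|r [j [r0 rP]]] := @compact_uniform (fun x r j => forall y', d y y' < r -> E j x y' -> W y x).
  - move=> x r r' j j' rr jj h y' yy' e; apply: (h y'); first exact: lt_le_trans rr.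
    exact: Edec e.
  - have [wx|nwx] := pselect (W y x).
      have [r r0 rP] := Wopen y x wx; exists r, 0%N; split=> // x' /rP wx' y' _ _; exact: wx'.
    have [j nE] : exists j, ~ E j x y by apply/existsNP => h; apply: nwx; exact: EW.
    have [r r0 rP] := Eclosed j x y nE; exists r, j; split=> // x' xx' y' yy' /(rP x' y' xx' yy').
    by [].
  - by exists r, j; split=> // y' yy' x; apply: rP.
have [|y|r [j [_ jP]]] := @compact_uniform (fun y' r j => exists y, forall x, E j x y' -> W y x).
- by move=> x r r' j j' _ jj [y h]; exists y => z e; apply: h; exact: Edec e.
- by have [r [j [r0 h]]] := loc y; exists r, j; split=> // y' yy'; exists y; apply: h.
- by exists j.
Qed.

Lemma cont_bounded (g : X -> R) : mcontR d g -> exists C, forall x, `|g x| <= C.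
Proof.
move=> gc; have [|x|r [j [_ jP]]] := @compact_uniform (fun x r j => `|g x| <= j%:R).
- by move=> x r r' j j' _ jj h; apply: le_trans h _; rewrite ler_nat.
- have [r r0 rP] := gc x 1 ltr01; have [j [_ jP]] := large_nat (`|g x| + 1).
  exists r, j; split=> // x' /rP /ltW h; apply: le_trans jP.
  by rewrite -lerBlDl (le_trans _ h) // distrC lerB_dist.
- by exists j%:R.
Qed.

(** [tube] is applied to closeness of [g]-values and to a neighbourhood of the fibre of [y], whose
    width is a third of the slack [eps - rad y]; the triangle inequality spends it twice. *)
Lemma separation m (g : X -> 'I_m -> R) (D : X -> X -> R) (eps : R) :
  (forall a, mcontR d (g^~ a)) ->
  (forall x e, 0 < e -> exists2 r, 0 < r & forall y, d x y < r -> D x y < e) ->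
  (forall x y, D x y = D y x) -> (forall x y z, D x z <= D x y + D y z) ->
  (forall p, diam_lt D (fun x => g x = p) eps) ->
  exists2 delta, 0 < delta & forall x y, (forall a, `|g x a - g y a| <= delta) -> D x y < eps.
Proof.
move=> gc Dc Dsym Dtri fib.
pose E j x y := forall a, `|g x a - g y a| <= j.+1%:R^-1.
have fib' y : exists r, r < eps /\ forall x z, g x = g y -> g z = g y -> D x z <= r.
  by have [r r0 rP] := fib (g y); exists r.
have [rad radP] := choice fib'.
have D0 x : D x x <= 0.
  apply/ler_addgt0Pr => e e0; rewrite add0r; have [r r0 rP] := Dc x e e0.
  by apply/ltW/rP; rewrite dist_xx.
pose W y x := exists w, g w = g y /\ D w x < (eps - rad y) / 3.
have [|j x y|y x [w [gw wx]]|x y Exy|j jP] := @tube E W.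
- move=> j j' x y jj h a; apply: le_trans (h a) _.
  by rewrite lef_pV2 ?posrE ?ltr0Sn // ler_nat.
- move=> /existsNP[a /negP]; rewrite -ltNge => h.
  have [r r0 rP] := gap_open (gc a) h; exists r => // x' y' xx yy /(_ a); apply/negP.
  by rewrite -ltNge; apply: rP.
- have e0 : 0 < (eps - rad y) / 3 - D w x by lra.
  have [r r0 rP] := Dc x _ e0; exists r => // z /rP h; exists w; split=> //.
  by have := Dtri w x z; lra.
- exists x; split; last by have [rr _] := radP y; have := D0 x; lra.
  apply/funext => a; apply/eqP; rewrite -subr_eq0 -normr_le0.
  by apply: (@le0_of_inverse _ 0) => j _; apply: Exy.
exists j.+1%:R^-1; first by rewrite invr_gt0 ltr0Sn.
move=> x y' xy; have [y yP] := jP y'.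
have [w [gw wx]] := yP x xy.
have [|w' [gw' wy]] := yP y' => [a|]; first by rewrite subrr normr0 invr_ge0 ler0n.
have [rr h] := radP y; have := h w w' gw gw'.
by have := Dtri x w y'; have := Dtri w w' y'; rewrite (Dsym x w); lra.
Qed.
End Compactness.

(** * Uniformity on cubes, and the waist inequality for cubes mapped into X *)

Section Heine.
Variables (R : realType) (K : finType).
Notation in_cube x := (forall k, 0 <= x k <= 1).

Lemma cube_uniform (P : R -> (K -> R) -> Prop) :
  (forall r r' x, r' <= r -> P r x -> P r' x) ->
  (forall x, in_cube x -> exists2 r, 0 < r & forall x', in_cube x' -> (forall k, `|x k - x' k| < r) -> P r x') ->
  exists2 r, 0 < r & forall x, in_cube x -> P r x.
Proof.
move=> mono loc.
pose of_row (v : 'rV[R]_#|K|) : K -> R := fun k => v ord0 (enum_rank k).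
pose to_row (x : K -> R) : 'rV[R]_#|K| := \row_i x (enum_val i).
have of_to x : of_row (to_row x) = x by apply/funext => k; rewrite /of_row mxE enum_rankK.
have := @rV_compact R #|K| (fun=> `[0, 1]%classic) (fun=> @segment_compact R 0 1).
move=> /compact_near_coveringP => cpt.
have [v v01|e /= e0 eP] := cpt R (0^'+)%classic (fun r v => (forall k, 0 <= of_row v k <= 1) -> P r (of_row v)) _.
- have vk k : 0 <= of_row v k <= 1 by have := v01 (enum_rank k); rewrite /= in_itv.
  have [r r0 rP] := loc _ vk.
  exists (ball v r, [set r' : R | r' <= r]%classic).
    split; first exact: nbhsx_ballx.
    by apply: nbhs_right_le.
  move=> [w r'] /= [vw rr] w01; apply: mono rr _; apply: rP => // k; by case: vw => _ vw; exact: vw.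
exists (e / 2); first by rewrite divr_gt0.
move=> x x01; rewrite -[x]of_to; apply: (eP (e / 2)) => /=.
- rewrite sub0r normrN gtr0_norm ?divr_gt0 //; lra.
- by rewrite divr_gt0.
- by move=> i; rewrite /= in_itv mxE; apply: x01.
- by rewrite of_to.
Qed.

Lemma heine (I : finType) (g : (K -> R) -> I -> R) :
  (forall x a, in_cube x -> forall e, 0 < e -> exists2 r, 0 < r &
     forall y, in_cube y -> (forall k, `|x k - y k| < r) -> `|g x a - g y a| < e) ->
  forall e, 0 < e -> exists2 r, 0 < r &
    forall x y, in_cube x -> in_cube y -> (forall k, `|x k - y k| <= r) -> forall a, `|g x a - g y a| <= e.
Proof.
move=> gc e e0.
have [r r0 rP] : exists2 r, 0 < r & forall a x, in_cube x -> forall y, in_cube y ->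
    (forall k, `|x k - y k| <= r) -> `|g x a - g y a| <= e.
  apply: uniform_radius => [a q q' qq h x x01 y y01 xy|a].
    by apply: h => // k; apply: le_trans qq.
  apply: cube_uniform => [r r' x rr h y y01 xy|x x01].
    by apply: h => // k; apply: le_trans rr.
  have e2 : 0 < e / 2 by rewrite divr_gt0.
  have [r r0 rP] := gc x a x01 _ e2; exists (r / 2); first by rewrite divr_gt0.
  move=> x' x'01 xx y y01 xy.
  have h1 : `|g x a - g x' a| < e / 2.
    by apply: rP => // k; apply: lt_le_trans (xx k) _; rewrite ler_pdivrMr // ler_peMr ?ler1n // ltW.
  have h2 : `|g x a - g y a| < e / 2.
    apply: rP => // k; rewrite [r]splitr.
    by apply: le_lt_trans (ler_distD (x' k) _ _) _; rewrite ltr_leD.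
  apply: le_trans (ler_distD (g x a) _ _) _; rewrite distrC [e]splitr; apply: lerD; exact: ltW.
by exists r => // x y x01 y01 xy a; apply: (rP a).
Qed.
End Heine.

Section WaistOfMap.
Variables (R : realType) (X : Type) (d : X -> X -> R) (J : finType) (m n : nat).
Hypothesis dm : is_metric d.
Hypothesis dc : mcompact d.
Hypothesis cardJ : #|J| = (m.+1 + n)%N.
Notation in_cube x := (forall k, 0 <= x k <= 1).
Variables (D : X -> X -> R) (psi : (J -> R) -> X) (G : X -> 'I_m -> R).
Hypothesis psi_cont : forall x, in_cube x -> forall e, 0 < e -> exists2 r, 0 < r &
  forall y, in_cube y -> (forall k, `|x k - y k| < r) -> d (psi x) (psi y) < e.
Hypothesis psi_expand : forall x y, in_cube x -> in_cube y -> forall k, `|x k - y k| <= D (psi x) (psi y).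
Hypothesis G_cont : forall a, mcontR d (G^~ a).
Variables (rho eps eta : R) (q T : nat).
Hypothesis rho0 : 0 < rho.
Hypothesis rho1 : rho <= 1.
Hypothesis eta0 : 0 < eta.
Hypothesis eps0 : 0 <= eps.
Hypothesis epsT : eps ^+ 2 <= rho ^+ T.
Hypothesis cover : forall x0, exists U : 'I_q -> X -> Prop,
  (forall x, (forall a, `|G x a - G x0 a| <= eta) -> exists i, U i x) /\
  (forall i x y, U i x -> U i y -> D x y <= eps).

(** Coordinates are split into m + 1 for the directions and n to be visited. A cover near a fibre of
    [G] pulls back through [psi], and expansion bounds its members in the sup norm. *)
Theorem waist_of_map : expR ((1 - rho) / 2 * (n * T)%:R) <= q%:R * (8 * expR 1) ^+ #|J|.
Proof.
have cardK : #|{: option 'I_m + 'I_n}| = #|J| by rewrite card_sum card_option !card_ord.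
pose enc (j : J) : option 'I_m + 'I_n := enum_val (cast_ord (esym cardK) (enum_rank j)).
pose dec (k : option 'I_m + 'I_n) : J := enum_val (cast_ord cardK (enum_rank k)).
have decK k : enc (dec k) = k by rewrite /enc /dec enum_valK cast_ordK enum_rankK.
pose tr (x : option 'I_m + 'I_n -> R) : J -> R := fun j => x (enc j).
pose H x a := G (psi (tr x)) a.
have [C CP] : exists C, forall x a, `|G x a| <= C.
  have [C CP] := choice (fun a => cont_bounded dm dc (G_cont a)).
  by exists (\big[Num.max/0]_a C a) => x a; apply: le_trans (CP a x) _; exact: le_bigmax.
have H_unif : forall e, 0 < e -> exists2 r, 0 < r & forall x y, in_cube x -> in_cube y ->
    (forall k, `|x k - y k| <= r) -> forall a, `|H x a - H y a| <= e.
  apply: heine => x a x01 e e0; have [r r0 rP] := G_cont a (psi (tr x)) e0.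
  have [q' q0 qP] := psi_cont (fun j => x01 (enc j)) r0.
  exists q' => // y y01 xy; apply: rP; apply: qP => j; [exact: y01 | exact: xy].
rewrite -[n in X in X <= _]card_ord -cardK.
apply: (waist_bound (H := H) rho0 rho1 eta0 eps0 epsT H_unif (C := C)).
  by move=> x a _; apply: CP.
move=> x0 x01; have [U [Ucov Usmall]] := cover (psi (tr x0)).
exists (fun i x => U i (psi (tr x))); split=> [x _ xx|i x y x01' y01 Ux Uy k]; first exact: Ucov.
apply: le_trans (Usmall _ _ _ Ux Uy).
by have := psi_expand (fun j => x01' (enc j)) (fun j => y01 (enc j)) (dec k); rewrite /tr decK.
Qed.
End WaistOfMap.

Lemma supdist_lt (R : realType) (k : nat) (x y : 'I_k -> R) (r : R) : 0 < r -> (forall i, `|x i - y i| < r) -> supdist x y < r.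
Proof. by move=> r0 h; apply: bigmax_lt. Qed.

Lemma le_supdist (R : realType) (k : nat) (x y : 'I_k -> R) i : `|x i - y i| <= supdist x y.
Proof. exact: (le_bigmax _ (fun i => `|x i - y i|)). Qed.

(** * Covering numbers of fibres *)

Section DynamicalMetric.
Variables (R : realType) (X : Type) (d : X -> X -> R) (T : X -> X).
Hypothesis dyn : dynsys d T.

Let dm : is_metric d. Proof. by case: dyn. Qed.
Let dc : mcompact d. Proof. by case: dyn. Qed.

Lemma dN_le N x y r : 0 <= r -> (forall i, (i < N)%N -> d (iter i T x) (iter i T y) <= r) ->
  dN d T N x y <= r.
Proof. by move=> r0 h; apply: bigmax_le => // i _; apply: h. Qed.

Lemma le_dN N x y i : (i < N)%N -> d (iter i T x) (iter i T y) <= dN d T N x y.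
Proof. by move=> iN; apply: (le_bigmax _ (fun i : 'I_N => d (iter i T x) (iter i T y)) (Ordinal iN)). Qed.

Lemma dN_ge0 N x y : 0 <= dN d T N x y. Proof. exact: bigmax_ge_id. Qed.

Lemma dN_sym N x y : dN d T N x y = dN d T N y x.
Proof. by apply: eq_bigr => i _; rewrite (dist_sym dm). Qed.

Lemma dN_xx N x : dN d T N x x = 0.
Proof. by apply/eqP; rewrite eq_le dN_ge0 dN_le // => i _; rewrite (dist_xx dm). Qed.

Lemma dN_tri N x y z : dN d T N x z <= dN d T N x y + dN d T N y z.
Proof.
apply: dN_le => [|i iN]; first by rewrite addr_ge0 ?dN_ge0.
by apply: le_trans (dist_tri dm _ (iter i T y) _) _; apply: lerD; apply: le_dN.
Qed.

Lemma dN_mono N N' x y : (N <= N')%N -> dN d T N x y <= dN d T N' x y.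
Proof. by move=> NN; apply: dN_le => [|i iN]; [exact: dN_ge0 | apply: le_dN; apply: leq_trans NN]. Qed.

Lemma dN_shift a b x y : dN d T b (iter a T x) (iter a T y) <= dN d T (a + b) x y.
Proof.
apply: dN_le => [|i ib]; first exact: dN_ge0.
by rewrite -!iterD; apply: le_dN; rewrite addnC ltn_add2l.
Qed.

Lemma dN_split a b x y r : dN d T a x y <= r -> dN d T b (iter a T x) (iter a T y) <= r ->
  dN d T (a + b) x y <= r.
Proof.
move=> ha hb; apply: dN_le => [|i iab]; first exact: le_trans (dN_ge0 _ _ _) ha.
case: (ltnP i a) => ia; first exact: le_trans (le_dN _ _ ia) ha.
rewrite -(subnK ia) !iterD; apply: le_trans (le_dN _ _ _) hb.
by rewrite ltn_subLR.
Qed.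

Lemma iter_cont i x e : 0 < e -> exists2 r, 0 < r & forall y, d x y < r -> d (iter i T x) (iter i T y) < e.
Proof.
have Tc : mcont d d T by case: dyn => _ _ [Ti []].
elim: i e => [|i ih] e e0 /=; first by exists e.
have [r r0 rP] := Tc (iter i T x) e e0; have [r' r'0 rP'] := ih r r0.
by exists r' => // y /rP'; apply: rP.
Qed.

Lemma dN_cont N x e : 0 < e -> exists2 r, 0 < r & forall y, d x y < r -> dN d T N x y < e.
Proof.
move=> e0; have [r r0 rP] : exists2 r, 0 < r & forall i : 'I_N, forall y, d x y < r -> d (iter i T x) (iter i T y) < e.
  apply: uniform_radius => [i q q' qq h y xy|i]; last exact: iter_cont.
  by apply: h; apply: lt_le_trans qq.
by exists r => // y xy; apply: bigmax_lt => // i _; apply: rP.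
Qed.

Lemma mopen_dN N U : mopen (dN d T N) U -> mopen d U.
Proof.
by move=> Uo x Ux; have [r r0 rP] := Uo x Ux; have [r' r'0 rP'] := dN_cont N x r0; exists r' => // y /rP'; apply: rP.
Qed.

Lemma mopen_dN_ball N x r : mopen (dN d T N) (fun y => dN d T N x y < r).
Proof.
move=> y xy; exists (r - dN d T N x y); first by lra.
by move=> z yz; have := dN_tri N x y z; lra.
Qed.

Definition covers (N n : nat) (eps : R) (E : X -> Prop) :=
  exists U : 'I_n -> set X,
    (forall j, mopen (dN d T N) (U j) /\ diam_lt (dN d T N) (U j) eps) /\
    (forall x, E x -> exists j, U j x).

Lemma covers_mono N n n' eps E : (n <= n')%N -> covers N n eps E -> covers N n' eps E.
Proof.
move=> nn [U [Uo Uc]].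
exists (fun i x => exists2 j : 'I_n, j = i :> nat & U j x); split=> [i|x /Uc[j Uj]]; last first.
  by exists (widen_ord nn j), j.
split=> [x [j ji /((Uo j).1)[r r0 rP]]|].
  by exists r => // y /rP Uy; exists j.
case: (ltnP i n) => [ni|ni].
  have [r r0 rP] := (Uo (Ordinal ni)).2; exists r => // x y [j ji Ux] [j' ji' Uy].
  have e : j = Ordinal ni by apply: val_inj.
  have e' : j' = Ordinal ni by apply: val_inj.
  by apply: rP; [rewrite -e | rewrite -e'].
exists (eps - 1) => [|x y [j ji _] _]; first by lra.
by move: (ltn_ord j); rewrite ji ltnNge ni.
Qed.

Lemma covers_all N eps : 0 < eps -> exists n, covers N n eps (fun=> True).
Proof.
move=> eps0; have e3 : 0 < eps / 3 by rewrite divr_gt0.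
have [|n [f fP]] := dc (fun x => mopen_dN (@mopen_dN_ball N x (eps / 3))).
  by move=> x; exists x; rewrite dN_xx.
exists n, (fun j y => dN d T N (f j) y < eps / 3); split=> [j|x _]; last exact: fP.
split; first exact: mopen_dN_ball.
exists (2 * (eps / 3)) => [|x y jx jy]; first by lra.
by have := dN_tri N x (f j) y; rewrite (dN_sym N x (f j)); lra.
Qed.
End DynamicalMetric.

Section FibreNumber.
Variables (R : realType) (X : Type) (d : X -> X -> R) (T : X -> X) (Y : Type) (pi : X -> Y).
Hypothesis dyn : dynsys d T.
Hypothesis piT : forall x x', pi x = pi x' -> pi (T x) = pi (T x').

Lemma fibre_covers N eps : 0 < eps ->
  exists n, `[< forall x0, covers d T N n eps (fun x => pi x = pi x0) >].
Proof.
move=> eps0; have [n [U [Uo Uc]]] := covers_all dyn N eps0; exists n; apply/asboolP => x0.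
by exists U; split=> // x _; apply: Uc.
Qed.

(** Indexed by points of [X], so that only nonempty fibres count; 0 is a default value for
    [eps <= 0]. *)
Definition fibre_number N eps : nat :=
  if pselect (0 < eps) is left e0 then ex_minn (fibre_covers N e0) else 0%N.

Lemma fibre_numberP N eps : 0 < eps -> forall x0, covers d T N (fibre_number N eps) eps (fun x => pi x = pi x0).
Proof.
move=> eps0; rewrite /fibre_number; case: pselect => // e0.
by case: ex_minnP => n /asboolP.
Qed.

Lemma fibre_number_min N eps n : 0 < eps ->
  (forall x0, covers d T N n eps (fun x => pi x = pi x0)) -> (fibre_number N eps <= n)%N.
Proof.
move=> eps0 h; rewrite /fibre_number; case: pselect => // e0.
by case: ex_minnP => k _; apply; apply/asboolP.
Qed.

Lemma fibre_number_gt0 N eps (x : X) : 0 < eps -> (0 < fibre_number N eps)%N.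
Proof.
move=> eps0; have [U [_ /(_ x erefl)[[j jn _]]]] := fibre_numberP N eps0 x.
exact: leq_ltn_trans jn.
Qed.

Lemma pi_iter i x x' : pi x = pi x' -> pi (iter i T x) = pi (iter i T x').
Proof. by move=> e; elim: i => //= i; apply: piT. Qed.

(** The iterate of order [a] sends a fibre into a fibre, so members of the first cover are
    intersected with preimages of members of a cover of the image fibre. *)
Lemma fibre_number_submul a b eps : 0 < eps ->
  (fibre_number (a + b) eps <= fibre_number a eps * fibre_number b eps)%N.
Proof.
move=> eps0; apply: fibre_number_min => // x0.
have [U [Uo Uc]] := fibre_numberP a eps0 x0.
have [V [Vo Vc]] := fibre_numberP b eps0 (iter a T x0).
rewrite -[X in covers _ _ _ X](_ : #|{: 'I_(fibre_number a eps) * 'I_(fibre_number b eps)}| = _); last first.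
  by rewrite card_prod !card_ord.
exists (fun k x => U (enum_val k).1 x /\ V (enum_val k).2 (iter a T x)); split=> [k|x ex]; last first.
  have [i Ui] := Uc x ex; have [j Vj] := Vc _ (pi_iter a ex).
  by exists (enum_rank (i, j)); rewrite enum_rankK.
case: (enum_val k) => i j /=; split=> [x [Ux Vx]|].
  have [r r0 rP] := (Uo i).1 x Ux; have [r' r'0 rP'] := (Vo j).1 _ Vx.
  exists (Num.min r r') => [|y]; first by rewrite lt_min r0.
  rewrite lt_min => /andP[xy xy']; split.
    by apply: rP; apply: le_lt_trans xy; apply: dN_mono; rewrite leq_addr.
  by apply: rP'; apply: le_lt_trans xy'; apply: dN_shift.
have [r r0 rP] := (Uo i).2; have [r' r'0 rP'] := (Vo j).2.
exists (Num.max r r') => [|x y [Ux Vx] [Uy Vy]]; first by rewrite gt_max r0.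
by apply: dN_split; rewrite le_max; apply/orP; [left; apply: rP | right; apply: rP'].
Qed.

End FibreNumber.

(** * Subadditive sequences *)

(** The limit is the infimum of the quotients, finite by nonnegativity. *)
Lemma fekete (R : realType) (a : nat -> R) : (forall n, 0 <= a n) ->
  (forall m n, a (m + n)%N <= a m + a n) ->
  exists l : R, ((fun n => a n.+1 / n.+1%:R) @ \oo --> l)%classic.
Proof.
move=> a0 sub; pose S := [set a n.+1 / n.+1%:R | n in setT]%classic.
have Slb : lbound S 0 by move=> _ [n _ <-]; rewrite divr_ge0.
have Sinf : has_inf S by split; [exists (a 1%N / 1%:R), 0%N | exists 0].
exists (inf S); apply/cvgrPdist_le => e e0.
have e2 : 0 < e / 2 by rewrite divr_gt0.
have [_ [k _ <-] kP] := inf_adherent e2 Sinf.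
set L := k.+1 in kP; have L0 : 0 < L%:R :> R by rewrite ltr0n.
(* Bounds the contribution of every remainder modulo [L]. *)
pose B := \sum_(r < L) a r; have B0 : 0 <= B by apply: sumr_ge0.
have [K [K0 KP]] := large_nat (B / (e / 2)).
exists K => // n /= Kn; have n0 : 0 < n.+1%:R :> R by rewrite ltr0n.
have lower : inf S <= a n.+1 / n.+1%:R by apply: ge_inf; [exists 0 | exists n].
have mul q r : a (q * L + r)%N <= q%:R * a L + a r.
  elim: q => [|q ih]; first by rewrite mul0r add0r.
  by rewrite mulSn -addnA -[q.+1%:R]natr1 mulrDl mul1r; apply: le_trans (sub _ _) _; move: ih; clear; lra.
have arB : a (n.+1 %% L)%N <= B.
  have rL : (n.+1 %% L < L)%N by rewrite ltn_mod.
  by rewrite /B (bigD1 (Ordinal rL)) //= lerDl sumr_ge0.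
have up : a n.+1 <= (n.+1 %/ L)%:R * a L + B.
  by rewrite {1}(divn_eq n.+1 L); apply: le_trans (mul _ _) _; rewrite lerD2l.
have qL : (n.+1 %/ L)%:R * L%:R <= n.+1%:R :> R by rewrite -natrM ler_nat leq_divM.
have h1 : (n.+1 %/ L)%:R * a L <= n.+1%:R * (a L / L%:R).
  by rewrite mulrA ler_pdivlMr // mulrAC ler_wpM2r.
have h2 : B <= n.+1%:R * (e / 2).
  rewrite -ler_pdivrMr //; apply: le_trans KP _; by rewrite ler_nat ltnW.
have : a n.+1 / n.+1%:R <= inf S + e.
  rewrite ler_pdivrMr //; have := ler_wpM2l (ltW n0) (ltW kP); lra.
by move: lower e0; rewrite ler_norml; move: (inf S) (_ / _) => x y; clear => ? ? ?; apply/andP; split; lra.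
Qed.

(** * Relative metric mean dimension through fibre numbers *)

Section FibreEntropy.
Variables (R : realType) (X : Type) (d : X -> X -> R) (T : X -> X) (Y : Type) (pi : X -> Y) (Yset : set Y).
Hypothesis dyn : dynsys d T.
Hypothesis piT : forall x x', pi x = pi x' -> pi (T x) = pi (T x').
Hypothesis piY : forall x, Yset (pi x).
Variable x0 : X.
Notation v L eps := (fibre_number pi dyn L eps).

Lemma covnum_le N E eps n : covers d T N n eps E -> (covnum (dN d T N) E eps <= (n%:R)%:E)%E.
Proof. by move=> h; apply: ereal_inf_lbound; exists n. Qed.

Lemma le_covnum N E eps n : ~ covers d T N n eps E -> ((n.+1%:R)%:E <= covnum (dN d T N) E eps)%E.
Proof.
move=> nc; apply: le_ereal_inf_tmp => _ [k kc <-]; rewrite lee_fin ler_nat.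
by rewrite ltnNge; apply/negP => kn; apply: nc; apply: covers_mono kn kc.
Qed.

Lemma lne_le (x y : \bar R) : (x <= y)%E -> (lne x <= lne y)%E.
Proof.
case: x => [x| |]; case: y => [y| |] //=; rewrite ?leNye ?leey //.
- rewrite lee_fin => xy; have [x0'|x0'] := leP x 0; first by rewrite leNye.
  have [y0|y0] := leP y 0; first by have := lt_le_trans x0' (le_trans xy y0); rewrite ltxx.
  by rewrite lee_fin ler_ln ?posrE.
Qed.

(** By minimality some fibre has no cover with one set less, so the supremum is attained; points of
    [Yset] outside the image have empty fibres. *)
Lemma sup_lne_covnum N eps : 0 < eps ->
  ereal_sup [set lne (covnum (dN d T N) (pi @^-1` [set y]) eps) | y in Yset]%classic =
  (ln (v N eps)%:R)%:E.
Proof.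
move=> eps0; have v0 := fibre_number_gt0 pi dyn N x0 eps0.
rewrite -lne_EFin ?ltr0n //; apply/eqP; rewrite eq_le; apply/andP; split.
  apply: ge_ereal_sup => _ [y _ <-]; apply: lne_le; apply: covnum_le.
  have [[x xy]|no] := pselect (exists x, pi x = y).
    by have := fibre_numberP pi dyn N eps0 x; rewrite xy.
  have [U [Uo Uc]] := fibre_numberP pi dyn N eps0 x0.
  by exists U; split=> // x xy; case: no; exists x.
have [x nc] : exists x, ~ covers d T N (v N eps).-1 eps (fun x' => pi x' = pi x).
  apply/existsNP => h; have := fibre_number_min dyn eps0 h.
  by rewrite leqNgt prednK // leqnn.
apply: le_ereal_sup_tmp; exists (lne (covnum (dN d T N) (pi @^-1` [set pi x])%classic eps)); first by exists (pi x).
by apply: lne_le; have := le_covnum nc; rewrite prednK.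
Qed.

Lemma lmdimM_ge (t : R) :
  (forall e, 0 < e -> exists2 delta, 0 < delta & forall eps, 0 < eps < delta -> forall L, (0 < L)%N ->
     (t - e) * ln (1 / eps) <= ln (v L eps)%:R / L%:R) ->
  (t%:E <= lmdimM Yset pi T d)%E.
Proof.
move=> H; apply/lee_subgt0Pr => e e0.
have [delta delta0 dP] := H e e0.
(* Staying below 1/2 keeps [ln (1 / eps)] positive. *)
have m0 : 0 < Num.min delta (1 / 2) by rewrite lt_min delta0; lra.
apply: le_ereal_sup_tmp; eexists; first by exists (Num.min delta (1 / 2)).
apply: le_ereal_inf_tmp => _ [eps /= /andP[eps0 epsd] <-].
move: epsd; rewrite lt_min => /andP[epsd eps1].
have l0 : 0 < ln (1 / eps) :> R.
  by rewrite ln_gt0 // ltr_pdivlMr // mul1r; lra.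
have [||l lP] := @fekete R (fun n => ln (v n eps)%:R).
- by move=> n; rewrite ln_ge0 // ler1n fibre_number_gt0.
- move=> m n; rewrite -lnM ?posrE ?ltr0n ?fibre_number_gt0 // -natrM.
  rewrite ler_ln ?posrE ?ltr0n ?muln_gt0 ?fibre_number_gt0 // ler_nat.
  exact: fibre_number_submul.
pose u (N : nat) : R := ln (v N.+1 eps)%:R / N.+1%:R / ln (1 / eps).
have uE : (fun N => (ereal_sup [set lne (covnum (dN d T N.+1) (pi @^-1` [set y])%classic eps) | y in Yset]%classic
       * ((N.+1%:R * ln (1 / eps))^-1)%:E)%E) = (fun N => (u N)%:E).
  by apply/funext => N; rewrite sup_lne_covnum // -EFinM /u invfM mulrA.
have uc : (u @ \oo --> l / ln (1 / eps))%classic by apply: cvgMr_tmp.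
rewrite uE -EFinB; apply: lime_ge.
  by apply: (cvgP (l / ln (1 / eps))%:E); apply/fine_cvgP; split; [exact: nearW | exact: uc].
apply: nearW => N; rewrite lee_fin /u ler_pdivlMr //.
by apply: dP; rewrite ?eps0.
Qed.
End FibreEntropy.

(** * Products of complexes *)

Section Overlap.
Variable R : realType.
Implicit Types p q : R.

(* length of the intersection of [p, p'] and [q, q'] *)
Definition overlap p p' q q' : R := Num.max 0 (Num.min p' q' - Num.max p q).

Lemma overlap_ge0 p p' q q' : 0 <= overlap p p' q q'.
Proof. by rewrite /overlap le_max lexx. Qed.

Lemma overlapC p p' q q' : overlap p p' q q' = overlap q q' p p'.
Proof. by rewrite /overlap minC [Num.max p q]maxC. Qed.

Definition clamp p p' t : R := if t <= p then p else if p' <= t then p' else t.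

(** Written as an increment, the overlap telescopes along a partition, which yields the marginals of
    the coupling. *)
Lemma overlap_clamp p p' q q' : p <= p' -> q <= q' ->
  overlap p p' q q' = clamp p p' q' - clamp p p' q.
Proof.
move=> pp qq; rewrite /overlap /clamp.
have [h1|h1] := leP q' p; have [h2|h2] := leP q p; have [h3|h3] := leP p' q';
have [h4|h4] := leP p' q; have [h5|h5] := leP 0 (_ - _); lra.
Qed.

Lemma overlap_neq0 p p' q q' : overlap p p' q q' != 0 -> [/\ p < p', q < q', p < q' & q < p'].
Proof.
rewrite /overlap; have [h5|h5] := leP 0 (_ - _); last by rewrite eqxx.
rewrite subr_eq0 => n; have : Num.max p q < Num.min p' q' by rewrite lt_neqAle eq_sym n -subr_ge0.
by rewrite gt_max !lt_min => /andP[/andP[-> ->] /andP[-> ->]].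
Qed.

Lemma overlap_lip p p' q q' a a' b b' e : `|p - a| <= e -> `|p' - a'| <= e -> `|q - b| <= e ->
  `|q' - b'| <= e -> `|overlap p p' q q' - overlap a a' b b'| <= 2 * e.
Proof.
rewrite !ler_norml => /andP[? ?] /andP[? ?] /andP[? ?] /andP[? ?].
have ov x x' y y' u u' w w' : x - e <= u <= x + e -> x' - e <= u' <= x' + e -> y - e <= w <= y + e ->
    y' - e <= w' <= y' + e -> overlap x x' y y' <= overlap u u' w w' + 2 * e.
  move=> /andP[? ?] /andP[? ?] /andP[? ?] /andP[? ?].
  have ? : 0 <= overlap u u' w w' by exact: overlap_ge0.
  rewrite {1}/overlap ge_max; apply/andP; split; first by lra.
  have : Num.min u' w' - Num.max u w <= overlap u u' w w' by rewrite /overlap le_max lexx orbT.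
  have [] := leP x' y'; have [] := leP u' w'; have [] := leP x y; have [] := leP u w; lra.
rewrite lerBlDr lerNl opprB lerBlDr [2 * e + _]addrC [X in _ && (_ <= X)]addrC.
by apply/andP; split; apply: ov; apply/andP; split; lra.
Qed.

(* The coupling of two probability vectors by the common refinement of the
   partitions of the unit interval they define; its support is a chain. *)
Definition coupling k k' (p : 'I_k -> R) (q : 'I_k' -> R) (i : 'I_k) (j : 'I_k') : R :=
  overlap (cumsum p i) (cumsum p i.+1) (cumsum q j) (cumsum q j.+1).

Lemma couplingC k k' (p : 'I_k -> R) (q : 'I_k' -> R) i j : coupling p q i j = coupling q p j i.
Proof. exact: overlapC. Qed.

Lemma coupling_marginal k k' (p : 'I_k -> R) (q : 'I_k' -> R) i :
  (forall i, 0 <= p i) -> \sum_i p i = 1 -> (forall j, 0 <= q j) -> \sum_j q j = 1 ->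
  \sum_j coupling p q i j = p i.
Proof.
move=> p0 p1 q0 q1.
have pp : cumsum p i <= cumsum p i.+1 by apply: cumsum_mono.
pose g (j : nat) := clamp (cumsum p i) (cumsum p i.+1) (cumsum q j).
rewrite (eq_bigr (fun j : 'I_k' => g j.+1 - g j)); last first.
  by move=> j _; rewrite /coupling overlap_clamp //; apply: cumsum_mono.
rewrite -(big_mkord xpredT (fun j => g j.+1 - g j)) telescope_sumr //.
have c0 : 0 <= cumsum p i by apply: sumr_ge0.
have c1 : cumsum p i.+1 <= 1 by rewrite -p1 -cumsum_last; apply: cumsum_mono.
rewrite /g cumsum0 cumsum_last q1 /clamp c0 c1.
have -> : p i = cumsum p i.+1 - cumsum p i by rewrite cumsumS addrC addKr.
by have [h|h] := leP 1 (cumsum p i); lra.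
Qed.

Lemma coupling_support k k' (p : 'I_k -> R) (q : 'I_k' -> R) i j :
  coupling p q i j != 0 -> p i != 0 /\ q j != 0.
Proof.
by move=> /overlap_neq0[]; rewrite !cumsumS !ltrDl => /gt_eqF -> /gt_eqF ->.
Qed.

Lemma coupling_chain k k' (p : 'I_k -> R) (q : 'I_k' -> R) i j i' j' :
  (forall i, 0 <= p i) -> (forall j, 0 <= q j) ->
  coupling p q i j != 0 -> coupling p q i' j' != 0 -> (i < i')%N -> (j' < j)%N -> False.
Proof.
move=> p0 q0 /overlap_neq0[_ _ _ h] /overlap_neq0[_ _ h' _] ii jj.
by have := cumsum_mono p0 ii; have := cumsum_mono q0 jj; lra.
Qed.
End Overlap.

(** A chain in a product of two chains is strictly ranked by [r], which takes values from 0 to the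
    sum of the two sizes minus 2. *)
Lemma chain_card (V : finType) (k k' : nat) (a : V -> 'I_k) (b : V -> 'I_k') (S : {set V}) :
  (forall u v, a u = a v -> b u = b v -> u = v) ->
  {in S &, forall u v, ~ ((a u < a v)%N /\ (b v < b u)%N)} -> (0 < #|S|)%N ->
  (#|S| < #|a @: S| + #|b @: S|)%N.
Proof.
move=> abinj chain S0.
pose r u := (#|[set i in a @: S | (i < a u)%N]%SET| + #|[set j in b @: S | (j < b u)%N]%SET|)%N.
have below (k0 : nat) (c : V -> 'I_k0) u : u \in S -> (#|[set i in c @: S | (i < c u)%N]%SET| < #|c @: S|)%N.
  move=> uS; apply: proper_card; apply/properP; split.
    by apply/fintype.subsetP => i; rewrite inE => /andP[].
  by exists (c u); [exact: imset_f | rewrite inE ltnn andbF].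
have sub (k0 : nat) (c : V -> 'I_k0) u v : (c u <= c v)%N ->
    (#|[set i in c @: S | (i < c u)%N]%SET| <= #|[set i in c @: S | (i < c v)%N]%SET|)%N.
  move=> uv; apply/subset_leq_card/fintype.subsetP => i; rewrite !inE => /andP[-> iu] /=.
  exact: leq_trans iu uv.
have ssub (k0 : nat) (c : V -> 'I_k0) u v : u \in S -> (c u < c v)%N ->
    (#|[set i in c @: S | (i < c u)%N]%SET| < #|[set i in c @: S | (i < c v)%N]%SET|)%N.
  move=> uS uv; apply: proper_card; apply/properP; split.
    by apply/fintype.subsetP => i; rewrite !inE => /andP[-> iu] /=; apply: ltn_trans iu uv.
  by exists (c u); rewrite inE ?ltnn ?andbF // imset_f.
have rlt u : u \in S -> (r u < (#|a @: S| + #|b @: S|).-1)%N.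
  by move=> uS; have := below _ a u uS; have := below _ b u uS; rewrite /r; clear; lia.
have rinj : {in S &, injective r}.
  have half u v : u \in S -> v \in S -> r u = r v -> (a u < a v)%N -> False.
    move=> uS vS ruv auv; have := ssub _ a u v uS auv.
    have buv : (b u <= b v)%N by rewrite leqNgt; apply/negP => bvu; exact: (chain u v uS vS (conj auv bvu)).
    by have := sub _ b u v buv; move: ruv; rewrite /r; clear; lia.
  have half' u v : u \in S -> v \in S -> r u = r v -> (b u < b v)%N -> False.
    move=> uS vS ruv buv; have := ssub _ b u v uS buv.
    have auv : (a u <= a v)%N by rewrite leqNgt; apply/negP => avu; exact: (chain v u vS uS (conj avu buv)).
    by have := sub _ a u v auv; move: ruv; rewrite /r; clear; lia.
  move=> u v uS vS ruv; apply: (abinj u v); apply: val_inj => /=.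
    by case: (ltngtP (a u) (a v)) => // h; [case: (half u v) | case: (half v u)].
  by case: (ltngtP (b u) (b v)) => // h; [case: (half' u v) | case: (half' v u)].
have n0 : (0 < (#|a @: S| + #|b @: S|).-1)%N.
  by case/card_gt0P: S0 => u /rlt; apply: leq_ltn_trans.
pose n := (#|a @: S| + #|b @: S|).-1.
have : (#|S| <= #|'I_n.-1.+1|)%N.
  apply: (@leq_card_in _ _ (fun u => inord (r u) : 'I_n.-1.+1)) => u v uS vS /(congr1 val) /=.
  rewrite !inordK ?prednK ?rlt //; exact: rinj.
by rewrite card_ord prednK // /n; move: n0; clear; lia.
Qed.

(** The property whose least [n] is [Widim]. *)
Definition has_width (R : realType) (X : Type) (D : X -> X -> R) (eps : R) (n : nat) : Prop :=
  exists (k : nat) (K : {set {set 'I_k}}) (f : X -> 'I_k -> R),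
    [/\ simpcomplex K, scdim K n, forall x, realization K (f x),
        forall i, mcontR D (fun x => f x i) &
        forall p, diam_lt D (f @^-1` [set p])%classic eps].

Section Width.
Variables (R : realType) (X : Type) (d : X -> X -> R) (T : X -> X).
Hypothesis dyn : dynsys d T.
Let dm : is_metric d. Proof. by case: dyn. Qed.

Lemma mcontR_dN N (g : X -> R) : mcontR (dN d T N) g -> mcontR d g.
Proof.
move=> gc x e /(gc x)[r r0 rP]; have [r' r'0 rP'] := dN_cont dyn N x r0.
by exists r' => // y /rP'; apply: rP.
Qed.

Lemma dN_mcontR N (g : X -> R) : (0 < N)%N -> mcontR d g -> mcontR (dN d T N) g.
Proof.
move=> N0 gc x e /(gc x)[r r0 rP]; exists r => // y xy; apply: rP.
exact: le_lt_trans (le_dN _ _ _ _ N0) xy.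
Qed.

Lemma has_width_dN N N' eps n : (0 < N)%N -> (N <= N')%N ->
  has_width (dN d T N') eps n -> has_width (dN d T N) eps n.
Proof.
move=> N0 NN [k [K [f [Ks Kd fK fc ff]]]]; exists k, K, f; split=> // [i|p].
  by apply: dN_mcontR => //; apply: mcontR_dN (fc i).
have [r r0 rP] := ff p; exists r => // x y fx fy; apply: le_trans (rP x y fx fy).
exact: dN_mono.
Qed.

Lemma mcontR_shift a (g : X -> R) : mcontR d g -> mcontR d (fun x => g (iter a T x)).
Proof.
move=> gc x e /(gc (iter a T x))[r r0 rP]; have [r' r'0 rP'] := iter_cont dyn a x r0.
by exists r' => // y /rP'; apply: rP.
Qed.

Lemma mcontR_family (I : finType) (g : X -> I -> R) : (forall i, mcontR d (g^~ i)) ->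
  forall x e, 0 < e -> exists2 r, 0 < r & forall y, d x y < r -> forall i, `|g x i - g y i| <= e.
Proof.
move=> gc x e e0.
have [r r0 rP] : exists2 r, 0 < r & forall i y, d x y < r -> `|g x i - g y i| <= e.
  apply: uniform_radius => [i q q' qq h y xy|i]; first by apply: h; apply: lt_le_trans qq.
  by have [r r0 rP] := gc i x e e0; exists r => // y /rP /ltW.
by exists r => // y xy i; apply: rP.
Qed.

Lemma coupling_cont k k' (f : X -> 'I_k -> R) (g : X -> 'I_k' -> R) i j :
  (forall i, mcontR d (f^~ i)) -> (forall j, mcontR d (g^~ j)) ->
  mcontR d (fun x => coupling (f x) (g x) i j).
Proof.
move=> fc gc x e e0; pose e' := e / (2 * (k%:R + k'%:R + 1)).
have e'0 : 0 < e' by rewrite divr_gt0 // mulr_gt0 // ltr_wpDl // addr_ge0.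
have [r r0 rP] := mcontR_family fc x e'0; have [r' r'0 rP'] := mcontR_family gc x e'0.
exists (Num.min r r') => [|y]; first by rewrite lt_min r0.
rewrite lt_min => /andP[/rP fxy /rP' gxy].
have K0 : 0 <= k%:R * e' by rewrite mulr_ge0 // ltW.
have K0' : 0 <= k'%:R * e' by rewrite mulr_ge0 // ltW.
have F n : `|cumsum (f x) n - cumsum (f y) n| <= (k%:R + k'%:R) * e'.
  by apply: le_trans (cumsum_near n fxy) _; rewrite mulrDl lerDl.
have G n : `|cumsum (g x) n - cumsum (g y) n| <= (k%:R + k'%:R) * e'.
  by apply: le_trans (cumsum_near n gxy) _; rewrite mulrDl lerDr.
apply: le_lt_trans (overlap_lip (F i) (F i.+1) (G j) (G j.+1)) _.
have -> : e = 2 * ((k%:R + k'%:R + 1) * e').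
  rewrite /e'; have : k%:R + k'%:R + 1 != 0 :> R by rewrite gt_eqF // ltr_wpDl // addr_ge0.
  by move: (_ + 1) => z z0; field.
by rewrite ltr_pM2l // ltr_pM2r // ltrDl.
Qed.

(** Triangulated product of the two complexes: vertices are pairs, simplices are chains projecting
    to simplices, and the map is the coupling of [f1] with [f2] after [a] iterations of [T]. The
    marginals give both maps back, so fibres are small; [chain_card] adds the dimensions. *)
Lemma has_width_add (x0 : X) a b eps n1 n2 : (0 < a)%N -> (0 < b)%N ->
  has_width (dN d T a) eps n1 -> has_width (dN d T b) eps n2 ->
  exists2 n, (n <= n1 + n2)%N & has_width (dN d T (a + b)) eps n.
Proof.
move=> a0 b0 [k1 [K1 [f1 [K1s K1d f1K f1c f1f]]]] [k2 [K2 [f2 [K2s K2d f2K f2c f2f]]]].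
pose V := ('I_k1 * 'I_k2)%type.
pose A (u : 'I_#|{: V}|) : 'I_k1 := (enum_val u : V).1.
pose B (u : 'I_#|{: V}|) : 'I_k2 := (enum_val u : V).2.
have ABinj u v : A u = A v -> B u = B v -> u = v.
  move=> eA eB; apply: enum_val_inj; move: eA eB; rewrite /A /B.
  by case: (enum_val u) => ? ?; case: (enum_val v) => ? ? /= -> ->.
pose g2 x := f2 (iter a T x).
pose h x u := coupling (f1 x) (g2 x) (A u) (B u).
have f1_0 x i : 0 <= f1 x i by case: (f1K x).
have g2_0 x (j : 'I_k2) : 0 <= g2 x j by rewrite /g2; case: (f2K (iter a T x)).
have f1_1 x : \sum_i f1 x i = 1 by case: (f1K x) => _ [].
have g2_1 x : \sum_i g2 x i = 1 := (f2K (iter a T x)).2.1.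
have hE x i j : h x (enum_rank ((i, j) : V)) = coupling (f1 x) (g2 x) i j.
  by rewrite /h /A /B enum_rankK.
have m1 x i : \sum_j h x (enum_rank ((i, j) : V)) = f1 x i.
  by rewrite (eq_bigr _ (fun j _ => hE x i j)) coupling_marginal.
have m2 x j : \sum_i h x (enum_rank ((i, j) : V)) = g2 x j.
  rewrite (eq_bigr (fun i => coupling (g2 x) (f1 x) j i)) ?coupling_marginal // => i _.
  by rewrite hE couplingC.
have hsum x : \sum_u h x u = 1.
  rewrite (reindex (@enum_rank V)) /=; last exact: onW_bij (enum_rank_bij _).
  rewrite -(f1_1 x) -(eq_bigr _ (fun i _ => m1 x i)) pair_bigA /=.
  by apply: eq_bigr => -[].
pose chainb (S : {set 'I_#|{: V}|}) := [forall u in S, forall v in S, ~~ ((A u < A v)%N && (B v < B u)%N)].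
pose K : {set {set 'I_#|{: V}|}} :=
  finset (fun S : {set 'I_#|{: V}|} => [&& (0 < #|S|)%N, A @: S \in K1, B @: S \in K2 & chainb S]).
have sup x : finset (fun u => h x u != 0) \in K.
  rewrite inE; set S := finset _.
  have S0 : (0 < #|S|)%N.
    rewrite lt0n; apply/negP => /eqP/cards0_eq S0; have := hsum x.
    rewrite big1 => [/esym/eqP|u _]; first by rewrite oner_eq0.
    by apply/eqP/negbNE/negP => hu; have : u \in S; [by rewrite inE hu | by rewrite S0 inE].
  have im0 (k : nat) (F : _ -> 'I_k) : (0 < #|F @: S|)%N.
    by case/card_gt0P: S0 => u uS; apply/card_gt0P; exists (F u); apply: imset_f.
  apply/and4P; split=> //.
  - have [_ [_ f1S]] := f1K x; apply: K1s.2 f1S _ (im0 _ _).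
    by apply/fintype.subsetP => _ /imsetP[u + ->]; rewrite !inE => /coupling_support[].
  - have [_ [_ f2S]] := f2K (iter a T x); apply: K2s.2 f2S _ (im0 _ _).
    by apply/fintype.subsetP => _ /imsetP[u + ->]; rewrite !inE => /coupling_support[].
  - apply/forall_inP => u uS; apply/forall_inP => v vS; apply/negP => /andP[auv bvu].
    move: uS vS; rewrite !inE => uS vS.
    exact: (coupling_chain (f1_0 x) (g2_0 x) uS vS auv bvu).
(* The exact dimension of [K], possibly below [n1 + n2], since [scdim] asks for a simplex of top
   dimension. *)
pose n := (\max_(S in K) #|S|).-1.
have max0 : (0 < \max_(S in K) #|S|)%N.
  apply: leq_trans (leq_bigmax_cond _ (sup x0)); move: (sup x0).
  by rewrite inE => /and4P[].
have KS S : S \in K -> (#|S| <= n1 + n2 + 1)%N.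
  rewrite inE => /and4P[S0 SA SB /forall_inP ch].
  have := @chain_card _ _ _ A B S ABinj _ S0.
  have := K1d.2 _ SA; have := K2d.2 _ SB; move=> hB hA /(_ _)hc.
  have : (#|S| < #|A @: S| + #|B @: S|)%N.
    apply: hc => u v uS vS [auv bvu]; have /forall_inP/(_ v vS) := ch u uS.
    by rewrite auv bvu.
  move=> h0; rewrite -ltnS; apply: leq_trans h0 _.
  by rewrite (_ : (n1 + n2 + 1).+1 = n1.+1 + n2.+1)%N ?leq_add // addn1 addSn addnS.
exists n.
  have : (\max_(S in K) #|S| <= n1 + n2 + 1)%N by apply/bigmax_leqP.
  by rewrite /n; clear; lia.
exists #|{: V}|, K, h; split=> //.
- split=> [S|S S']; first by rewrite inE => /and4P[].
  rewrite !inE => /and4P[S0 SA SB ch] SS S'0.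
  have im0 (k : nat) (F : _ -> 'I_k) : (0 < #|F @: S'|)%N.
    by case/card_gt0P: S'0 => u uS; apply/card_gt0P; exists (F u); apply: imset_f.
  apply/and4P; split=> //.
  + by apply: K1s.2 SA _ (im0 _ _); apply: imsetS.
  + by apply: K2s.2 SB _ (im0 _ _); apply: imsetS.
  + apply/forall_inP => u uS; apply/forall_inP => v vS.
    by have /forall_inP/(_ v (fintype.subsetP SS v vS)) := forall_inP ch u (fintype.subsetP SS u uS).
- split=> [|S SK]; last by rewrite /n prednK //; apply: leq_bigmax_cond.
  have K0 : (0 < #|K|)%N by apply/card_gt0P; exists (finset (fun u => h x0 u != 0)).
  have [S SK Smax] := eq_bigmax_cond (fun S : {set 'I_#|{: V}|} => #|S|) K0.
  by exists S => //; rewrite /n prednK.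
- move=> x; split=> [u|]; first exact: overlap_ge0.
  by split; [exact: hsum | exact: sup].
- move=> u; apply: dN_mcontR; first by rewrite addn_gt0 a0.
  apply: coupling_cont => i; first exact: mcontR_dN (f1c i).
  exact: (@mcontR_shift a (fun x => f2 x i) (mcontR_dN (f2c i))).
- move=> p; have [[x hx]|no] := pselect (exists x, h x = p); last first.
    by exists (eps - 1) => [|x y hx]; [lra | case: no; exists x].
  have [r1 r10 r1P] := f1f (f1 x); have [r2 r20 r2P] := f2f (g2 x).
  have f1E y : h y = p -> f1 y = f1 x.
    by move=> hy; apply/funext => i; rewrite -!m1 hy hx.
  have g2E y : h y = p -> g2 y = g2 x.
    by move=> hy; apply/funext => i; rewrite -!m2 hy hx.
  exists (Num.max r1 r2) => [|y z hy hz]; first by rewrite gt_max r10.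
  apply: dN_split; rewrite le_max; apply/orP; [left; apply: r1P | right; apply: r2P].
  + exact: f1E.
  + exact: f1E.
  + exact: g2E.
  + exact: g2E.
Qed.
End Width.

(** * Mean dimension *)

Section MeanDimension.
Variables (R : realType) (X : Type) (d : X -> X -> R) (T : X -> X).
Hypothesis dyn : dynsys d T.
Variable x0 : X.
Let dm : is_metric d. Proof. by case: dyn. Qed.
Let dc : mcompact d. Proof. by case: dyn. Qed.

Lemma WidimP (D : X -> X -> R) eps : (Widim D eps = +oo%E /\ forall n, ~ has_width D eps n) \/
  exists2 n, has_width D eps n & Widim D eps = (n%:R)%:E.
Proof.
have [ex|no] := pselect (exists n, has_width D eps n).
  right; have ex' : exists n, `[< has_width D eps n >] by case: ex => n h; exists n; apply/asboolP.
  have [n /asboolP wn nmin] := ex_minnP ex'; exists n => //.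
  apply/eqP; rewrite eq_le; apply/andP; split.
    by apply: ereal_inf_lbound; exists n.
  apply: le_ereal_inf_tmp => _ [k wk <-]; rewrite lee_fin ler_nat; apply: nmin; exact/asboolP.
left; split=> [|n h]; last by apply: no; exists n.
rewrite /Widim (_ : [set _ | _ in _]%classic = set0) ?ereal_inf0 //.
by apply/seteqP; split=> [y [n h _]|//]; case: no; exists n.
Qed.

Lemma Widim_le (D : X -> X -> R) eps n : has_width D eps n -> (Widim D eps <= (n%:R)%:E)%E.
Proof. by move=> h; apply: ereal_inf_lbound; exists n. Qed.

Lemma Widim_ge0 (D : X -> X -> R) eps : (0 <= Widim D eps)%E.
Proof. by apply: le_ereal_inf_tmp => _ [n _ <-]; rewrite lee_fin. Qed.

Lemma Widim_mono N N' eps : (0 < N)%N -> (N <= N')%N -> (Widim (dN d T N) eps <= Widim (dN d T N') eps)%E.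
Proof.
move=> N0 NN; have [[-> _]|[n wn ->]] := WidimP (dN d T N') eps; first exact: leey.
by apply: Widim_le; apply: has_width_dN wn.
Qed.

Lemma Widim_anti (D : X -> X -> R) eps eps' : eps <= eps' -> (Widim D eps' <= Widim D eps)%E.
Proof.
move=> ee; have [[-> _]|[n [k [K [f [Ks Kd fK fc ff]]]] ->]] := WidimP D eps; first exact: leey.
apply: Widim_le; exists k, K, f; split=> // p; have [r r0 rP] := ff p.
by exists r => //; apply: lt_le_trans ee.
Qed.

Definition width N eps : R := fine (Widim (dN d T N) eps).

(** If no width is available at time 1, none is later; otherwise [has_width_add] makes all widths
    finite and [fekete] applies. *)
Lemma width_cvg eps : exists l : \bar R,
  ((fun N : nat => (Widim (dN d T N.+1) eps * ((N.+1%:R)^-1)%:E)%E) @ \oo --> l)%classic.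
Proof.
have [[Wy _]|[n1 wn1 _]] := WidimP (dN d T 1) eps.
  exists +oo%E; rewrite (_ : (fun _ => _) = fun=> +oo%E); first exact: cvg_cst.
  apply/funext => N; have := Widim_mono eps (ltn0Sn 0) (ltn0Sn N); rewrite Wy leye_eq => /eqP ->.
  by rewrite gt0_mulye // lte_fin invr_gt0.
have fin N : exists2 n, has_width (dN d T N.+1) eps n & Widim (dN d T N.+1) eps = (n%:R)%:E.
  have [n wn] : exists n, has_width (dN d T N.+1) eps n.
    elim: N => [|N [n wn]]; first by exists n1.
    have [k _ wk] := has_width_add dyn x0 (ltn0Sn N) (ltn0Sn 0) wn wn1.
    by exists k; rewrite -addn1.
  by have [[_ no]|//] := WidimP (dN d T N.+1) eps; case: (no n).
have finE N : Widim (dN d T N.+1) eps = (width N.+1 eps)%:E.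
  by have [n _ h] := fin N; rewrite /width h.
(* Subadditivity is known at positive times only, so time 0 is given the value 0. *)
pose a N := if N is N'.+1 then width N eps else 0.
have [||l lP] := @fekete R a.
- by case=> [|N] //; rewrite /a fine_ge0 // Widim_ge0.
- case=> [|m]; first by move=> n; rewrite add0r add0n.
  case=> [|n]; first by rewrite addn0 addr0.
  have [p wp pE] := fin m; have [q wq qE] := fin n.
  have [r rle wr] := has_width_add dyn x0 (ltn0Sn m) (ltn0Sn n) wp wq.
  have := Widim_le wr; rewrite addSn finE lee_fin => /le_trans; apply.
  by rewrite /a /width pE qE /= -natrD ler_nat.
exists l%:E; apply/fine_cvgP; split; first by apply: nearW => N; rewrite finE.
by apply: cvg_trans lP; apply: near_eq_cvg; apply: nearW => N; rewrite /= finE.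
Qed.

Definition mean_width eps : \bar R :=
  lim ((fun N : nat => (Widim (dN d T N.+1) eps * ((N.+1%:R)^-1)%:E)%E) @ \oo)%classic.

Lemma mean_width_cvg eps :
  ((fun N : nat => (Widim (dN d T N.+1) eps * ((N.+1%:R)^-1)%:E)%E) @ \oo --> mean_width eps)%classic.
Proof. by have [l lP] := width_cvg eps; rewrite /mean_width (cvg_lim _ lP). Qed.

Lemma mean_width_is_cvg eps :
  cvg ((fun N : nat => (Widim (dN d T N.+1) eps * ((N.+1%:R)^-1)%:E)%E) @ \oo)%classic.
Proof. by apply/cvg_ex; exists (mean_width eps); exact: mean_width_cvg. Qed.

Lemma mean_width_ge0 eps : (0 <= mean_width eps)%E.
Proof.
rewrite /mean_width; apply: lime_ge; first exact: mean_width_is_cvg.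
by apply: nearW => N; rewrite mule_ge0 ?Widim_ge0 // lee_fin.
Qed.

Lemma mean_width_anti eps eps' : eps <= eps' -> (mean_width eps' <= mean_width eps)%E.
Proof.
move=> ee; rewrite /mean_width; apply: lee_lim.
- exact: mean_width_is_cvg.
- exact: mean_width_is_cvg.
by apply: nearW => N; rewrite lee_wpmul2r ?lee_fin // Widim_anti.
Qed.

Lemma mdim_cvg : (mean_width eps @[eps --> 0^'+] --> mdim T d)%classic.
Proof.
have h := @nonincreasing_at_right_cvge R mean_width 0 (BInfty R false) isT
  (fun x y _ _ xy => mean_width_anti xy).
by rewrite /mdim (cvg_lim _ h).
Qed.

Lemma mdim_is_cvg : cvg (mean_width eps @[eps --> 0^'+])%classic.
Proof. by apply/cvg_ex; exists (mdim T d); exact: mdim_cvg. Qed.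

Lemma mean_width_le_mdim eps : 0 < eps -> (mean_width eps <= mdim T d)%E.
Proof.
move=> eps0; apply: lime_ge; first exact: mdim_is_cvg.
by near=> t; apply: mean_width_anti; near: t; exact: nbhs_right_le.
Unshelve. all: by end_near. Qed.

Lemma mdim_ge (t : \bar R) delta : 0 < delta -> (forall eps, 0 < eps < delta -> (t <= mean_width eps)%E) ->
  (t <= mdim T d)%E.
Proof.
move=> delta0 h; apply: lime_ge; first exact: mdim_is_cvg.
by near=> t'; apply: h; apply/andP; split; near: t'; [exact: nbhs_right_gt | exact: nbhs_right_lt].
Unshelve. all: by end_near. Qed.

(** Small fibres and expansion give the separation hypothesis of [cube_to_simplex_support]; its 1/4
    is the bound on [eps]. *)
Lemma width_of_cube N M (psi : ('I_M -> R) -> X) eps n : (0 < N)%N -> eps <= 1 / 4 ->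
  (forall (x : 'I_M -> R), cube x -> forall e : R, 0 < e ->
     exists2 r : R, 0 < r & forall y, cube y -> supdist x y < r -> d (psi x) (psi y) < e) ->
  (forall x y : 'I_M -> R, cube x -> cube y -> supdist x y <= dN d T N (psi x) (psi y)) ->
  has_width (dN d T N) eps n -> (M <= n)%N.
Proof.
move=> N0 eps4 psic psie [k [K [f [Ks Kd fK fc ff]]]].
have [delta delta0 sep] := separation dm dc (fun i => mcontR_dN dyn (fc i)) (dN_cont dyn N)
  (dN_sym dyn N) (dN_tri dyn N) ff.
have f1 x : \sum_i f x i = 1 by case: (fK x) => _ [].
have [|||x cx xM] := @cube_to_simplex_support R M k (fun x => f (psi x)) delta _ _ delta0 _.
- by move=> x; apply: f1.
- move=> e e0; apply: (@heine R 'I_M 'I_k (fun x => f (psi x))) => // x i x01 e' e'0.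
  have [r r0 rP] := mcontR_dN dyn (fc i) (psi x) e'0.
  have [r' r'0 rP'] := psic x x01 r r0; exists r' => // y y01 xy.
  by apply: rP; apply: rP' => //; apply: supdist_lt.
- move=> x y x01 y01 xy j; apply: le_trans (le_supdist x y j) _.
  by apply: le_trans (psie x y x01 y01) _; apply: le_trans eps4; exact/ltW/sep.
have [_ [_ S]] := fK (psi x).
by rewrite -ltnS; apply: leq_trans xM (Kd.2 _ S).
Qed.
End MeanDimension.

(** * Conclusion *)

Lemma le0_of_small_multiples (R : realType) (a b : R) : 
  (forall t, 0 < t -> a <= b * t) -> a <= 0.
Proof.
move=> h; apply/ler_addgt0Pr => e e0; rewrite add0r.
have p0 : 0 < 1 + `|b| by have := normr_ge0 b; lra.
have := h (e / (1 + `|b|)) (divr_gt0 e0 p0); move/le_trans; apply.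
rewrite mulrA ler_pdivrMr // mulrC ler_wpM2l ?(ltW e0) //.
by have := ler_norm b; lra.
Qed.

(* The exponent [k] with [eps ^+ 2] just below [rho ^+ k]; the factor
   [(1 - rho) / ln (1 / rho)] is at least [rho], hence tends to [1] with [rho]. *)
Lemma exponent_choice (R : realType) (rho eps : R) : 0 < rho -> rho < 1 -> 0 < eps -> eps < 1 ->
  exists k : nat, eps ^+ 2 <= rho ^+ k /\ rho * ln (1 / eps) - 1 / 2 <= (1 - rho) / 2 * k%:R.
Proof.
move=> rho0 rho1 eps0 eps1.
have lrE : ln (1 / rho) = - ln rho by rewrite div1r lnV.
have leE : ln (1 / eps) = - ln eps by rewrite div1r lnV.
have lr0 : 0 < ln (1 / rho) by rewrite ln_gt0 // ltr_pdivlMr // mul1r.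
have le0 : 0 < ln (1 / eps) by rewrite ln_gt0 // ltr_pdivlMr // mul1r.
have lr1 : rho * ln (1 / rho) <= 1 - rho.
  have := expR_ge1Dx (ln (1 / rho)); rewrite lnK ?posrE ?divr_gt0 // => h.
  have := ler_wpM2l (ltW rho0) h; rewrite mulrDr mulr1 mulrCA divff ?gt_eqF //; lra.
have x0 : 0 <= 2 * ln (1 / eps) / ln (1 / rho) by rewrite divr_ge0 ?mulr_ge0 // ltW.
have /andP[k1 k2] := truncn_itv x0; move: k1 k2; set k := Num.truncn _ => k1 k2.
move: k1 k2; rewrite ler_pdivlMr // ltr_pdivrMr // -[k.+1%:R]natr1 => k1 k2.
exists k; split.
  rewrite -ler_ln ?posrE ?exprn_gt0 // !lnXn // -[leRHS]mulr_natl -[leLHS]mulr_natl.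
  by rewrite -lerN2 -!mulrN -lrE -leE.
have h : (1 - rho) * (2 * ln (1 / eps)) <= (1 - rho) * ((k%:R + 1) * ln (1 / rho)).
  by rewrite ler_wpM2l ?subr_ge0 // ltW.
rewrite -(ler_pM2r lr0).
have h2 : rho * ln (1 / rho) * ln (1 / eps) <= (1 - rho) * ln (1 / eps) by rewrite ler_wpM2r // ltW.
have h3 : 0 <= rho * ln (1 / rho) by rewrite mulr_ge0 // ltW.
by move: (ln (1 / rho)) (ln (1 / eps)) (k%:R) h h2 h3 => a b c; lra.
Qed.

(* A polynomial vanishing on all but one point of the support of [p - q] has
   degree at most [2 n + 1], so the moments of order at most [2 n + 1] separate. *)
Lemma moments_inj (R : realType) (k n : nat) (p q : 'I_k -> R) :
  \sum_i p i = 1 -> \sum_i q i = 1 ->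
  (#|finset (fun i => p i != 0%R)| <= n.+1)%N -> (#|finset (fun i => q i != 0%R)| <= n.+1)%N ->
  (forall a : 'I_(n.*2.+1), \sum_i p i * i%:R ^+ a.+1 = \sum_i q i * i%:R ^+ a.+1) -> p = q.
Proof.
move=> p1 q1 pn qn mom; apply/funext => i0; apply/eqP/negbNE/negP => pq.
pose U : {set 'I_k} := (finset (fun i => p i != 0%R) :|: finset (fun i => q i != 0%R))%SET.
have i0U : i0 \in U.
  rewrite !inE; apply: contraNT pq; rewrite negb_or !negbK => /andP[/eqP -> /eqP ->]; exact: eqxx.
pose rs : seq R := [seq (nat_of_ord i)%:R | i <- enum (U :\ i0)%SET].
pose P : {poly R} := \prod_(a <- rs) ('X - a%:P).
have Pi i : i \in U -> i != i0 -> P.[i%:R] = 0.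
  move=> iU ii; apply/rootP; rewrite root_prod_XsubC; apply/mapP; exists i => //.
  by rewrite mem_enum in_setD1 ii.
have Pi0 : P.[i0%:R] != 0.
  rewrite -rootE root_prod_XsubC; apply/negP => /mapP[j]; rewrite mem_enum in_setD1 => /andP[ji _] /eqP.
  by rewrite eqr_nat => /eqP/val_inj e; rewrite e eqxx in ji.
have U2 : (#|U| <= n.*2.+2)%N.
  by rewrite cardsU; apply: leq_trans (leq_subr _ _) _; apply: leq_trans (leq_add pn qn) _; rewrite addnn doubleS.
have Ps : (size P <= n.*2.+2)%N.
  by rewrite size_prod_XsubC size_map -cardE; move: U2; rewrite (cardsD1 i0) i0U add1n.
have zero l : (l < size P)%N -> \sum_i (p i - q i) * i%:R ^+ l = 0 :> R.
  move=> lP; have {lP} := leq_trans lP Ps; case: l => [|l] lt.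
    by under eq_bigr do rewrite expr0 mulr1; rewrite sumrB p1 q1 subrr.
  under eq_bigr do rewrite mulrBl; rewrite sumrB.
  by rewrite (mom (Ordinal (lt : (l < n.*2.+1)%N))) subrr.
have S1 : \sum_i (p i - q i) * P.[i%:R] = 0.
  under eq_bigr do rewrite horner_coef mulr_sumr.
  rewrite exchange_big /= big1 // => l _.
  rewrite (eq_bigr (fun i : 'I_k => P`_l * ((p i - q i) * i%:R ^+ l))); last by move=> i _; ring.
  by rewrite -mulr_sumr zero // mulr0.
move: S1; rewrite (bigD1 i0) //= big1 ?addr0 => [|i ii].
  by move/eqP; rewrite mulf_eq0 (negbTE Pi0) orbF subr_eq0 (negbTE pq).
have [iU|niU] := boolP (i \in U); first by rewrite Pi ?mulr0.
move: niU; rewrite !inE negb_or !negbK => /andP[/eqP -> /eqP ->].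
by rewrite subrr mul0r.
Qed.

(** * Lower bounds relative to a factor *)

Section RelativeBound.
Variables (R : realType) (X : Type) (d : X -> X -> R) (T : X -> X).
Variables (s : R) (N M : nat -> nat) (psi : forall n : nat, ('I_(M n) -> R) -> X).
Hypothesis dyn : dynsys d T.
Hypothesis psi_cont : forall n (x : 'I_(M n) -> R), cube x -> forall e : R, 0 < e ->
  exists2 r : R, 0 < r & forall y, cube y -> supdist x y < r -> d (psi x) (psi y) < e.
Hypothesis N_infty : forall K : nat, exists n0 : nat, forall n : nat, (n0 <= n)%N -> (K <= N n)%N.
Hypothesis MN_cvg : ((fun n => (M n)%:R / (N n)%:R : R) @ \oo --> s)%classic.
Hypothesis psi_expand : forall n (x y : 'I_(M n) -> R), cube x -> cube y ->
  supdist x y <= dN d T (N n) (psi x) (psi y).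
Let dm : is_metric d. Proof. by case: dyn. Qed.
Let dc : mcompact d. Proof. by case: dyn. Qed.

Lemma good_index (t : R) (K : nat) : 0 < t -> exists n, [/\ (K <= N n)%N, (0 < N n)%N, `|(M n)%:R - s * (N n)%:R| <= t * (N n)%:R
   & 1 <= t * (N n)%:R].
Proof.
move=> t0; have [k [k0 kP]] := large_nat t^-1.
have [n0 n0P] := N_infty (maxn K k).
move/cvgrPdist_le: (MN_cvg) => /(_ t t0) [n1 _ n1P].
exists (maxn n0 n1); have := n0P _ (leq_maxl n0 n1); rewrite geq_max => /andP[KN kN].
have := n1P (maxn n0 n1) (leq_maxr n0 n1); set n := maxn n0 n1 => /= h.
have N0 : (0 < N n)%N by exact: leq_trans kN.
have N0' : 0 < (N n)%:R :> R by rewrite ltr0n.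
split => //.
  rewrite -(ler_pdivrMr _ _ N0') -{2}(gtr0_norm N0') -normf_div mulrBl mulfK ?gt_eqF //.
  by rewrite distrC.
rewrite -ler_pdivrMl // mulr1; apply: le_trans kP _; by rewrite ler_nat.
Qed.

Section Relative.
Variables (Y : Type) (pi : X -> Y) (E : nat -> X -> X -> Prop) (c : R).
Hypothesis E_dec : forall j j' x y, (j <= j')%N -> E j' x y -> E j x y.
Hypothesis E_closed : forall j x y, ~ E j x y ->
  exists2 r, 0 < r & forall x' y', d x x' < r -> d y y' < r -> ~ E j x' y'.
Hypothesis E_fibre : forall x y, (forall j, E j x y) -> pi x = pi y.
Hypothesis E_map : forall j (t : R), 0 < t -> exists N0, forall N', (N0 <= N')%N ->
  exists m (G : X -> 'I_m -> R) eta, [/\ m%:R <= (c + t) * N'%:R, 0 < eta, forall a, mcontR d (G^~ a) &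
    forall x x0, (forall a, `|G x a - G x0 a| <= eta) -> forall i, (i < N')%N -> E j (iter i T x) (iter i T x0)].

Notation v L eps := (fibre_number pi dyn L eps).

(** A cover of a fibre also covers the points related by some [E j], and [tube] makes [j] uniform.
    The relations [E j] express closeness of images at finite precision, which finitely many real
    coordinates can certify. *)
Lemma uniform_cover L eps : 0 < eps -> exists j, forall x0, exists U : 'I_(v L eps) -> X -> Prop,
  (forall x, E j x x0 -> exists i, U i x) /\ (forall i x y, U i x -> U i y -> dN d T L x y <= eps).
Proof.
move=> eps0; have [U UP] := choice (fun y => fibre_numberP pi dyn L eps0 y).
have [y|x y xy|j jP] := @tube _ _ _ dm dc E (fun y x => exists j, U y j x) E_dec E_closed.
- by move=> x [j Ux]; have [r r0 rP] := mopen_dN dyn ((UP y).1 j).1 Ux; exists r => // z /rP; exists j.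
- exact: (UP y).2 (E_fibre xy).
exists j => x0; have [y yP] := jP x0; exists (U y); split=> // i x z Ux Uz.
have [r r0 rP] := ((UP y).1 i).2; apply: le_trans (ltW r0); exact: rP.
Qed.

(** A member is a choice of one set per block. The successor accounts for an incomplete last block,
    and a block starting at [N'] or later imposes nothing. *)
Lemma chained_cover L eps j N' (x0 : X) : 0 < eps -> (0 < L)%N ->
  (forall x0, exists U : 'I_(v L eps) -> X -> Prop,
    (forall x, E j x x0 -> exists i, U i x) /\ (forall i x y, U i x -> U i y -> dN d T L x y <= eps)) ->
  exists U : 'I_(v L eps ^ (N' %/ L).+1) -> X -> Prop,
    (forall x, (forall i, (i < N')%N -> E j (iter i T x) (iter i T x0)) -> exists i, U i x) /\
    (forall i x y, U i x -> U i y -> dN d T N' x y <= eps).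
Proof.
move=> eps0 L0 cov; set q := (N' %/ L).+1; have v0 := fibre_number_gt0 pi dyn L x0 eps0.
have [U UP] := choice (fun k : 'I_q => cov (iter (k * L) T x0)).
rewrite -(_ : #|{: {ffun 'I_q -> 'I_(v L eps)}}| = (v L eps ^ q)%N); last by rewrite card_ffun !card_ord.
exists (fun f x => forall k : 'I_q, (k * L < N')%N -> U k ((enum_val f : {ffun 'I_q -> 'I_(v L eps)}) k) (iter (k * L) T x)).
split=> [x Ex|f x y fx fy].
  have ex (k : 'I_q) : exists i, (k * L < N')%N -> U k i (iter (k * L) T x).
    have [kN|] := boolP (k * L < N')%N; last by exists (Ordinal v0).
    by have [i Ui] := (UP k).1 _ (Ex _ kN); exists i.
  have [g gP] := choice ex; exists (enum_rank [ffun k => g k]) => k kN.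
  by rewrite enum_rankK ffunE; apply: gP.
apply: dN_le => [|t tN]; first exact: ltW.
have kq : (t %/ L < q)%N by rewrite ltnS leq_div2r // ltnW.
have kN : (Ordinal kq * L < N')%N by apply: leq_ltn_trans (leq_divM _ _) tN.
rewrite {1 2}(divn_eq t L) addnC !iterD.
have := (UP (Ordinal kq)).2 _ _ _ (fx _ kN) (fy _ kN); apply: le_trans.
by apply: le_dN; rewrite ltn_mod.
Qed.

(** The waist inequality at time [N n], with [M n] close to [s * N n] and [m] at most
    [(c + t) * N n], divided by [N n]. The errors are multiples of the arbitrary [t];
    [s * ln (8 * expR 1)] is what remains of the factor (8 e) ^ M. *)
Theorem fibre_number_bound rho k eps L : 0 < rho -> rho <= 1 -> 0 < eps -> eps ^+ 2 <= rho ^+ k -> (0 < L)%N ->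
  (1 - rho) / 2 * k%:R * (s - c) <= ln (v L eps)%:R / L%:R + s * ln (8 * expR 1).
Proof.
move=> rho0 rho1 eps0 epsk L0; rewrite -subr_le0.
have x0 : X := @psi 0%N (fun=> 0).
have v0 := fibre_number_gt0 pi dyn L x0 eps0.
have lnv0 : 0 <= ln (v L eps)%:R :> R by rewrite ln_ge0 // ler1n.
pose C0 : R := ln (8 * expR 1).
have e1 : 0 < 8 * expR 1 :> R by rewrite mulr_gt0 // expR_gt0.
have C00 : 0 <= C0 by rewrite ln_ge0 //; have : 1 + 1 <= expR 1 :> R := expR_ge1Dx 1; lra.
have L0' : 0 < L%:R :> R by rewrite ltr0n.
set w := (1 - rho) / 2 * k%:R; have w0 : 0 <= w by rewrite mulr_ge0 // divr_ge0 // subr_ge0.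
apply: (@le0_of_small_multiples _ _ (3 * w + ln (v L eps)%:R + C0)) => t t0.
have lnX (a : R) (i : nat) : 0 < a -> ln (a ^+ i) = i%:R * ln a.
  by move=> a0; rewrite lnXn // mulr_natl.
have v0' : 0 < (v L eps)%:R :> R by rewrite ltr0n.
have [j jP] := uniform_cover L eps0.
have [N0 N0P] := E_map j t0.
have [n [N0n Nn0 Mn Nt]] := good_index N0 t0.
have [m [G [eta [mle eta0 Gc GE]]]] := N0P _ N0n.
have Nn0' : 0 < (N n)%:R :> R by rewrite ltr0n.
set q := (N n %/ L).+1.
have qle : q%:R * L%:R <= (N n)%:R + L%:R :> R.
  by rewrite -natrM -natrD ler_nat mulSn addnC leq_add2r leq_divM.
have key : w * ((M n)%:R - m%:R - 1) <= q%:R * ln (v L eps)%:R + (M n)%:R * C0.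
  have [mM|Mm] := leqP m.+1 (M n); last first.
    apply: le_trans (_ : 0 <= _); last by rewrite addr_ge0 // mulr_ge0.
    by rewrite mulr_ge0_le0 // -addrA -opprD natr1 subr_le0 ler_nat ltnW.
  have cardM : #|'I_(M n)| = (m.+1 + (M n - m.+1))%N by rewrite card_ord subnKC.
  have W : expR ((1 - rho) / 2 * ((M n - m.+1) * k)%:R) <= (v L eps ^ q)%:R * (8 * expR 1) ^+ M n.
    rewrite -[X in _ ^+ X]card_ord.
    apply: (@waist_of_map R X d 'I_(M n) m (M n - m.+1) dm dc cardM (dN d T (N n)) (@psi n) G) eta0 (ltW eps0) epsk _ => //.
    - move=> x x01 e e0'; have [r r0 rP] := psi_cont x01 e0'; exists r => // y y01 xy.
      by apply: rP => //; exact: supdist_lt.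
    - by move=> x y x01 y01 i; apply: le_trans (le_supdist x y i) _; exact: psi_expand.
    - move=> y0; have [U [Uc Us]] := chained_cover (N n) y0 eps0 L0 jP.
      by exists U; split=> // x xx; apply: Uc; exact: GE.
  have vq0 : 0 < (v L eps ^ q)%:R :> R by rewrite ltr0n expn_gt0 v0.
  have := W; rewrite -ler_ln ?posrE ?expR_gt0 ?mulr_gt0 ?exprn_gt0 //.
  rewrite expRK (lnM vq0 (exprn_gt0 _ e1)) (lnX _ (M n) e1) natrX (lnX _ q v0') -/C0.
  apply: le_trans; rewrite natrM (natrB _ mM) -[m.+1%:R]natr1 /w.
  by move: ((M n)%:R : R) (m%:R : R) (k%:R : R) => a b e; lra.
have qv : q%:R * ln (v L eps)%:R <= (N n)%:R * (ln (v L eps)%:R / L%:R) + ln (v L eps)%:R :> R.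
  rewrite -(ler_pM2r L0') mulrDl -!mulrA mulVf ?gt_eqF // mulr1.
  by have := ler_wpM2r lnv0 qle; rewrite mulrDl; lra.
move: Mn; rewrite ler_norml => /andP[Mn1 Mn2].
have h1 : w * ((s - c - 3 * t) * (N n)%:R) <= w * ((M n)%:R - m%:R - 1).
  by rewrite ler_wpM2l //; lra.
have h2 : (M n)%:R * C0 <= ((s + t) * (N n)%:R) * C0 by rewrite ler_wpM2r //; lra.
have h3 : ln (v L eps)%:R <= ln (v L eps)%:R * (t * (N n)%:R) :> R by rewrite ler_peMr.
by rewrite -(ler_pM2r Nn0'); rewrite -/C0; lra.
Qed.
End Relative.

Theorem relative_bound (Y : Type) (Yset : set Y) (pi : X -> Y) (E : nat -> X -> X -> Prop) (c : R) :
  (forall x, Yset (pi x)) ->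
  (forall x x', pi x = pi x' -> pi (T x) = pi (T x')) ->
  (forall j j' x y, (j <= j')%N -> E j' x y -> E j x y) ->
  (forall j x y, ~ E j x y ->
    exists2 r, 0 < r & forall x' y', d x x' < r -> d y y' < r -> ~ E j x' y') ->
  (forall x y, (forall j, E j x y) -> pi x = pi y) ->
  (forall j (t : R), 0 < t -> exists N0, forall N', (N0 <= N')%N ->
    exists m (G : X -> 'I_m -> R) eta, [/\ m%:R <= (c + t) * N'%:R, 0 < eta, forall a, mcontR d (G^~ a) &
      forall x x0, (forall a, `|G x a - G x0 a| <= eta) ->
        forall i, (i < N')%N -> E j (iter i T x) (iter i T x0)]) ->
  ((s - c)%:E <= lmdimM Yset pi T d)%E.
Proof.
move=> piY piT Edec Eclosed Efib Emap; have x0 : X := @psi 0%N (fun=> 0).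
apply: (lmdimM_ge (dyn := dyn) piT piY x0) => e e0.
have lnv0 eps L : 0 < eps -> 0 <= ln (fibre_number pi dyn L eps)%:R / L%:R :> R.
  by move=> eps0; rewrite divr_ge0 // ln_ge0 // ler1n fibre_number_gt0.
have lge eps : 0 < eps -> eps < 1 -> 0 < ln (1 / eps) :> R.
  by move=> eps0 eps1; rewrite ln_gt0 // ltr_pdivlMr // mul1r.
have [te|te] := leP (s - c - e) 0.
  exists 1 => // eps /andP[eps0 eps1] L L0; apply: le_trans (lnv0 eps L eps0).
  by rewrite mulr_le0_ge0 // ltW // lge.
set t := s - c in te *; have t0 : 0 < t by lra.
(* Close enough to 1 to lose at most [e / 2] of [t]; the 1/2 keeps it positive. *)
pose rho := Num.max (1 / 2) (1 - e / (2 * t)).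
have rho0 : 0 < rho by rewrite lt_max; apply/orP; left; lra.
have et0 : 0 < e / (2 * t) by rewrite divr_gt0 // mulr_gt0.
have rho1 : rho < 1 by rewrite gt_max; apply/andP; split; lra.
have rhot : t - e / 2 <= rho * t.
  apply: le_trans (_ : (1 - e / (2 * t)) * t <= _); last by rewrite ler_wpM2r ?(ltW t0) // le_max lexx orbT.
  by rewrite mulrBl mul1r invfM mulrA mulfVK ?gt_eqF.
(* Makes the terms without [ln (1 / eps)], namely [t / 2] and [s * ln (8 * expR 1)], together at
   most [e / 2 * ln (1 / eps)]. *)
pose C1 := (t + 2 * (s * ln (8 * expR 1))) / e.
exists (Num.min 1 (expR (- C1))) => [|eps]; first by rewrite lt_min ltr01 expR_gt0.
rewrite lt_min => /andP[eps0 /andP[eps1 epsC]] L L0.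
have [k [epsk kge]] := exponent_choice rho0 rho1 eps0 eps1.
have B := fibre_number_bound Edec Eclosed Efib Emap rho0 (ltW rho1) eps0 epsk L0.
have leC : C1 <= ln (1 / eps).
  rewrite div1r lnV ?posrE // lerNr -[leRHS]expRK ler_ln ?posrE ?expR_gt0 //; exact: ltW.
rewrite /C1 ler_pdivrMr // in leC.
have := ler_wpM2r (ltW t0) kge; rewrite -/t in B => kt.
have := ler_wpM2r (ltW (lge eps eps0 eps1)) rhot.
move: leC B kt; move: (ln (1 / eps)) (ln (8 * expR 1)) (ln _ / L%:R) (k%:R) => l C v kk.
clearbody rho t; lra.
Qed.

Lemma iter_shift (b : nat) (pi : X -> int -> 'I_b -> R) : (forall x, pi (T x) = (fun k => pi x (k + 1)%R)) ->
  forall i x k, pi (iter i T x) k = pi x (k + i%:Z).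
Proof.
move=> piT; elim=> [|i ih] x k /=; first by rewrite addr0.
by rewrite piT ih; congr (pi x _); rewrite -addrA -intS.
Qed.

(** [G] reads [pi x] at the times from [- j] to [N' + j]: [b] coordinates per unit of time, plus a
    boundary term absorbed by [t * N']. *)
Theorem cubical_shift_bound (b : nat) (pi : X -> int -> 'I_b -> R) :
  (forall x k i, 0 <= pi x k i <= 1) ->
  (forall k i, mcontR d (fun x => pi x k i)) ->
  (forall x, pi (T x) = (fun k => pi x (k + 1)%R)) ->
  ((s - b%:R)%:E <= lmdimM [set y : int -> 'I_b -> R | forall k i, (0 <= y k i <= 1)%R]%classic pi T d)%E.
Proof.
move=> pi01 pic piT.
pose E (j : nat) x y := forall k i, `|k| <= j%:Z -> `|pi x k i - pi y k i| <= j.+1%:R^-1.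
apply: (@relative_bound _ _ _ E) => //.
- by move=> x x' e; rewrite !piT e.
- move=> j j' x y jj h k i kj; apply: le_trans (h k i _) _; first by apply: le_trans kj _; rewrite lez_nat.
  by rewrite lef_pV2 ?posrE ?ltr0Sn // ler_nat.
- move=> j x y /existsNP[k /existsNP[i /not_implyP[kj /negP]]]; rewrite -ltNge => h.
  have [r r0 rP] := gap_open (pic k i) h; exists r => // x' y' xx yy /(_ k i kj); apply/negP.
  by rewrite -ltNge; apply: rP.
- move=> x y Exy; apply/funext => k; apply/funext => i.
  apply/eqP; rewrite -subr_eq0 -normr_le0; apply: (@le0_of_inverse _ `|k|%N) => j kj.
  by apply: Exy; rewrite -abszE lez_nat.
- move=> j t t0; have [N0 [_ N0P]] := large_nat ((j.*2.+1 * b)%:R / t).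
  exists N0 => N' NN; pose I := ('I_(N' + j.*2.+1) * 'I_b)%type.
  exists #|{: I}|, (fun x a => pi x ((enum_val a : I).1%:Z - j%:Z) (enum_val a : I).2), j.+1%:R^-1; split.
  + rewrite card_prod !card_ord mulnDl natrD natrM mulrDl [X in _ <= X + _]mulrC lerD2l.
    by rewrite mulrC -ler_pdivrMr //; apply: le_trans N0P _; rewrite ler_nat.
  + by rewrite invr_gt0 ltr0Sn.
  + by move=> a; exact: pic.
  + move=> x x0 xx i iN k a kj; rewrite !(iter_shift piT).
    have kb : (`|(k + i%:Z + j%:Z)%R|%N < N' + j.*2.+1)%N by move: kj iN; rewrite -addnn; clear; lia.
    have := xx (enum_rank ((Ordinal kb, a) : I)); rewrite enum_rankK /=.
    suff -> : `|(k + i%:Z + j%:Z)%R|%N%:Z - j%:Z = k + i%:Z by [].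
    by move: kj; clear; lia.
Qed.

(** A mean width below [s - e] would give, at a good index, a width at time [N n] below [M n],
    against [width_of_cube]. *)
Theorem mdim_bound : (s%:E <= mdim T d)%E.
Proof.
have x0 : X := @psi 0%N (fun=> 0).
have d0 : 0 < 1 / 4 :> R by lra.
apply: (mdim_ge dyn x0 d0) => eps /andP[eps0 eps4].
apply/lee_subgt0Pr => e e0; rewrite -EFinB leNgt; apply/negP => lt.
have : nbhs (mean_width d T eps) [set x : \bar R | (x < (s - e)%:E)%E]%classic.
  by apply: open_nbhs_nbhs; split; [exact: open_ereal_lt_ereal | exact: lt].
move/(mean_width_cvg dyn x0) => [K _ KP].
have [n [Kn Nn0 Mn _]] := good_index K.+1 e0.
have := KP (N n).-1 => /=; rewrite -ltnS prednK // => /(_ Kn).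
have Nn0' : 0 < (N n)%:R :> R by rewrite ltr0n.
have le : ((M n)%:R%:E <= Widim (dN d T (N n)) eps)%E.
  have [[-> _]|[k wk ->]] := WidimP (dN d T (N n)) eps; first exact: leey.
  by rewrite lee_fin ler_nat; apply: (width_of_cube dyn Nn0 (ltW eps4) (@psi_cont n) (@psi_expand n) wk).
apply/negP; rewrite -leNgt; apply: le_trans (_ : ((M n)%:R%:E * ((N n)%:R^-1)%:E <= _)%E); last first.
  by rewrite lee_wpmul2r // lee_fin invr_ge0.
rewrite -EFinM lee_fin ler_pdivlMr //.
by move: Mn; rewrite ler_norml => /andP[? ?]; lra.
Qed.

Section Factor.
Variables (Y : Type) (dY : Y -> Y -> R) (S : Y -> Y) (pi : X -> Y).
Hypothesis dynY : dynsys dY S.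
Hypothesis pic : mcont d dY pi.
Hypothesis piT : forall x, pi (T x) = S (pi x).
Let dmY : is_metric dY. Proof. by case: dynY. Qed.

Lemma pi_iterT i x : pi (iter i T x) = iter i S (pi x).
Proof. by elim: i => //= i <-. Qed.

(** The moments separate the points of the complex, so each fibre of [G] lies over one fibre of the
    map to the complex; [separation] turns this into closeness at a uniform scale. *)
Lemma width_moments (N' k : nat) (eps : R) : has_width (dN dY S N') eps k ->
  exists (G : X -> 'I_(k.*2.+1) -> R) eta, [/\ 0 < eta, forall a, mcontR d (G^~ a) &
    forall x y, (forall a, `|G x a - G y a| <= eta) -> dN dY S N' (pi x) (pi y) < eps].
Proof.
move=> [l [K [f [Ks Kd fK fc ff]]]].
pose G x (a : 'I_(k.*2.+1)) : R := \sum_i f (pi x) i * i%:R ^+ a.+1.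
have Gc a : mcontR d (G^~ a).
  move=> x e e0; pose C : R := \sum_(i < l) i%:R ^+ a.+1.
  have C0 : 0 <= C by apply: sumr_ge0 => i _; rewrite exprn_ge0.
  have e'0 : 0 < e / (C + 1) by rewrite divr_gt0 // ltr_wpDl.
  have [r r0 rP] := mcontR_family (fun i => mcontR_dN dynY (fc i)) (pi x) e'0.
  have [r' r'0 rP'] := pic x r0; exists r' => // y /rP' /rP h.
  rewrite /= /G -sumrB; apply: le_lt_trans (ler_norm_sum _ _ _) _.
  apply: le_lt_trans (_ : \sum_(i < l) e / (C + 1) * i%:R ^+ a.+1 < _).
    by apply: ler_sum => i _; rewrite -mulrBl normrM (ger0_norm (exprn_ge0 _ _)) // ler_wpM2r ?exprn_ge0.
  by rewrite -mulr_sumr -/C mulrAC ltr_pdivrMr ?ltr_wpDl // ltr_pM2l // ltrDl.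
have [|||||eta eta0 etaP] := @separation R X d dm dc _ G (fun x y => dN dY S N' (pi x) (pi y)) eps.
- exact: Gc.
- move=> x e e0; have [r r0 rP] := dN_cont dynY N' (pi x) e0.
  by have [r' r'0 rP'] := pic x r0; exists r' => // y /rP'; apply: rP.
- by move=> x y; apply: dN_sym dynY _ _ _.
- by move=> x y z; apply: dN_tri dynY _ _ _ _.
- move=> p; have [[x Gx]|no] := pselect (exists x, G x = p); last first.
    by exists (eps - 1) => [|x y Gx]; [lra | case: no; exists x].
  have fE y : G y = p -> f (pi y) = f (pi x).
    move=> Gy; have [_ [s1 S1]] := fK (pi y); have [_ [s2 S2]] := fK (pi x).
    apply: (moments_inj s1 s2 (Kd.2 _ S1) (Kd.2 _ S2)) => a.
    by have := congr1 (@^~ a) Gy; rewrite -Gx.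
  have [r r0 rP] := ff (f (pi x)); exists r => // y z Gy Gz.
  by apply: rP; apply: fE.
- by exists G, eta; split.
Qed.

(** Distinguishing points of a complex of dimension [k] by real coordinates takes [2 k + 1] of them,
    whence the factor 2. If the mean dimension is infinite the left side is [-oo]. *)
Theorem factor_bound : (s%:E - 2%:E * mdim S dY <= lmdimM [set: Y]%classic pi T d)%E.
Proof.
have x0 : X := @psi 0%N (fun=> 0).
have y0 := pi x0.
have m0 : (0 <= mdim S dY)%E by apply: (mdim_ge dynY y0 ltr01) => eps _; apply: mean_width_ge0.
case mE : (mdim S dY) m0 => [c| |] //= c0; last first.
  by rewrite gt0_muley ?lte_fin // leNye.
rewrite lee_fin in c0; rewrite -[X in (X <= _)%E]/((s - 2 * c)%:E).
pose E (j : nat) x y := dY (pi x) (pi y) <= j.+1%:R^-1.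
apply: (relative_bound (E := E)) => //.
- by move=> x x' e; rewrite !piT e.
- by move=> j j' x y jj h; apply: le_trans h _; rewrite lef_pV2 ?posrE ?ltr0Sn // ler_nat.
- move=> j x y /negP; rewrite -ltNge => h.
  have [r r0 rP] := dist_gt_open (dist_sym dmY) (dist_tri dmY) pic h.
  by exists r => // x' y' xx yy; apply/negP; rewrite -ltNge; apply: rP.
- move=> x y Exy; have [_ dY0 _ _] := dmY; apply/dY0/eqP; rewrite eq_le (dist_ge0 dmY) andbT.
  by apply: (@le0_of_inverse _ 0) => j _; apply: Exy.
move=> j t t0; have eps0 : 0 < j.+1%:R^-1 :> R by rewrite invr_gt0 ltr0Sn.
have : nbhs (mean_width dY S j.+1%:R^-1) [set x : \bar R | (x < (c + t / 4)%:E)%E]%classic.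
  apply: open_nbhs_nbhs; split; first exact: open_ereal_lt_ereal.
  apply: (@le_lt_trans _ _ c%:E); last by rewrite lte_fin; lra.
  by rewrite -mE; apply: mean_width_le_mdim.
move/(mean_width_cvg dynY y0) => [K _ KP].
(* With [k] below [c + t / 4] per unit of time, twice [k] leaves [t / 2] per unit of time, and this
   has to pay for the one extra coordinate. *)
have [K' [_ K'P]] := large_nat (2 / t).
exists (maxn K.+1 K') => -[|N']; first by rewrite geq_max ltn0.
rewrite geq_max => /andP[KN K'N].
have := KP N' KN => /=; have N0 : 0 < N'.+1%:R :> R by rewrite ltr0Sn.
have [[-> _]|[k wk ->]] := WidimP (dN dY S N'.+1) j.+1%:R^-1.
  by rewrite gt0_mulye // lte_fin invr_gt0.
rewrite -EFinM lte_fin ltr_pdivrMr // => kN.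
have [G [eta [eta0 Gc GE]]] := width_moments wk.
exists k.*2.+1, G, eta; split=> // [|x x1 xx i iN].
  have h : 2 <= N'.+1%:R * t.
    by rewrite -ler_pdivrMr //; apply: le_trans K'P _; rewrite ler_nat.
  by rewrite -[_.+1%:R]natr1 -muln2 natrM; lra.
by rewrite /E !pi_iterT; apply: le_trans (ltW (GE _ _ xx)); apply: le_dN.
Qed.
End Factor.
End RelativeBound.

Local Open Scope classical_set_scope.
Local Open Scope ring_scope.

Theorem theorem4p1 (R : realType) (s : R) (X : Type) (d : X -> X -> R) (T : X -> X)
  (N M : nat -> nat) (psi : forall n : nat, ('I_(M n) -> R) -> X) :
  0 <= s ->
  dynsys d T ->
  (* each psi_n : [0,1]^{M_n} -> X is continuous (sup-norm on the cube) *)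
  (forall n (x : 'I_(M n) -> R), cube x -> forall e : R, 0 < e ->
     exists2 r : R, 0 < r & forall y, cube y -> supdist x y < r ->
       d (psi n x) (psi n y) < e) ->
  (* N_n -> +oo *)
  (forall K : nat, exists n0 : nat, forall n : nat, (n0 <= n)%N -> (K <= N n)%N) ->
  (* M_n / N_n -> s *)
  ((fun n => (M n)%:R / (N n)%:R : R) @ \oo --> s) ->
  (forall n (x y : 'I_(M n) -> R), cube x -> cube y ->
     supdist x y <= dN d T (N n) (psi n x) (psi n y)) ->
  [/\ (s%:E <= mdim T d)%E,
      (* (2) maps into (([0,1]^b)^Z, shift) *)
      forall (b : nat) (pi : X -> int -> 'I_b -> R),
        (forall x k i, 0 <= pi x k i <= 1) ->
        (forall k i, mcontR d (fun x => pi x k i)) ->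
        (forall x, pi (T x) = (fun k => pi x (k + 1)%R)) ->
        ((s - b%:R)%:E <= lmdimM [set y : int -> 'I_b -> R | forall k i, (0 <= y k i <= 1)%R]
                               pi T d)%E &
      (* (3) maps into an arbitrary dynamical system (Y,S) *)
      forall (Y : Type) (dY : Y -> Y -> R) (S : Y -> Y) (pi : X -> Y),
        dynsys dY S -> mcont d dY pi -> (forall x, pi (T x) = S (pi x)) ->
        (s%:E - 2%:E * mdim S dY <= lmdimM [set: Y] pi T d)%E].
Proof.
move=> s0 dyn psic Ninf MN psie; split.
- exact: mdim_bound dyn psic Ninf MN psie.
- exact: cubical_shift_bound dyn psic Ninf MN psie.
- exact: factor_bound dyn psic Ninf MN psie.
Qed.
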